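(* There exist positive constants $c_0,c_1,C_0,C_1,C_2$ (depending only on the distribution of the entries of the sensing vectors) such that the following holds. Let $a_1,\dots,a_m$ be drawn from the sub-Gaussian sampling model, let $\mathcal A(M)=(a_i^\top M a_i)_{i=1}^m$, and suppose $m>c_1 nr$. Then with probability at least $1-C_0\exp(-c_0 m)$ the following holds simultaneously for all positive semidefinite $\Sigma\in\mathbb{R}^{n\times n}$, all $\epsilon_1\ge0$ and all noise vectors $\eta\in\mathbb{R}^m$ with $\|\eta\|_1\le\epsilon_1$: letting $y=\mathcal A(\Sigma)+\eta$, any minimizer $\hat\Sigma$ of $$\min_{M}\ \operatorname{Tr}(M)\quad\text{subject to}\quad M\succeq0,\ \ \|y-\mathcal A(M)\|_1\le\epsilon_1$$ satisfies $$\|\hat\Sigma-\Sigma\|_{\mathrm F}\le C_1\frac{\|\Sigma-\Sigma_r\|_*}{\sqrt r}+C_2\frac{\epsilon_1}{m}.$$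
   Context: Sub-Gaussian sampling model: the sensing vectors $a_1,a_2,\dots\in\mathbb{R}^n$ are i.i.d. copies of a random vector $z=(z_1,\dots,z_n)^\top$ whose entries $z_j$ are i.i.d. sub-Gaussian random variables with $\mathbb{E}[z_j]=0$, $\mathbb{E}[z_j^2]=1$ and $\mu_4:=\mathbb{E}[z_j^4]>1$. $\Sigma_r$ denotes a best rank-$r$ approximation of $\Sigma$ in Frobenius norm. $\|\cdot\|_*$ is the nuclear norm, $\|\cdot\|_{\mathrm F}$ the Frobenius norm, and $\|v\|_1$ the $\ell_1$ norm of a vector. *)

(* Defs.v *)
From HB Require Import structures.
From mathcomp Require Import all_boot all_order all_algebra.
From mathcomp Require Import all_classical all_reals all_analysis.
Set Implicit Arguments. Unset Strict Implicit. Unset Printing Implicit Defensive.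
Import Order.TTheory GRing.Theory Num.Theory.
Local Open Scope ring_scope.
Local Open Scope classical_set_scope.

Section Defs.
Variable R : realType.

Definition subgaussian_law (mu : probability R R) : Prop :=
  exists K : R, 0 < K /\
    (\int[mu]_x (expR (x ^+ 2 / K ^+ 2))%:E <= 2%:E)%E.

Definition entry_law (mu : probability R R) : Prop :=
  [/\ subgaussian_law mu,
      mu.-integrable setT (fun x => x%:E),
      (\int[mu]_x x%:E = 0)%E,
      (\int[mu]_x (x ^+ 2)%:E = 1)%E &
      (1%:E < \int[mu]_x (x ^+ 4)%:E)%E].

Definition mutually_independent (d : measure_display) (T : measurableType d)
    (P : probability T R) (I : finType) (X : I -> {RV P >-> R}) : Prop :=
  forall (A : {set I}) (B : I -> set R), (forall i, measurable (B i)) ->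
    fine (P (\bigcap_(i in [set` A]) (X i @^-1` B i))) =
    \prod_(i in A) fine (P (X i @^-1` B i)).

Definition has_law (d : measure_display) (T : measurableType d)
    (P : probability T R) (X : {RV P >-> R}) (mu : probability R R) : Prop :=
  forall B : set R, measurable B -> P (X @^-1` B) = mu B.

Definition psd (n : nat) (M : 'M[R]_n) : Prop :=
  M^T = M /\ forall v : 'cV[R]_n, 0 <= (v^T *m M *m v) 0 0.

Definition frob (p q : nat) (M : 'M[R]_(p, q)) : R :=
  Num.sqrt (\sum_(i < p) \sum_(j < q) M i j ^+ 2).

Definition l1norm (m : nat) (v : 'I_m -> R) : R := \sum_(i < m) `|v i|.

(** s lists the singular values of M (with multiplicity): the s i are >= 0
    and their squares are the eigenvalues (roots of the characteristic
    polynomial, with multiplicity) of M^T M. *)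
Definition singular_values (n : nat) (M : 'M[R]_n) (s : 'I_n -> R) : Prop :=
  (forall i, 0 <= s i) /\
  char_poly (M^T *m M) = \prod_(i < n) ('X - (s i ^+ 2)%:P).

Definition nuclear_norm_is (n : nat) (M : 'M[R]_n) (x : R) : Prop :=
  exists s, singular_values M s /\ x = \sum_(i < n) s i.

Definition best_rank_approx (n r : nat) (S Sr : 'M[R]_n) : Prop :=
  (\rank Sr <= r)%N /\
  forall M : 'M[R]_n, (\rank M <= r)%N -> frob (S - Sr) <= frob (S - M).

Definition meas (m n : nat) (a : 'I_m -> 'cV[R]_n) (M : 'M[R]_n) : 'I_m -> R :=
  fun i => ((a i)^T *m M *m a i) 0 0.

Definition feasible (m n : nat) (a : 'I_m -> 'cV[R]_n) (y : 'I_m -> R)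
    (eps1 : R) (M : 'M[R]_n) : Prop :=
  psd M /\ l1norm (fun i => y i - meas a M i) <= eps1.

Definition is_minimizer (m n : nat) (a : 'I_m -> 'cV[R]_n) (y : 'I_m -> R)
    (eps1 : R) (Sh : 'M[R]_n) : Prop :=
  feasible a y eps1 Sh /\
  forall M, feasible a y eps1 M -> \tr Sh <= \tr M.

End Defs.

(* Main.v *)
Require Import Defs.
From HB Require Import structures.
From mathcomp Require Import all_boot all_order all_algebra.
From mathcomp Require Import all_classical all_reals all_analysis.
From mathcomp Require Import measurable_realfun zify ring lra.
Import Order.TTheory GRing.Theory Num.Theory.
Local Open Scope ring_scope.
Local Open Scope classical_set_scope.
Set Implicit Arguments. Unset Strict Implicit. Unset Printing Implicit Defensive.

(** Differences of two measurements cancel the trace: for k < p = m/2 put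
    Y_k(M) = a_k^T M a_k - a_(p+k)^T M a_(p+k) and f(M) = sum_k |Y_k(M)|.
    For a fixed symmetric M, Y_k(M) is a centred quadratic form in independent
    sub-Gaussian variables; its second moment is at least a multiple of |M|_F^2
    because mu_4 > 1, and a decoupling argument bounds its exponential moments.
    Chernoff bounds then give c p |M|_F <= f(M) <= C p |M|_F with probability
    1 - 2 exp(-c' p).

    Symmetrized products u v^T of points of a finite lattice of exp(O(n)) points,
    whose convex hull contains the unit ball, serve as atoms: a positive
    semidefinite A is a nonnegative combination of atoms of total weight tr A.
    A union bound extends the two-sided estimate to all sums of N = O(r) atoms and
    their differences.  If H has an atomic decomposition of weight W, sampling N
    atoms from it (Maurey's method) gives c p |H|_F <= f(H) + 8 C p W / sqrt N.

    For a minimizer and H = Sh - S, let P be the orthogonal projection on the row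
    space of S_r and Q = 1 - P.  Since tr H <= 0 and tr (S Q) = tr ((S - S_r) Q)
    is at most the nuclear norm of S - S_r, the block Q H Q = Q Sh Q - Q S Q has
    small weight, the rest of H has weight O(sqrt r |H|_F), and f(H) <= 2 eps1. *)

(** The mean of a_i^T M a_i is tr M, which is not comparable to |M|_F; this is the obstacle that
    pairing removes. The price is that the diagonal of M must stay visible: for entries equal to 1
    or -1, all differences vanish on diagonal matrices, and mu_4 > 1 excludes exactly this.
    Uniformity over Sigma, the noise level and the noise holds because randomness is used only for a
    finite family of matrices; everything after that event is deterministic. The family has exp(O(n
    N)) members, so N proportional to r is what m > c1 n r can pay for in the union bound. The part
    of Maurey's error proportional to |H|_F must stay below c p |H|_F / 2; since W is at most 3 sqrt
    r |H|_F plus twice the nuclear norm, this asks for N = L r with sqrt L >= 48 C / c. Spectral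
    theory serves only to bound tr (M Q) by the nuclear norm; positive semidefinite matrices are
    decomposed by Schur complements. *)

(** * Independence of functions of disjoint blocks of coordinates *)

Section independence.
Context (R : realType) (d : measure_display) (T : measurableType d)
  (P : probability T R) (I : finType) (X : I -> {RV P >-> R}).

Definition cylinders (A : {set I}) : set (set T) :=
  [set U | exists2 B : I -> set R, (forall i, measurable (B i)) &
     U = \bigcap_(i in [set` A]) (X i @^-1` B i)].

(** Dependence on the coordinates in [A] is expressed as measurability for the sigma-algebra they
    generate, so the closure properties of measurable functions apply to it unchanged. *)
Definition depends_on d' (V : measurableType d') (A : {set I}) (f : T -> V) :=
  measurable_fun setT (f : g_sigma_algebraType (cylinders A) -> V).

Lemma cylinders_setI (A : {set I}) : setI_closed (cylinders A).
Proof.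
move=> _ _ [B mB ->] [C mC ->]; exists (fun i => B i `&` C i).
  by move=> i; exact: measurableI.
by rewrite -bigcapI.
Qed.

Lemma cylinders_measurable (A : {set I}) U : cylinders A U -> measurable U.
Proof.
move=> [B mB ->]; apply: fin_bigcap_measurable => //.
by move=> i _; exact: measurable_funPTI.
Qed.

Lemma cylinders_sub (A B : {set I}) : A \subset B ->
  cylinders A `<=` cylinders B.
Proof.
move=> AB _ [C mC ->].
exists (fun i => if i \in A then C i else setT).
  by move=> i; case: ifP.
apply/seteqP; split=> w h i /= iA; last first.
  by have := h i (fintype.subsetP AB i iA); rewrite iA.
by case: ifP => // iA'; exact: h.
Qed.

Lemma cylinders_sigma_measurable (A : {set I}) U :
  <<s cylinders A >> U -> measurable U.
Proof.
apply: smallest_sub; last exact: cylinders_measurable.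
exact: sigma_algebra_measurable.
Qed.

Lemma depends_on_measurable d' (V : measurableType d') (A : {set I})
  (f : T -> V) : depends_on A f -> measurable_fun setT f.
Proof.
move=> mf _ B mB; apply: (@cylinders_sigma_measurable A).
exact: (mf measurableT B mB).
Qed.

Lemma depends_on_sub d' (V : measurableType d') (A B : {set I})
  (f : T -> V) : A \subset B -> depends_on A f -> depends_on B f.
Proof.
move=> AB mf _ S mS; have := mf measurableT S mS.
apply: sub_sigma_algebra2; exact: cylinders_sub.
Qed.

Lemma depends_on_self (A : {set I}) i : i \in A -> depends_on A (X i).
Proof.
move=> iA _ S mS; apply: sub_sigma_algebra.
exists (fun j => if j == i then S else setT).
  by move=> j; case: ifP.
rewrite setTI; apply/seteqP; split=> w h.
  by move=> j /= jA; case: eqP => // ->.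
by have := h i iA; rewrite /= eqxx.
Qed.

Hypothesis indX : mutually_independent X.

Lemma cylinders_indep (A B : {set I}) U V : [disjoint A & B]%B ->
  cylinders A U -> cylinders B V -> P (U `&` V) = (P U * P V)%E.
Proof.
move=> AB [C mC ->] [D mD ->].
pose F i := if i \in A then C i else D i.
have mF i : measurable (F i) by rewrite /F; case: ifP.
have m (S : {set I}) (G : I -> set R) : (forall i, measurable (G i)) ->
  measurable (\bigcap_(i in [set` S]) (X i @^-1` G i)).
  by move=> mG; apply: (@cylinders_measurable S); exists G.
have -> : \bigcap_(i in [set` A]) (X i @^-1` C i) `&`
   \bigcap_(i in [set` B]) (X i @^-1` D i) =
   \bigcap_(i in [set` (A :|: B)%SET]) (X i @^-1` F i).
  apply/seteqP; split=> [w [h1 h2] i /=|w h].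
    rewrite inE /F; case: ifP => [iA _|_ /= iB]; first exact: h1.
    exact: h2.
  split=> i /= iS; have := h i; rewrite /= inE iS /= ?orbT /F ?iS; first exact.
  by rewrite (disjointFl AB iS); exact.

rewrite -(fineK (fin_num_measure P _ (m (A :|: B)%SET _ mF))) -(fineK (fin_num_measure P _ (m A _ mC))).
rewrite -(fineK (fin_num_measure P _ (m B _ mD))) -EFinM; congr EFin.
rewrite (indX _ mF) (indX A mC) (indX B mD) (big_setID A)/=; congr (_ * _).
  apply: congr_big => // i; first by rewrite !inE; case: (i \in A) => //; rewrite andbF.
  by rewrite !inE => /andP[_ iA]; rewrite /F iA.
apply: congr_big => // i; rewrite !inE.
  by case: (boolP (i \in A)) => //= iA; rewrite (disjointFr AB iA) ?andbF.
by move=> /andP[/negbTE iA _]; rewrite /F iA.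
Qed.

Let indep_lambda (V : set T) : measurable V ->
  lambda_system setT [set U | measurable U /\ P (U `&` V) = (P U * P V)%E].
Proof.
move=> mV; apply/dynkin_lambda_system; split.
- by split=> //; rewrite setTI probability_setT mul1e.
- move=> U [mU UV]; split; first exact: measurableC.
  rewrite setIC -setDE measureD ?probability_setC//; last first.
    exact: le_lt_trans (probability_le1 _ mV) (ltry _).
  have pV : P V \is a fin_num by exact: fin_num_measure.
  have pU : P U \is a fin_num by exact: fin_num_measure.
  transitivity (P V - P U * P V)%E; first by rewrite -UV [V `&` U]setIC.
  move: pV pU; move: (P V) (P U) => v u /fineK <- /fineK <-.
  by rewrite -EFinM -EFinB -[1%E]/(1%:E) -EFinB -EFinM; congr EFin; ring.
- move=> F tF mF; split; first by apply: bigcup_measurable => n _; case: (mF n).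
  have mF' n : measurable (F n) by case: (mF n).
  have mFV n : measurable (F n `&` V) by exact: measurableI.
  rewrite setI_bigcupl.
  rewrite (measure_bigcup P setT F)// (measure_bigcup P setT (fun n => F n `&` V))//;
    last exact: trivIset_setIr.
  have pV : P V \is a fin_num by exact: fin_num_measure.
  rewrite muleC -(fineK pV) -nneseriesZl//.
  by apply: eq_eseriesr => n _; rewrite fineK// muleC; exact: (mF n).2.
Qed.

(** The pi-lambda theorem is applied twice: the events independent of a fixed cylinder form a Dynkin
    class, which frees [U]; with [U] fixed in its sigma-algebra, the same argument frees [V]. *)
Lemma cylinders_sigma_indep (A B : {set I}) U V : [disjoint A & B]%B ->
  <<s cylinders A >> U -> <<s cylinders B >> V -> P (U `&` V) = (P U * P V)%E.
Proof.
move=> AB sU sV.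
have h V' : cylinders B V' -> <<s cylinders A >> `<=`
    [set U | measurable U /\ P (U `&` V') = (P U * P V')%E].
  move=> cV'; apply: lambda_system_subset => //.
  - exact: cylinders_setI.
  - by apply: indep_lambda; exact: cylinders_measurable cV'.
  - move=> U' cU'; split; first exact: cylinders_measurable cU'.
    exact: cylinders_indep AB cU' cV'.
have mU := cylinders_sigma_measurable sU.
have : <<s cylinders B >> `<=`
    [set V | measurable V /\ P (V `&` U) = (P V * P U)%E].
  apply: lambda_system_subset => //.
  - exact: cylinders_setI.
  - exact: indep_lambda.
  - move=> V' cV'; split; first exact: cylinders_measurable cV'.
    by rewrite setIC muleC; exact: (h _ cV' _ sU).2.
by move=> /(_ _ sV)[_ UV]; rewrite setIC muleC.
Qed.

(** The law of [(f, g)] agrees with the product of the two laws on rectangles, so they coincide and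
    Tonelli applies. The iterated integral over two copies of the sample space plays the part of
    conditioning on [g]. *)
Lemma ge0_expect_indep d1 d2 (V1 : measurableType d1) (V2 : measurableType d2)
    (A B : {set I}) (f : T -> V1) (g : T -> V2) (h : V1 * V2 -> \bar R) :
  [disjoint A & B]%B -> depends_on A f -> depends_on B g ->
  measurable_fun [set: (V1 * V2)%type] h -> (forall z, (0 <= h z)%E) ->
  (\int[P]_w h (f w, g w) = \int[P]_w' \int[P]_w h (f w, g w'))%E.
Proof.
move=> AB df dg mh h0.
have mf := depends_on_measurable df; have mg := depends_on_measurable dg.
pose F : {mfun T >-> V1} := HB.pack f (isMeasurableFun.Build _ _ _ _ _ mf).
pose G : {mfun T >-> V2} := HB.pack g (isMeasurableFun.Build _ _ _ _ _ mg).
have mfg : measurable_fun setT (fun w => (f w, g w)) by exact: measurable_fun_pair.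
pose FG : {mfun T >-> (V1 * V2)%type} :=
  HB.pack (fun w => (f w, g w)) (isMeasurableFun.Build _ _ _ _ _ mfg).
have E U : measurable U ->
    (distribution P F \x distribution P G)%E U = distribution P FG U.
  apply: product_measure_unique => S1 S2 mS1 mS2.
  apply: (cylinders_sigma_indep (U := f @^-1` S1) (V := g @^-1` S2) AB).
    by have := df measurableT S1 mS1; rewrite setTI.
  by have := dg measurableT S2 mS2; rewrite setTI.
transitivity (\int[distribution P FG]_z h z)%E.
  by rewrite ge0_integral_distribution.
transitivity (\int[(distribution P F \x distribution P G)%E]_z h z)%E.
  by apply: eq_measure_integral => U mU _; first [exact: E|exact/esym/E].
rewrite fubini_tonelli2// /fubini_G ge0_integral_distribution//; last 2 first.
- exact: measurable_fun_fubini_tonelli_G.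
- by move=> y; exact: integral_ge0.
apply: eq_integral => w _ /=; rewrite ge0_integral_distribution//.
exact: measurableT_comp.
Qed.

Lemma ge0_expectM (A B : {set I}) (f g : T -> R) :
  [disjoint A & B]%B -> depends_on A f -> depends_on B g ->
  (forall w, 0 <= f w) -> (forall w, 0 <= g w) ->
  (\int[P]_w (f w * g w)%:E = \int[P]_w (f w)%:E * \int[P]_w (g w)%:E)%E.
Proof.
move=> AB df dg f0 g0.
have mf := depends_on_measurable df; have mg := depends_on_measurable dg.
have mM : measurable_fun [set: R * R] (fun z => (`|z.1| * `|z.2|)%:E).
  apply/measurable_EFinP; by apply: measurable_funM; exact: measurableT_comp.
transitivity (\int[P]_w' \int[P]_w (`|f w| * `|g w'|)%:E)%E.
  rewrite -(@ge0_expect_indep _ _ _ _ A B f g _ AB df dg mM)//=.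
  by apply: eq_integral => w _; rewrite !ger0_norm.
transitivity (\int[P]_w' ((g w')%:E * \int[P]_w (f w)%:E))%E.
  apply: eq_integral => w' _; rewrite ger0_norm//.
  rewrite -ge0_integralZl//; last 3 first.
  - exact/measurable_EFinP.
  - by move=> w _; rewrite lee_fin.
  - by rewrite lee_fin.
  by apply: eq_integral => w _; rewrite ger0_norm// mulrC.
rewrite ge0_integralZr//.
- by rewrite muleC.
- exact/measurable_EFinP.
- by move=> w _; rewrite lee_fin.
- by apply: integral_ge0 => w _; rewrite lee_fin.
Qed.

End independence.

(** * Elementary inequalities and expectations of nonnegative functions *)

(** A second-order Taylor bound on the whole line: for a centred variable the term [y] integrates to
    zero and only the quadratic remainder is left. *)
Lemma expR_le_sqr (R : realType) (y : R) :
  expR y <= 1 + y + 2 * (y ^+ 2 * expR `|y|).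
Proof.
have [y1|y1] := lerP y (-1).
  have : expR y <= 1 by rewrite -expR0 ler_expR; lra.
  have : 1 <= expR `|y| by rewrite -expR0 ler_expR.
  by nra.
have [y1'|y1'] := lerP 1 y.
  have h : 1 <= y ^+ 2 by nra.
  have y0 : 0 <= y by lra.
  by have := ler_peMl (expR_ge0 y) h; have := expR_ge0 y; rewrite (ger0_norm y0); lra.
(* For |y| < 1, exp y is at most (1 - y/2)^-2, because 1 - y/2 <= exp(-y/2); this is then compared
   with the polynomial. *)
suff h : expR y <= 1 + y + 2 * y ^+ 2.
  apply: le_trans h _; rewrite lerD2l ler_pM2l// ler_peMr ?sqr_ge0//.
  by rewrite -expR0 ler_expR.
have h2 : expR (- (y / 2)) >= 1 - y / 2.
  by have := expR_ge1Dx (- (y / 2)); lra.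
have h3 : 1 = expR y * (expR (- (y / 2)) * expR (- (y / 2))).
  by rewrite -!expRD (_ : y + _ = 0) ?expR0//; lra.
have h4 : (1 - y / 2) ^+ 2 <= expR (- (y / 2)) * expR (- (y / 2)).
  by rewrite expr2 ler_pM//; lra.
have h5 : expR y * (1 - y / 2) ^+ 2 <= 1.
  by rewrite [leRHS]h3 ler_pM2l// expR_gt0.
have h6 : 1 <= (1 + y + 2 * y ^+ 2) * (1 - y / 2) ^+ 2.
  (* This product equals (1 + y + 2 y^2) (1 - y/2)^2 - 1. *)
  have : 0 <= y ^+ 2 * ((1 - y) * (5 / 2 - y) / 2) by rewrite mulr_ge0 ?sqr_ge0//; nra.
  by lra.
have h7 : 0 < (1 - y / 2) ^+ 2 by rewrite exprn_gt0//; lra.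
by rewrite -(ler_pM2r h7) (le_trans h5).
Qed.

Lemma expR_ge_sqr (R : realType) (u : R) : 0 <= u -> u ^+ 2 <= 4 * expR u.
Proof.
move=> u0; have h : 1 + u / 2 <= expR (u / 2) by exact: expR_ge1Dx.
have -> : expR u = expR (u / 2) * expR (u / 2).
  by rewrite -expRD; congr expR; lra.
have : (1 + u / 2) * (1 + u / 2) <= expR (u / 2) * expR (u / 2).
  by rewrite ler_pM//; lra.
by nra.
Qed.

Section nonneg_expectation.
Context (R : realType) (d : measure_display) (T : measurableType d)
  (P : probability T R).
Local Notation E f := (\int[P]_w (f w)%:E)%E.

Lemma le_expect (f g : T -> R) : measurable_fun setT f ->
  measurable_fun setT g -> (forall w, 0 <= f w <= g w) -> (E f <= E g)%E.
Proof.
move=> mf mg fg; apply: ge0_le_integral => //.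
- by move=> w _; rewrite lee_fin; case/andP: (fg w).
- exact/measurable_EFinP.
- exact/measurable_EFinP.
- by move=> w _; rewrite lee_fin; case/andP: (fg w).
Qed.

Lemma expectZ (c : R) (f : T -> R) : measurable_fun setT f -> 0 <= c ->
  (forall w, 0 <= f w) -> (\int[P]_w (c * f w)%:E = c%:E * E f)%E.
Proof.
move=> mf c0 f0; under eq_integral do rewrite EFinM.
by rewrite ge0_integralZl//; [exact/measurable_EFinP|move=> w _; rewrite lee_fin].
Qed.

Lemma expectD (f g : T -> R) : measurable_fun setT f -> measurable_fun setT g ->
  (forall w, 0 <= f w) -> (forall w, 0 <= g w) ->
  (\int[P]_w (f w + g w)%:E = E f + E g)%E.
Proof.
move=> mf mg f0 g0; under eq_integral do rewrite EFinD.
by rewrite ge0_integralD//; do ?[exact/measurable_EFinP|move=> w _; rewrite lee_fin].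
Qed.

Lemma expect_sum (I : Type) (s : seq I) (f : I -> T -> R) :
  (forall i, measurable_fun setT (f i)) -> (forall i w, 0 <= f i w) ->
  (\int[P]_w (\sum_(i <- s) f i w)%:E = \sum_(i <- s) E (f i))%E.
Proof.
move=> mf f0; under eq_integral do rewrite -sumEFin.
by rewrite ge0_integral_sum//; do ?[move=> i; exact/measurable_EFinP|move=> i w _; rewrite lee_fin].
Qed.

Lemma expect_cst (c : R) : (\int[P]_w c%:E = c%:E)%E.
Proof.
transitivity (c%:E * P setT)%E; first exact: integral_cst.
by rewrite probability_setT mule1.
Qed.

End nonneg_expectation.

(** * Moment generating functions of an entry and of its centred square *)

Section entry_moments.
Context (R : realType) (mu : probability R R) (K : R).
Hypotheses (K0 : 0 < K)
  (muK : (\int[mu]_x (expR (x ^+ 2 / K ^+ 2))%:E <= 2%:E)%E).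

Lemma measurable_expR_sqr : measurable_fun setT (fun x : R => expR (x ^+ 2 / K ^+ 2)).
Proof.
by apply: measurableT_comp => //; apply: measurable_funM => //; exact: measurable_funX.
Qed.

Lemma integrable_dominated (f : R -> R) (C : R) : measurable_fun setT f ->
  (forall x, `|f x| <= C * expR (x ^+ 2 / K ^+ 2)) ->
  mu.-integrable setT (EFin \o f).
Proof.
move=> mf fC; apply: (@le_integrable _ _ _ mu setT measurableT _
  (EFin \o (fun x => C * expR (x ^+ 2 / K ^+ 2)))).
- exact/measurable_EFinP.
- move=> x _ /=; rewrite lee_fin (le_trans (fC x))//; exact: ler_norm.
- rewrite (_ : _ \o _ = (fun x => C%:E * (expR (x ^+ 2 / K ^+ 2))%:E)%E)//.
  apply: integrableZl => //; apply/integrableP; split.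
    apply/measurable_EFinP; exact: measurable_expR_sqr.
  apply: le_lt_trans (ltry 2); apply: le_trans muK.
  by under eq_integral do rewrite gee0_abs ?lee_fin ?expR_ge0//.
Qed.

Lemma integral_dominated (f : R -> R) (C : R) : measurable_fun setT f ->
  0 <= C -> (forall x, 0 <= f x <= C * expR (x ^+ 2 / K ^+ 2)) ->
  (\int[mu]_x (f x)%:E <= (2 * C)%:E)%E.
Proof.
move=> mf C0 fC.
apply: le_trans (le_expect mu mf _ fC) _.
  by apply: measurable_funM => //; exact: measurable_expR_sqr.
rewrite expectZ//; first by rewrite mulrC EFinM lee_wpmul2l.
exact: measurable_expR_sqr.
Qed.

(** The bound of [expR_le_sqr] is integrated with y = s g: the linear term vanishes, and the
    remainder is at most 2 s^2 times the integral of B exp(x^2/K^2), hence 4 B s^2. *)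
Lemma mgf_local (g : R -> R) (B s0 : R) : measurable_fun setT g ->
  (\int[mu]_x (g x)%:E = 0)%E -> 0 <= B ->
  (forall x, g x ^+ 2 * expR (s0 * `|g x|) <= B * expR (x ^+ 2 / K ^+ 2)) ->
  forall s, `|s| <= s0 ->
  (\int[mu]_x (expR (s * g x))%:E <= (expR (4 * B * s ^+ 2))%:E)%E.
Proof.
move=> mg g0 B0 gB s ss0.
have s00 : 0 <= s0 by exact: le_trans ss0.
have e1 x : 1 <= expR (x ^+ 2 / K ^+ 2).
  by rewrite -expR0 ler_expR divr_ge0// sqr_ge0.
have gi : mu.-integrable setT (EFin \o g).
  apply: (@integrable_dominated _ (1 + B)) => // x.
  have h1 : `|g x| <= 1 + g x ^+ 2 by rewrite -(real_normK (num_real (g x))); nra.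
  have h2 : g x ^+ 2 <= B * expR (x ^+ 2 / K ^+ 2).
    apply: le_trans (gB x); rewrite ler_peMr ?sqr_ge0//.
    by rewrite -expR0 ler_expR mulr_ge0.
  by have := e1 x; lra.
have mg2 : measurable_fun setT (fun x => g x ^+ 2 * expR (s0 * `|g x|)).
  apply: measurable_funM; first exact: measurable_funX.
  apply: measurableT_comp => //; apply: measurable_funM => //.
  exact: measurableT_comp.
pose h x := g x ^+ 2 * expR (s0 * `|g x|).
have h0 x : 0 <= h x by rewrite mulr_ge0 ?sqr_ge0 ?expR_ge0.
have hi : mu.-integrable setT (EFin \o h).
  by apply: (@integrable_dominated _ B) => // x; rewrite ger0_norm//; exact: gB.
have hB : (\int[mu]_x (h x)%:E <= (2 * B)%:E)%E.
  by apply: integral_dominated => // x; rewrite h0 gB.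
have me : measurable_fun setT (fun x => expR (s * g x)).
  by apply: measurableT_comp => //; exact: measurable_funM.
have pt x : expR (s * g x) <= 1 + s * g x + 2 * s ^+ 2 * h x.
  have -> : 2 * s ^+ 2 * h x = 2 * ((s * g x) ^+ 2 * expR (s0 * `|g x|)).
    by rewrite /h; ring.
  apply: le_trans (expR_le_sqr _) _; rewrite lerD2l ler_pM2l// ler_wpM2l ?sqr_ge0//.
  by rewrite ler_expR normrM ler_wpM2r.
have i1 : mu.-integrable setT (EFin \o (fun x => 1 + s * g x)).
  rewrite (_ : _ \o _ = (fun x => 1%:E + (s%:E * (g x)%:E))%E)//.
  apply: integrableD => //; last exact: integrableZl.
  exact: (finite_measure_integrable_cst mu 1).
have i2 : mu.-integrable setT (EFin \o (fun x => 2 * s ^+ 2 * h x)).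
  rewrite (_ : _ \o _ = (fun x => ((2 * s ^+ 2)%:E * (h x)%:E))%E)//.
  exact: integrableZl.
apply: (@le_trans _ _ (\int[mu]_x ((1 + s * g x)%:E + (2 * s ^+ 2 * h x)%:E))%E).
  apply: le_integral => //.
  - apply: (@le_integrable _ _ _ mu setT measurableT _
      (fun x => (1 + s * g x)%:E + (2 * s ^+ 2 * h x)%:E)%E).
    + exact/measurable_EFinP.
    + by move=> x _ /=; rewrite lee_fin (ger0_norm (expR_ge0 _)) (le_trans (pt x))// ler_norm.
    + exact: integrableD.
  - exact: integrableD.
  - by move=> x _; rewrite -EFinD lee_fin.
rewrite integralD//.
have -> : (\int[mu]_x (1 + s * g x)%:E = 1)%E.
  under eq_integral do rewrite EFinD EFinM.
  rewrite integralD//; last 2 first.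
  - exact: (finite_measure_integrable_cst mu 1).
  - exact: integrableZl.
  by rewrite integralZl// g0 mule0 adde0 expect_cst.
have -> : (\int[mu]_x (2 * s ^+ 2 * h x)%:E = (2 * s ^+ 2)%:E * \int[mu]_x (h x)%:E)%E.
  under eq_integral do rewrite EFinM.
  by rewrite integralZl.
apply: (@le_trans _ _ (1 + (2 * s ^+ 2)%:E * (2 * B)%:E)%E).
  by rewrite leeD2l// lee_wpmul2l// lee_fin mulr_ge0 ?sqr_ge0.
rewrite -EFinM -[1%E]/(1%:E) -EFinD lee_fin (le_trans _ (expR_ge1Dx _))//.
by rewrite lerD2l; lra.
Qed.

(** Small [s] fall under [mgf_local]. For |s| > 1/K, the inequality s x <= s^2 K^2 / 2 + x^2 / K^2
    makes the integral at most 2 exp(s^2 K^2 / 2), and the factor 2 <= e is absorbed because s^2 K^2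
    >= 1. *)
Lemma subgaussian_mgf : (\int[mu]_x x%:E = 0)%E ->
  exists2 C : R, 0 < C & forall s,
    (\int[mu]_x (expR (s * x))%:E <= (expR (C * s ^+ 2))%:E)%E.
Proof.
move=> mu0; pose B := 2 * K ^+ 2 * expR (1 / 2) : R.
have K2 : 0 < K ^+ 2 by rewrite exprn_gt0.
have B0 : 0 <= B by rewrite /B !mulr_ge0 ?expR_ge0 ?sqr_ge0 ?(ltW K0).
have h x : x ^+ 2 * expR (K^-1 * `|x|) <= B * expR (x ^+ 2 / K ^+ 2).
  have x2 : x ^+ 2 <= 2 * K ^+ 2 * expR (x ^+ 2 / K ^+ 2 / 2).
    set u := x ^+ 2 / K ^+ 2 / 2.
    have -> : x ^+ 2 = 2 * K ^+ 2 * u by rewrite /u; field; rewrite gt_eqF.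
    by rewrite ler_pM2l ?mulr_gt0//; have := expR_ge1Dx u; lra.
  have e2 : expR (K^-1 * `|x|) <= expR (1 / 2) * expR (x ^+ 2 / K ^+ 2 / 2).
    rewrite -expRD ler_expR.
    have -> : x ^+ 2 / K ^+ 2 = (K^-1 * `|x|) ^+ 2.
      by rewrite exprMn real_normK ?num_real// exprVn mulrC.
    by have := sqr_ge0 (K^-1 * `|x| - 1); lra.
  apply: le_trans (ler_pM (sqr_ge0 _) (expR_ge0 _) x2 e2) _.
  rewrite /B le_eqVlt; apply/orP; left; apply/eqP.
  rewrite [in RHS](_ : x ^+ 2 / K ^+ 2 = x ^+ 2 / K ^+ 2 / 2 + x ^+ 2 / K ^+ 2 / 2); last by lra.
  by rewrite expRD; ring.
have sm := @mgf_local (fun x => x) B K^-1 _ mu0 B0 h.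
exists (4 * B + 2 * K ^+ 2).
  by have : 0 < 2 * K ^+ 2 by [rewrite mulr_gt0]; lra.
move=> s; have [sK|sK] := lerP `|s| K^-1.
  apply: le_trans (sm _ s sK) _; first exact: measurable_id.
  by rewrite lee_fin ler_expR ler_wpM2r ?sqr_ge0// lerDl mulr_ge0// ltW.
have sK2 : 1 <= s ^+ 2 * K ^+ 2.
  rewrite -exprMn -(real_normK (num_real (s * K))) normrM (gtr0_norm K0).
  rewrite exprn_ege1//; move: sK; rewrite -(ltr_pM2r K0) mulVf ?gt_eqF//.
  exact: ltW.
have pt x : 0 <= expR (s * x) <= expR (s ^+ 2 * K ^+ 2 / 2) * expR (x ^+ 2 / K ^+ 2).
  rewrite expR_ge0 /= -expRD ler_expR.
  have := sqr_ge0 (s * K - x / K).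
  have -> : (s * K - x / K) ^+ 2 = s ^+ 2 * K ^+ 2 - 2 * (s * x) + x ^+ 2 / K ^+ 2.
    by field; rewrite gt_eqF.
  have : 0 <= x ^+ 2 / K ^+ 2 by rewrite divr_ge0 ?sqr_ge0.
  by lra.
apply: le_trans (integral_dominated _ _ pt) _.
- by apply: measurableT_comp => //; apply: measurable_funM.
- exact: expR_ge0.
rewrite lee_fin; apply: (@le_trans _ _ (expR 1 * expR (s ^+ 2 * K ^+ 2 / 2))).
  by rewrite ler_wpM2r ?expR_ge0//; have := @expR_ge1Dx R 1; lra.
rewrite -expRD ler_expR.
have : 0 <= 4 * B * s ^+ 2 by exact: mulr_ge0 (mulr_ge0 (ler0n _ _) B0) (sqr_ge0 s).
by nra.
Qed.

(** The centred square is only sub-exponential, hence the restriction to |s| <= s0, here with s0 = 1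
    / (2 K^2). *)
Lemma subgaussian_sqr_mgf : (\int[mu]_x (x ^+ 2)%:E = 1)%E ->
  exists C s0 : R, [/\ 0 < C, 0 < s0 & forall s, `|s| <= s0 ->
    (\int[mu]_x (expR (s * (x ^+ 2 - 1)))%:E <= (expR (C * s ^+ 2))%:E)%E].
Proof.
move=> mu1; pose B := 16 * K ^+ 4 * expR (1 / K ^+ 2) : R.
have K2 : 0 < K ^+ 2 by rewrite exprn_gt0.
have B0 : 0 < B by rewrite /B !mulr_gt0 ?expR_gt0 ?exprn_gt0 ?K0.
have h x : (x ^+ 2 - 1) ^+ 2 * expR ((2 * K ^+ 2)^-1 * `|x ^+ 2 - 1|) <=
    B * expR (x ^+ 2 / K ^+ 2).
  (* The square and the exponential each cost exp u, and exp u squared is exp(1/K^2) exp(x^2/K^2),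
     exactly the exponent that can be integrated. *)
  pose u := (x ^+ 2 + 1) / (2 * K ^+ 2).
  have u0 : 0 <= u.
    by apply: divr_ge0; [have := sqr_ge0 x; lra|exact: mulr_ge0 (ler0n _ _) (ltW K2)].
  have nx : `|x ^+ 2 - 1| <= x ^+ 2 + 1.
    by rewrite ler_norml; have := sqr_ge0 x; lra.
  have h1 : (x ^+ 2 - 1) ^+ 2 <= 16 * K ^+ 4 * expR u.
    apply: (@le_trans _ _ ((x ^+ 2 + 1) ^+ 2)).
      by have := sqr_ge0 x; nra.
    have -> : (x ^+ 2 + 1) ^+ 2 = 4 * K ^+ 4 * u ^+ 2.
      by rewrite /u; field; rewrite gt_eqF.
    have -> : 16 * K ^+ 4 * expR u = 4 * K ^+ 4 * (4 * expR u) by ring.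
    by rewrite ler_wpM2l ?expR_ge_sqr// mulr_ge0// exprn_ge0 ?ltW.
  have h2 : expR ((2 * K ^+ 2)^-1 * `|x ^+ 2 - 1|) <= expR u.
    by rewrite ler_expR mulrC ler_wpM2r// invr_ge0 mulr_ge0// ltW.
  apply: le_trans (ler_pM (sqr_ge0 _) (expR_ge0 _) h1 h2) _.
  have E1 : expR u * expR u = expR (1 / K ^+ 2) * expR (x ^+ 2 / K ^+ 2).
    by rewrite -!expRD /u; congr expR; field; rewrite gt_eqF.
  by rewrite -[X in X <= _]mulrA E1 /B mulrA.
exists (4 * B), (2 * K ^+ 2)^-1; split.
- by rewrite mulr_gt0.
- by rewrite invr_gt0 mulr_gt0.
apply: mgf_local h => //; last exact: ltW.
  by apply: measurable_funB => //; exact: measurable_funX.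
under eq_integral do rewrite EFinB.
have i2 : mu.-integrable setT (fun x => (x ^+ 2)%:E).
  apply/integrableP; split; first by apply/measurable_EFinP; exact: measurable_funX.
  under eq_integral do rewrite gee0_abs ?lee_fin ?sqr_ge0//.
  by rewrite mu1 ltry.
rewrite integralB//; last exact: (finite_measure_integrable_cst mu 1).
by rewrite mu1 expect_cst subee.
Qed.

End entry_moments.

(** * Exponential moments of quadratic forms *)

Lemma expR_tangent (R : realType) (m y : R) : expR m * (1 + (y - m)) <= expR y.
Proof.
have -> : expR y = expR m * expR (y - m) by rewrite -expRD; congr expR; ring.
by rewrite ler_wpM2l ?expR_ge0 ?expR_ge1Dx.
Qed.

(** Jensen for weights of total mass at most 1: the missing mass is placed at 0, where the
    exponential is 1, and the tangent at the barycentre [m] is summed. *)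
Lemma expR_jensen (R : realType) (J : finType) (p y : J -> R) :
  (forall i, 0 <= p i) -> \sum_i p i <= 1 ->
  expR (\sum_i p i * y i) <= 1 - \sum_i p i + \sum_i p i * expR (y i).
Proof.
move=> p0 p1; set m := \sum_i _ * _.
have h1 : \sum_i p i * (expR m * (1 + (y i - m))) <= \sum_i p i * expR (y i).
  by apply: ler_sum => i _; rewrite ler_wpM2l ?expR_tangent.
have h2 : (1 - \sum_i p i) * (expR m * (1 + (0 - m))) <= 1 - \sum_i p i.
  by rewrite ler_piMr ?subr_ge0// -[leRHS]expR0 expR_tangent.
have h3 : \sum_i p i * (expR m * (1 + (y i - m))) =
    expR m * (\sum_i p i + (m - m * \sum_i p i)).
  have -> : m - m * \sum_i p i = \sum_i (p i * y i - m * p i).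
    by rewrite sumrB mulr_sumr.
  rewrite -big_split mulr_sumr.
  by apply: eq_bigr => i _ /=; ring.
apply: le_trans (lerD h2 h1); rewrite h3.
by rewrite le_eqVlt; apply/orP; left; apply/eqP; ring.
Qed.

Lemma expRD_le_mean (R : realType) (x y : R) :
  expR (x + y) <= (expR (2 * x) + expR (2 * y)) / 2.
Proof.
rewrite expRD !(mulrDl 1 1) !mul1r !expRD.
by have := sqr_ge0 (expR x - expR y); nra.
Qed.

Section squared_exponential_moment.
Context (R : realType) (d : measure_display) (T : measurableType d)
  (P : probability T R) (l : T -> R) (C : R).
Hypotheses (ml : measurable_fun setT l) (C0 : 0 <= C)
  (lC : forall k, (\int[P]_w (expR (k * l w))%:E <= (expR (C * k ^+ 2))%:E)%E).

(* Each exp(x^2/4b) is dominated, up to the factor e^b, by the single term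
   exp(k|x| - b k^2) with k the integer part of |x|/2b. *)
Lemma expR_sqr_expect (b := C + 1) :
  (\int[P]_w (expR (l w ^+ 2 / (4 * b)))%:E <= (4 * expR b)%:E)%E.
Proof.
have b0 : 0 < b by exact: ltr_wpDl C0 ltr01.
pose g (k : nat) w := expR (- (b * k%:R ^+ 2)) * (expR (k%:R * l w) + expR (- k%:R * l w)).
have g0 k w : 0 <= g k w by rewrite mulr_ge0 ?addr_ge0 ?expR_ge0.
have me k : measurable_fun setT (fun w => expR (k * l w)).
  by apply: measurableT_comp => //; exact: measurable_funM.
have mg k : measurable_fun setT (g k).
  by apply: measurable_funM => //; apply: measurable_funD.
have pt w : ((expR (l w ^+ 2 / (4 * b)))%:E <=
    (expR b)%:E * \sum_(0 <= k <oo) (g k w)%:E)%E.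
  pose k := Num.truncn (`|l w| / (2 * b)).
  have a0 : 0 <= `|l w| / (2 * b) by rewrite divr_ge0// mulr_ge0// ltW.
  have /andP[k1 k2] := truncn_itv a0.
  apply: (@le_trans _ _ ((expR b)%:E * (g k w)%:E)%E); last first.
    rewrite lee_wpmul2l ?lee_fin ?expR_ge0//.
    rewrite (@nneseriesD1 _ _ k)//; last by move=> i _; rewrite lee_fin.
    by rewrite leeDl// nneseries_ge0// => i _ _; rewrite lee_fin.
  rewrite -EFinM lee_fin /g.
  apply: (@le_trans _ _ (expR b * (expR (- (b * k%:R ^+ 2)) * expR (k%:R * `|l w|)))).
    rewrite -!expRD ler_expR -(real_normK (num_real (l w))).
    set x := `|l w| / (2 * b) in k1 k2 a0.
    have -> : `|l w| = 2 * b * x by rewrite /x; field; rewrite gt_eqF.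
    have -> : (2 * b * x) ^+ 2 / (4 * b) = b * x ^+ 2 by field; rewrite gt_eqF.
    rewrite -subr_ge0 (_ : _ - _ = b * (1 - (x - k%:R) ^+ 2)); last by ring.
    apply: (mulr_ge0 (ltW b0)); rewrite subr_ge0.
    move: k2; rewrite -/k -addn1 natrD => k2.
    rewrite -/k in k1; nra.
  rewrite ler_wpM2l ?expR_ge0// ler_wpM2l ?expR_ge0//.
  case: (ler0P (l w)) => _; first by rewrite mulrN -mulNr lerDr expR_ge0.
  by rewrite lerDl expR_ge0.
have mS : measurable_fun setT (fun w => \sum_(0 <= k <oo) (g k w)%:E)%E.
  by apply: ge0_emeasurable_sum => // k *; [rewrite lee_fin|exact/measurable_EFinP].
apply: (@le_trans _ _ (\int[P]_w ((expR b)%:E * \sum_(0 <= k <oo) (g k w)%:E))%E).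
  apply: ge0_le_integral => //.
  - by apply/measurable_EFinP; apply: measurableT_comp => //; apply: measurable_funM => //; exact: measurable_funX.
  - by apply: emeasurable_funM.
rewrite ge0_integralZl//; last first.
  by move=> w _; apply: nneseries_ge0 => k _ _; rewrite lee_fin.
rewrite integral_nneseries//; last 2 first.
- by move=> k; exact/measurable_EFinP.
- by move=> k w _; rewrite lee_fin.
rewrite mulrC EFinM lee_wpmul2l ?lee_fin ?expR_ge0//.
(* The series is dominated termwise by 4 / 2^(k+1), of sum 4: since b = C + 1, a factor exp(-k^2)
   survives, and exp(k^2) >= 2^k. *)
apply: le_trans (@epsilon_trick0 R 4 xpredT _); last by [].
apply: lee_nneseries => [k _ _|k _]; first by apply: integral_ge0 => w _; rewrite lee_fin.
rewrite expectZ ?expR_ge0//; last exact: measurable_funD.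
rewrite expectD//; try by move=> w; exact: expR_ge0.
have h : (\int[P]_w (expR (k%:R * l w))%:E + \int[P]_w (expR (- k%:R * l w))%:E <=
   (2 * expR (C * k%:R ^+ 2))%:E)%E.
  rewrite mulrDl mul1r EFinD leeD//.
  by have := lC (- k%:R); rewrite sqrrN.
apply: le_trans (lee_wpmul2l _ h) _; first by rewrite lee_fin expR_ge0.
rewrite -EFinM lee_fin mulrCA -expRD.
have -> : - (b * k%:R ^+ 2) + C * k%:R ^+ 2 = - (k%:R ^+ 2) by rewrite /b; ring.
have h2 : 2 ^+ k <= expR (k%:R ^+ 2) :> R.
  apply: (@le_trans _ _ (expR k%:R)).
    rewrite -[k%:R]mulr1 mulrC expRM_natr lerXn2r ?nnegrE ?expR_ge0//.
    by have := @expR_ge1Dx R 1; lra.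
  by rewrite ler_expR -natrX ler_nat; case: (k) => // k'; rewrite expnS leq_pmulr// expn_gt0.
rewrite expRN natrX [_ ^+ k.+1]exprS invfM mulrA.
have -> : 4 / 2 = 2 :> R by lra.
by rewrite ler_pM2l// lef_pV2 ?posrE ?expR_gt0 ?exprn_gt0.
Qed.

End squared_exponential_moment.

Section quadratic_form_mgf.
Context (R : realType) (d : measure_display) (T : measurableType d)
  (P : probability T R) (I : finType) (X : I -> {RV P >-> R}).
Hypothesis indX : mutually_independent X.
Variables (C1 C2 s0 : R).
Hypotheses (C10 : 0 < C1) (C20 : 0 < C2) (s00 : 0 < s0).
Hypothesis mgf1 : forall i s,
  (\int[P]_w (expR (s * X i w))%:E <= (expR (C1 * s ^+ 2))%:E)%E.
Hypothesis mgf2 : forall i s, `|s| <= s0 ->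
  (\int[P]_w (expR (s * (X i w ^+ 2 - 1)))%:E <= (expR (C2 * s ^+ 2))%:E)%E.

(** The variables in [s] are integrated one at a time, conditionally on the coordinates in [B]. Each
    leaves C1 (L i)^2, which depends on [B] only and can join [V]; the statement is general in [V]
    for this induction. *)
Lemma integrate_out_linear (s : seq I) (B : {set I}) (L : I -> T -> R) (V : T -> R) :
  uniq s -> {in s, forall i, i \notin B} ->
  (forall i, depends_on X B (L i)) -> depends_on X B V ->
  (\int[P]_w (expR (\sum_(i <- s) X i w * L i w + V w))%:E <=
   \int[P]_w (expR (C1 * \sum_(i <- s) L i w ^+ 2 + V w))%:E)%E.
Proof.
elim: s V => [|a s IH] V.
  by move=> _ _ _ _; under eq_integral do rewrite big_nil;
     under [leRHS]eq_integral do rewrite big_nil mulr0.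
rewrite cons_uniq => /andP[sa us] sB dL dV.
pose B' := (B :|: [set i in s])%SET.
pose r w := \sum_(i <- s) X i w * L i w + V w.
have dr : depends_on X B' r.
  apply: measurable_funD; last by apply: depends_on_sub dV; exact: finset.subsetUl.
  have mX i : i \in s -> depends_on X B' (X i).
    by move=> si; apply: depends_on_self; rewrite !inE si orbT.
  have mL i : depends_on X B' (L i) by apply: depends_on_sub (dL i); exact: finset.subsetUl.
  rewrite (_ : (fun x => _) = fun w => \sum_(i <- s) (if i \in s then X i w * L i w else 0)).
    apply: measurable_sum => i; case: (boolP (i \in s)) => si; last exact: measurable_cst.
    by apply: measurable_funM; [exact: mX|exact: mL].
  by apply/funext => w; rewrite big_seq [RHS]big_seq; apply: eq_bigr => i ->.
have dg : depends_on X B' (fun w => (L a w, r w)).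
  apply: measurable_fun_pair => //.
  by apply: depends_on_sub (dL a); exact: finset.subsetUl.
have da : depends_on X [set a]%SET (X a) by apply: depends_on_self; rewrite inE.
have dis : [disjoint [set a]%SET & B']%B.
  by rewrite disjoints1 !inE negb_or sa andbT; apply: sB; rewrite inE eqxx.
have mr := depends_on_measurable dr.
have mLa : measurable_fun setT (L a) by exact: depends_on_measurable (dL a).
apply: (@le_trans _ _ (\int[P]_w (expR (C1 * L a w ^+ 2 + r w))%:E)%E).
  under eq_integral do rewrite big_cons -addrA -/(r _).
  have mh : measurable_fun [set: R * (R * R)]
      (fun z => (expR (z.1 * z.2.1 + z.2.2))%:E).
    apply/measurable_EFinP; apply: measurableT_comp => //.
    apply: measurable_funD; last exact: measurableT_comp.
    by apply: measurable_funM => //; exact: measurableT_comp.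
  have := ge0_expect_indep indX dis da dg mh.
  move=> -> /=; last by move=> z; rewrite lee_fin expR_ge0.
  apply: ge0_le_integral => //.
  - by move=> w _; apply: integral_ge0 => w' _; rewrite lee_fin expR_ge0.
  - have mh' : measurable_fun [set: T * T] (fun z => (expR (X a z.1 * L a z.2 + r z.2))%:E).
      apply/measurable_EFinP; apply: measurableT_comp => //.
      apply: measurable_funD; last exact: measurableT_comp.
      by apply: measurable_funM; exact: measurableT_comp.
    have h0 z : (0 <= (expR (X a z.1 * L a z.2 + r z.2))%:E)%E by rewrite lee_fin expR_ge0.
    exact: (@measurable_fun_fubini_tonelli_G _ _ T T R P _ mh' h0).
  - apply/measurable_EFinP; apply: measurableT_comp => //.
    apply: measurable_funD => //; apply: measurable_funM => //.
    exact: measurable_funX.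
  - move=> w _.
    have -> : (\int[P]_w0 (expR (X a w0 * L a w + r w))%:E =
        \int[P]_w0 (expR (r w) * expR (L a w * X a w0))%:E)%E.
      by apply: eq_integral => w0 _; rewrite -expRD mulrC addrC.
    rewrite expectZ ?expR_ge0//; last first.
      by apply: measurableT_comp => //; exact: measurable_funM.
    have -> : ((expR (C1 * L a w ^+ 2 + r w))%:E =
        (expR (r w))%:E * (expR (C1 * L a w ^+ 2))%:E)%E.
      by rewrite -EFinM -expRD addrC.
    by rewrite lee_wpmul2l// lee_fin expR_ge0.
have -> : (\int[P]_w (expR (C1 * L a w ^+ 2 + r w))%:E =
  \int[P]_w (expR (\sum_(i <- s) X i w * L i w + (C1 * L a w ^+ 2 + V w)))%:E)%E.
  by apply: eq_integral => w _; rewrite /r addrCA.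
apply: le_trans (IH _ us _ dL _) _.
- by move=> i si; apply: sB; rewrite inE si orbT.
- apply: measurable_funD => //; apply: measurable_funM => //.
  by apply: measurable_funX; exact: dL.
have -> // : (\int[P]_w (expR (C1 * (\sum_(i <- s) L i w ^+ 2) + (C1 * L a w ^+ 2 + V w)))%:E =
   \int[P]_w (expR (C1 * (\sum_(i <- a :: s) L i w ^+ 2) + V w))%:E)%E.
by apply: eq_integral => w _; rewrite big_cons mulrDr addrA [C1 * _ + _]addrC.
Qed.

Lemma expect_expR_linear (B : {set I}) (v : I -> R) :
  (\int[P]_w (expR (\sum_(i in B) v i * X i w))%:E <=
   (expR (C1 * \sum_(i in B) v i ^+ 2))%:E)%E.
Proof.
have := @integrate_out_linear (enum B) finset.set0 (fun i _ => v i) (fun=> 0)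
  (enum_uniq _) _ (fun=> measurable_cst _) (measurable_cst _).
under eq_integral do rewrite addr0 big_enum.
under [leRHS]eq_integral do rewrite addr0 big_enum.
rewrite expect_cst => h; apply: le_trans (h _); last by move=> i _; rewrite inE.
rewrite le_eqVlt; apply/orP; left; apply/eqP; apply: eq_integral => w _.
by congr (expR _)%:E; apply: eq_bigr => i _; rewrite mulrC.
Qed.

Lemma expect_expR_diagonal (s : seq I) (v : I -> R) : uniq s ->
  (forall i, `|v i| <= s0) ->
  (\int[P]_w (expR (\sum_(i <- s) v i * (X i w ^+ 2 - 1)))%:E <=
   (expR (C2 * \sum_(i <- s) v i ^+ 2))%:E)%E.
Proof.
move=> us vs; elim: s us => [_|a s IH].
  under eq_integral do rewrite big_nil expR0.
  by rewrite big_nil mulr0 expR0 expect_cst.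
rewrite cons_uniq => /andP[sa us].
have m1 i (A : {set I}) : i \in A ->
    depends_on X A (fun w => v i * (X i w ^+ 2 - 1)).
  move=> iA; apply: measurable_funM => //; apply: measurable_funB => //.
  by apply: measurable_funX; exact: depends_on_self.
under eq_integral do rewrite big_cons expRD.
rewrite (ge0_expectM indX (A := [set a]%SET) (B := [set i in s]%SET)); try by move=> w; exact: expR_ge0.
- rewrite big_cons mulrDr expRD EFinM lee_pmul//.
  + by apply: integral_ge0 => w _; rewrite lee_fin expR_ge0.
  + by apply: integral_ge0 => w _; rewrite lee_fin expR_ge0.
  + exact: mgf2.
  + exact: IH.
- by rewrite disjoints1 inE.
- by apply: measurableT_comp => //; apply: m1; rewrite inE.
- apply: measurableT_comp => //.
  rewrite (_ : (fun x => _) = fun w => \sum_(i <- s) (if i \in s then v i * (X i w ^+ 2 - 1) else 0)).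
    apply: measurable_sum => i; case: (boolP (i \in s)) => si; last exact: measurable_cst.
    by apply: m1; rewrite inE.
  by apply/funext => w; rewrite big_seq [RHS]big_seq; apply: eq_bigr => i ->.
Qed.

(** Given the variables outside [S], the form is linear in those of [S]; integrating these out
    leaves exp(C1 t^2 sum_i (L i)^2) with linear forms [L i]. The squared row norms of [D] sum to at
    most 1, so convexity reduces to one normalized linear form at a time, whose squared exponential
    moment is bounded independently of the dimension. The condition on [t] brings the exponent down
    to 1 / (4 (C1 + 1)). *)
Lemma expect_expR_decoupled (D : I -> I -> R) (S : {set I}) (t : R) :
  \sum_i \sum_j D i j ^+ 2 <= 1 -> 4 * C1 * (C1 + 1) * t ^+ 2 <= 1 ->
  (\int[P]_w (expR (t * \sum_(i in S) \sum_(j in ~: S) D i j * X i w * X j w))%:E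
    <= (1 + 4 * expR (C1 + 1))%:E)%E.
Proof.
move=> D1 t1.
pose L i w := \sum_(j in ~: S) D i j * X j w.
have dL i : depends_on X (~: S) (L i).
  rewrite /L (_ : (fun w => _) = fun w => \sum_j (if j \in ~: S then D i j * X j w else 0)).
    apply: measurable_sum => j; case: (boolP (j \in ~: S)) => jS; last exact: measurable_cst.
    by apply: measurable_funM => //; exact: depends_on_self.
  by apply/funext => w; rewrite big_mkcond.
have mL i : measurable_fun setT (L i) by exact: depends_on_measurable (dL i).
apply: (@le_trans _ _ (\int[P]_w (expR (C1 * \sum_(i in S) (t * L i w) ^+ 2))%:E)%E).
  have := @integrate_out_linear (enum S) (~: S) (fun i w => t * L i w) (fun=> 0)
    (enum_uniq _) _ _ (measurable_cst _).
  under eq_integral do rewrite addr0 big_enum.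
  under [leRHS]eq_integral do rewrite addr0 big_enum.
  move=> h; apply: le_trans (h _ _).
  - rewrite le_eqVlt; apply/orP; left; apply/eqP; apply: eq_integral => w _.
    congr (expR _)%:E; rewrite mulr_sumr; apply: eq_bigr => i _.
    rewrite /L [X i w * _]mulrCA; congr (_ * _); rewrite mulr_sumr.
    by apply: eq_bigr => j _; ring.
  - by move=> i; rewrite mem_enum !inE => ->.
  - by move=> i; apply: measurable_funM => //; exact: dL.
pose p i := \sum_j D i j ^+ 2.
have p0 i : 0 <= p i by apply: sumr_ge0 => j _; exact: sqr_ge0.
(* For a zero row the division by 0 yields the zero form, and [lE] below still holds. *)
pose l i w := \sum_(j in ~: S) (D i j / Num.sqrt (p i)) * X j w.
have lE i w : L i w ^+ 2 = p i * l i w ^+ 2.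
  have [pi0|pi0] := eqVneq (p i) 0.
    have D0 j : D i j = 0.
      apply/eqP; rewrite -sqrf_eq0; move/eqP: pi0.
      by rewrite /p psumr_eq0 => [/allP/(_ j)|*]; rewrite ?mem_index_enum ?sqr_ge0//; apply.
    by rewrite pi0 mul0r /L big1 ?expr0n// => j _; rewrite D0 mul0r.
  rewrite -{1}[p i]sqr_sqrtr// -exprMn; congr (_ ^+ 2).
  rewrite /l mulr_sumr; apply: eq_bigr => j _.
  by field; rewrite sqrtr_eq0 -ltNge lt_def pi0 p0.
have ml i : measurable_fun setT (l i).
  rewrite /l (_ : (fun w => _) = fun w => \sum_j (if j \in ~: S then D i j / Num.sqrt (p i) * X j w else 0)).
    apply: measurable_sum => j; case: (boolP (j \in ~: S)) => jS; last exact: measurable_cst.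
    by apply: measurable_funM.
  by apply/funext => w; rewrite big_mkcond.
have lC i k : (\int[P]_w (expR (k * l i w))%:E <= (expR (C1 * k ^+ 2))%:E)%E.
  have := expect_expR_linear (~: S) (fun j => k * (D i j / Num.sqrt (p i))).
  under eq_integral do under eq_bigr do rewrite -mulrA.
  under eq_integral do rewrite -mulr_sumr.
  move=> h; apply: le_trans h _; rewrite lee_fin ler_expR ler_pM2l//.
  under eq_bigr do rewrite exprMn.
  rewrite -mulr_sumr ler_piMr ?sqr_ge0//.
  have [pi0|pi0] := eqVneq (p i) 0.
    by rewrite big1 ?ler01// => j _; rewrite pi0 sqrtr0 invr0 mulr0 expr0n.
  have pp : 0 < p i by rewrite lt_def pi0 p0.
  under eq_bigr do rewrite exprMn exprVn sqr_sqrtr//.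
  rewrite -mulr_suml ler_pdivrMr// mul1r /p big_mkcond; apply: ler_sum => j _.
  by case: ifP => //; rewrite sqr_ge0.
have C1p : 0 < C1 + 1 by rewrite addr_gt0.
have b4 : 0 < 4 * (C1 + 1) by rewrite mulr_gt0.
apply: (@le_trans _ _ (\int[P]_w (1 + \sum_i p i * expR (l i w ^+ 2 / (4 * (C1 + 1))))%:E)%E).
  apply: le_expect.
  - apply: measurableT_comp => //; apply: measurable_funM => //.
    rewrite (_ : (fun x => _) = fun w => \sum_i (if i \in S then (t * L i w) ^+ 2 else 0)).
      apply: measurable_sum => i; case: (i \in S) => //.
      by apply: measurable_funX; exact: measurable_funM.
    by apply/funext => w; rewrite big_mkcond.
  - apply: measurable_funD => //; apply: measurable_sum => i.
    apply: measurable_funM => //; apply: measurableT_comp => //.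
    by apply: measurable_funM => //; exact: measurable_funX.
  - move=> w; rewrite expR_ge0 /=.
    apply: (@le_trans _ _ (expR (\sum_i p i * (l i w ^+ 2 / (4 * (C1 + 1)))))).
      rewrite ler_expR mulr_sumr big_mkcond; apply: ler_sum => i _.
      have q0 : 0 <= p i * l i w ^+ 2 by rewrite mulr_ge0 ?sqr_ge0.
      case: ifP => _; last by rewrite mulrA divr_ge0// ltW.
      rewrite exprMn lE [leRHS]mulrA ler_pdivlMr//.
      have -> : C1 * (t ^+ 2 * (p i * l i w ^+ 2)) * (4 * (C1 + 1)) =
        (4 * C1 * (C1 + 1) * t ^+ 2) * (p i * l i w ^+ 2) by ring.
      by rewrite ler_piMl.
    apply: le_trans (expR_jensen _ p0 D1) _.
    by rewrite lerD2r lerBlDr lerDl sumr_ge0.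
rewrite expectD//; last 2 first.
- apply: measurable_sum => i.
  apply: measurable_funM => //; apply: measurableT_comp => //.
  by apply: measurable_funM => //; exact: measurable_funX.
- by move=> w; rewrite sumr_ge0// => i _; rewrite mulr_ge0 ?expR_ge0.
have mE i : measurable_fun setT (fun w => expR (l i w ^+ 2 / (4 * (C1 + 1)))).
  apply: measurableT_comp => //.
  by apply: measurable_funM => //; exact: measurable_funX.
rewrite expect_cst EFinD leeD2l// expect_sum; last 2 first.
- by move=> i; apply: measurable_funM.
- by move=> i w; rewrite mulr_ge0 ?expR_ge0.
apply: (@le_trans _ _ (\sum_i (p i * (4 * expR (C1 + 1)))%:E)%E).
  apply: lee_sum => i _; rewrite expectZ ?expR_ge0// EFinM lee_wpmul2l ?lee_fin//.
  by apply: expR_sqr_expect => //; exact: ltW.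
rewrite sumEFin lee_fin -mulr_suml ler_piMl// mulr_ge0 ?expR_ge0.
Qed.

End quadratic_form_mgf.

(** Such sets are [i] added to an arbitrary subset of the complement of {i, j}. *)
Lemma card_separating_sets (I : finType) (i j : I) : i != j ->
  (#|[set S : {set I} | (i \in S) && (j \notin S)]%SET| * 4 = 2 ^ #|I|)%N.
Proof.
move=> ij.
have -> : [set S : {set I} | (i \in S) && (j \notin S)]%SET =
    ((fun S => i |: S) @: powerset (~: [set i; j]))%SET.
  apply/setP => S; apply/idP/imsetP; rewrite inE.
    move=> /andP[iS jS]; exists (S :\ i)%SET; last by rewrite finset.setD1K.
    rewrite powersetE; apply/fintype.subsetP => k; rewrite !inE => /andP[ki kS].
    by rewrite negb_or ki /=; apply: contraNneq jS => <-.
  move=> [S']; rewrite powersetE => /fintype.subsetP S'ij ->.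
  rewrite !inE eqxx /= negb_or eq_sym ij /=.
  by apply/negP => /S'ij; rewrite !inE eqxx orbT.
rewrite card_in_imset; last first.
  move=> S1 S2; rewrite !powersetE => /fintype.subsetP S1ij /fintype.subsetP S2ij E.
  apply/setP => k; have := congr1 (fun S : {set I} => k \in S) E; rewrite /= !inE.
  case: (eqVneq k i) => [->|] //= _.
  have -> : (i \in S1) = false by apply/negP => /S1ij; rewrite !inE eqxx.
  by apply/esym/negP => /S2ij; rewrite !inE eqxx.
rewrite card_powerset -[4%N]/(2 ^ 2)%N -expnD; congr (2 ^ _)%N.
by rewrite -(cardsC [set i; j]%SET) cards2 ij addnC.
Qed.

(** A uniformly random subset contains [i] and misses [j] with probability 1/4 when the two differ,
    and never when they are equal; hence the factor 4 and the absence of diagonal terms. *)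
Lemma off_diagonal_decouple (R : realType) (I : finType) (F : I -> I -> R) :
  \sum_i \sum_(j | j != i) F i j =
  \sum_(S : {set I}) (2 ^ #|I|)%:R^-1 * (4 * \sum_(i in S) \sum_(j in ~: S) F i j).
Proof.
have E (S : {set I}) : \sum_(i in S) \sum_(j in ~: S) F i j =
    \sum_i \sum_j ((i \in S) && (j \notin S))%:R * F i j.
  rewrite big_mkcond; apply: eq_bigr => i _.
  case: (i \in S) => /=; last by rewrite big1// => j _; rewrite mul0r.
  rewrite big_mkcond; apply: eq_bigr => j _; rewrite !inE.
  by case: (j \in S); rewrite ?mul0r ?mul1r.
under [RHS]eq_bigr do rewrite E mulrA.
rewrite -mulr_sumr exchange_big mulr_sumr; apply: eq_bigr => i _ /=.
rewrite exchange_big mulr_sumr big_mkcond; apply: eq_bigr => j _ /=.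
rewrite -mulr_suml -natr_sum.
have -> : (\sum_(S : {set I}) ((i \in S) && (j \notin S)) =
    #|[set S : {set I} | (i \in S) && (j \notin S)]%SET|)%N.
  by rewrite -sum1dep_card [RHS]big_mkcond; apply: eq_bigr => S _; case: (_ && _).
case: eqVneq => [->|ji] /=.
  rewrite (_ : [set _ | _]%SET = finset.set0) ?cards0 ?mul0r ?mulr0//.
  by apply/setP => S; rewrite !inE andbN.
have := @card_separating_sets I i j; rewrite eq_sym => /(_ ji) <-.
rewrite natrM invfM.
have : 0 < #|[set S : {set I} | (i \in S) && (j \notin S)]%SET|%:R :> R.
  rewrite ltr0n -(ltn_pmul2r (_ : 0 < 4)%N)// mul0n card_separating_sets ?expn_gt0//.
  by rewrite eq_sym.
by move=> h; field; rewrite gt_eqF.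
Qed.

Section quadratic_form_mgf_total.
Context (R : realType) (d : measure_display) (T : measurableType d)
  (P : probability T R) (I : finType) (X : I -> {RV P >-> R}).
Hypothesis indX : mutually_independent X.
Variables (C1 C2 s0 : R).
Hypotheses (C10 : 0 < C1) (C20 : 0 < C2) (s00 : 0 < s0).
Hypothesis mgf1 : forall i s,
  (\int[P]_w (expR (s * X i w))%:E <= (expR (C1 * s ^+ 2))%:E)%E.
Hypothesis mgf2 : forall i s, `|s| <= s0 ->
  (\int[P]_w (expR (s * (X i w ^+ 2 - 1)))%:E <= (expR (C2 * s ^+ 2))%:E)%E.

Definition quad (D : I -> I -> R) (w : T) : R :=
  \sum_i \sum_j D i j * X i w * X j w.

Lemma measurable_quad (D : I -> I -> R) : measurable_fun setT (quad D).
Proof.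
apply: measurable_sum => i; apply: measurable_sum => j.
by apply: measurable_funM => //; exact: measurable_funM.
Qed.

(** Zero trace allows X_i^2 to be replaced by X_i^2 - 1 on the diagonal. The mean inequality
    separates the diagonal from the rest at the cost of doubling [t], and Jensen over random subsets
    decouples the rest at the cost of another factor 4; thus [expect_expR_decoupled] is used at 8 t,
    and 256 = 4 * 64. *)
Lemma expect_expR_quad (D : I -> I -> R) (t : R) :
  \sum_i D i i = 0 -> \sum_i \sum_j D i j ^+ 2 <= 1 ->
  0 < t -> 2 * t <= s0 -> 256 * C1 * (C1 + 1) * t ^+ 2 <= 1 ->
  (\int[P]_w (expR (t * quad D w))%:E
    <= (expR (4 * C2 * t ^+ 2) + (1 + 4 * expR (C1 + 1)))%:E)%E.
Proof.
move=> trD D1 t0 ts0 t1.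
pose dg w := \sum_i D i i * (X i w ^+ 2 - 1).
pose off w := \sum_i \sum_(j | j != i) D i j * X i w * X j w.
have quadE w : quad D w = dg w + off w.
  rewrite /quad /dg; transitivity (\sum_i (D i i * X i w * X i w) + off w).
    by rewrite /off -big_split; apply: eq_bigr => i _; rewrite (bigD1 i).
  congr (_ + _); under [RHS]eq_bigr do rewrite mulrBr mulr1.
  by rewrite sumrB trD subr0; apply: eq_bigr => i _; ring.
have mdg : measurable_fun setT dg.
  apply: measurable_sum => i; apply: measurable_funM => //.
  by apply: measurable_funB => //; exact: measurable_funX.
pose dec (S : {set I}) w := \sum_(i in S) \sum_(j in ~: S) D i j * X i w * X j w.
have mdec S : measurable_fun setT (dec S).
  rewrite (_ : dec S = fun w => \sum_i \sum_j
      (if (i \in S) && (j \in ~: S) then D i j * X i w * X j w else 0)).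
    apply: measurable_sum => i; apply: measurable_sum => j.
    case: (_ && _) => //; apply: measurable_funM => //; exact: measurable_funM.
  apply/funext => w; rewrite /dec big_mkcond; apply: eq_bigr => i _.
  case: (i \in S) => /=; last by rewrite big1.
  by rewrite big_mkcond.
pose q : R := (2 ^ #|I|)%:R^-1.
have q0 : 0 <= q by rewrite invr_ge0.
have q1 : \sum_(S : {set I}) q = 1.
  rewrite sumr_const -cardsT -powersetT card_powerset cardsT -[q *+ _]mulr_natl /q mulfV//.
have pt w : 0 <= expR (t * quad D w) <=
    expR (2 * t * dg w) + \sum_(S : {set I}) q * expR (8 * t * dec S w).
  rewrite expR_ge0 quadE mulrDr /=; apply: le_trans (expRD_le_mean _ _) _.
  have -> : 2 * (t * off w) = \sum_(S : {set I}) q * (8 * t * dec S w).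
    rewrite /off off_diagonal_decouple !mulr_sumr; apply: eq_bigr => S _.
    by rewrite /q /dec; ring.
  have J := @expR_jensen R _ (fun=> q) (fun S => 8 * t * dec S w) (fun=> q0).
  move: J; rewrite q1 subrr add0r => /(_ (lexx _)) J.
  have -> : 2 * (t * dg w) = 2 * t * dg w by ring.
  have e0 := expR_ge0 (2 * t * dg w).
  have : 0 <= \sum_(S : {set I}) q * expR (8 * t * dec S w).
    by apply: sumr_ge0 => S _; rewrite mulr_ge0 ?expR_ge0.
  move: J e0; set a := expR _; set b := \sum_(S : {set I}) _; set c := expR _.
  by lra.
have me S : measurable_fun setT (fun w => expR (8 * t * dec S w)).
  by apply: measurableT_comp => //; exact: measurable_funM.
have mqe S : measurable_fun setT (fun w => q * expR (8 * t * dec S w)).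
  exact: measurable_funM.
have mde : measurable_fun setT (fun w => expR (2 * t * dg w)).
  by apply: measurableT_comp => //; exact: measurable_funM.
have mse : measurable_fun setT (fun w => \sum_(S : {set I}) q * expR (8 * t * dec S w)).
  by apply: measurable_sum.
apply: le_trans (le_expect P _ _ pt) _.
- by apply: measurableT_comp => //; apply: measurable_funM => //; exact: measurable_quad.
- exact: measurable_funD.
rewrite expectD//; last by move=> w; apply: sumr_ge0 => S _; rewrite mulr_ge0 ?expR_ge0.
rewrite EFinD leeD//.
  have vs i : `|2 * t * D i i| <= s0.
    have Dii : `|D i i| <= 1.
      rewrite -(@ler_pXn2r _ 2)// ?nnegrE// expr1n real_normK ?num_real//.
      apply: le_trans D1; rewrite (bigD1 i)//= (bigD1 i)//= -addrA lerDl addr_ge0//.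
        by apply: sumr_ge0 => j _; exact: sqr_ge0.
      by apply: sumr_ge0 => k _; apply: sumr_ge0 => j _; exact: sqr_ge0.
    have tt : 0 < 2 * t by rewrite mulr_gt0.
    by rewrite normrM (gtr0_norm tt) (le_trans _ ts0)// ler_piMr// ltW.
  have := expect_expR_diagonal indX mgf2 (index_enum_uniq I) vs.
  rewrite (_ : (\int[P]_w _ = \int[P]_w (expR (2 * t * dg w))%:E)%E); last first.
    apply: eq_integral => w _; rewrite /dg mulr_sumr; congr (expR _)%:E.
    by apply: eq_bigr => i _; rewrite mulrA.
  move=> h; apply: le_trans h _; rewrite lee_fin ler_expR.
  have -> : 4 * C2 * t ^+ 2 = C2 * (4 * t ^+ 2) by ring.
  rewrite ler_pM2l//; under eq_bigr do rewrite exprMn.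
  rewrite -mulr_sumr (_ : (2 * t) ^+ 2 = 4 * t ^+ 2); last by ring.
  apply: ler_piMr; first by rewrite mulr_ge0 ?sqr_ge0.
  apply: le_trans D1.
  apply: ler_sum => i _; rewrite (bigD1 i)//= lerDl.
  by apply: sumr_ge0 => j _; exact: sqr_ge0.
rewrite expect_sum//; last by move=> S w; rewrite mulr_ge0 ?expR_ge0.
apply: (@le_trans _ _ (\sum_(S : {set I}) (q * (1 + 4 * expR (C1 + 1)))%:E)%E).
  apply: lee_sum => S _; rewrite expectZ// EFinM lee_wpmul2l ?lee_fin//.
  apply: (expect_expR_decoupled indX) => //.
  by rewrite (le_trans _ t1)// le_eqVlt; apply/orP; left; apply/eqP; ring.
by rewrite sumEFin -mulr_suml q1 mul1r.
Qed.

End quadratic_form_mgf_total.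

(** * Second moment of a centred quadratic form *)

Section second_moment.
Context (R : realType) (d : measure_display) (T : measurableType d)
  (P : probability T R) (I : finType) (X : I -> {RV P >-> R}).
Hypothesis indX : mutually_independent X.
Local Notation intg f := (P.-integrable setT (EFin \o f)).
Local Notation Ex f := (\int[P]_w f w)%R.

Lemma intg_measurable (f : T -> R) : intg f -> measurable_fun setT f.
Proof. by move=> /integrableP[mf _]; exact/measurable_EFinP. Qed.

Lemma intg_le (f g : T -> R) : measurable_fun setT f -> intg g ->
  (forall w, `|f w| <= `|g w|) -> intg f.
Proof.
move=> mf ig fg; apply: le_integrable ig => //.
  exact/measurable_EFinP.
by move=> w _ /=; rewrite lee_fin.
Qed.

Lemma intgD (f g : T -> R) : intg f -> intg g -> intg (fun w => f w + g w).
Proof. by move=> fi gi; exact: (integrableD _ fi gi). Qed.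

Lemma intgZ (c : R) (f : T -> R) : intg f -> intg (fun w => c * f w).
Proof. by move=> fi; exact: (integrableZl _ c fi). Qed.

Lemma ExD (f g : T -> R) : intg f -> intg g ->
  (\int[P]_w (f w + g w) = Ex f + Ex g)%R.
Proof. by move=> fi gi; rewrite RintegralD. Qed.

Lemma ExZ (c : R) (f : T -> R) : intg f -> (\int[P]_w (c * f w) = c * Ex f)%R.
Proof. by move=> fi; rewrite RintegralZl. Qed.

Let ge0_mul (A B : {set I}) (f g : T -> R) : [disjoint A & B]%B ->
  depends_on X A f -> depends_on X B g -> intg f -> intg g ->
  (forall w, 0 <= f w) -> (forall w, 0 <= g w) ->
  intg (fun w => f w * g w) /\ (\int[P]_w (f w * g w) = Ex f * Ex g)%R.
Proof.
move=> AB df dg fi gi f0 g0.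
have E := ge0_expectM indX AB df dg f0 g0.
have Ef : (\int[P]_w (f w)%:E)%E \is a fin_num by exact: integrable_fin_num fi.
have Eg : (\int[P]_w (g w)%:E)%E \is a fin_num by exact: integrable_fin_num gi.
split; last by rewrite /Rintegral E fineM.
apply/integrableP; split.
  by apply/measurable_EFinP; apply: measurable_funM; exact: intg_measurable.
under eq_integral do rewrite gee0_abs ?lee_fin ?mulr_ge0//.
by rewrite E -(fineK Ef) -(fineK Eg) -EFinM ltry.
Qed.

(** Positive and negative parts reduce the claim to four products of nonnegative functions. *)
Lemma Ex_indep (A B : {set I}) (f g : T -> R) : [disjoint A & B]%B ->
  depends_on X A f -> depends_on X B g -> intg f -> intg g ->
  intg (fun w => f w * g w) /\ (\int[P]_w (f w * g w) = Ex f * Ex g)%R.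
Proof.
move=> AB df dg fi gi.
pose pos (f : T -> R) w := Num.max (f w) 0.
pose neg (f : T -> R) w := Num.max (- f w) 0.
have fE (h : T -> R) w : h w = pos h w + -1 * neg h w.
  by rewrite /pos /neg; case: (lerP (h w) 0); case: (lerP (- h w) 0); lra.
have p0 (h : T -> R) w : 0 <= pos h w by rewrite /pos le_max lexx orbT.
have n0 (h : T -> R) w : 0 <= neg h w by rewrite /neg le_max lexx orbT.
have dp (C : {set I}) h : depends_on X C h -> depends_on X C (pos h).
  by move=> dh; exact: measurable_maxr.
have dn (C : {set I}) h : depends_on X C h -> depends_on X C (neg h).
  by move=> dh; apply: measurable_maxr => //; exact: measurable_funN.
have ip h : intg h -> intg (pos h).
  move=> hi; apply: intg_le (hi) _; first by apply: measurable_maxr => //; exact: intg_measurable.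
  by move=> w; rewrite ger0_norm// /pos ge_max ler_norm normr_ge0.
have in_ h : intg h -> intg (neg h).
  move=> hi; apply: intg_le (hi) _.
    by apply: measurable_maxr => //; apply: measurable_funN; exact: intg_measurable.
  by move=> w; rewrite ger0_norm// /neg ge_max -normrN ler_norm normr_ge0.
have [i1 e1] := ge0_mul AB (dp _ _ df) (dp _ _ dg) (ip _ fi) (ip _ gi) (p0 f) (p0 g).
have [i2 e2] := ge0_mul AB (dp _ _ df) (dn _ _ dg) (ip _ fi) (in_ _ gi) (p0 f) (n0 g).
have [i3 e3] := ge0_mul AB (dn _ _ df) (dp _ _ dg) (in_ _ fi) (ip _ gi) (n0 f) (p0 g).
have [i4 e4] := ge0_mul AB (dn _ _ df) (dn _ _ dg) (in_ _ fi) (in_ _ gi) (n0 f) (n0 g).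
have fgE : (fun w => f w * g w) = (fun w => (pos f w * pos g w + -1 * (pos f w * neg g w)) +
    (-1 * (neg f w * pos g w) + neg f w * neg g w)).
  by apply/funext => w; rewrite (fE f) (fE g); ring.
have EE h : intg h -> Ex h = Ex (pos h) - Ex (neg h).
  move=> hi; transitivity (\int[P]_w (pos h w + -1 * neg h w))%R.
    by apply: eq_Rintegral => w _; exact: fE.
  rewrite ExD; [|exact: ip|by apply: intgZ; exact: in_].
  by rewrite ExZ ?mulN1r//; exact: in_.
rewrite fgE; split.
  by apply: intgD; apply: intgD => //; exact: intgZ.
rewrite ExD; try by apply: intgD => //; exact: intgZ.
rewrite ExD//; last exact: intgZ.
rewrite ExD//; last exact: intgZ.
by rewrite !ExZ// e1 e2 e3 e4 (EE f fi) (EE g gi); ring.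
Qed.

Definition sqint (f : T -> R) :=
  measurable_fun setT f /\ intg (fun w => f w ^+ 2).

Lemma sqint_mul (f g : T -> R) : sqint f -> sqint g -> intg (fun w => f w * g w).
Proof.
move=> [mf f2] [mg g2].
apply: intg_le (intgD f2 g2) _; first exact: measurable_funM.
move=> w; rewrite [leRHS]ger0_norm ?addr_ge0 ?sqr_ge0// ler_norml.
by apply/andP; split; have := sqr_ge0 (f w + g w); have := sqr_ge0 (f w - g w);
  have := sqr_ge0 (f w); have := sqr_ge0 (g w); lra.
Qed.

Lemma sqint_cst (c : R) : sqint (fun=> c).
Proof. by split=> //; exact: (finite_measure_integrable_cst P (c ^+ 2)). Qed.

Lemma sqint_intg (f : T -> R) : sqint f -> intg f.
Proof.
move=> f2; have := sqint_mul f2 (sqint_cst 1).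
by under eq_fun do rewrite mulr1.
Qed.

Lemma sqintD (f g : T -> R) : sqint f -> sqint g -> sqint (fun w => f w + g w).
Proof.
move=> sf sg; have [mf f2] := sf; have [mg g2] := sg.
split; first exact: measurable_funD.
rewrite (_ : (fun w => _) = fun w => f w ^+ 2 + g w ^+ 2 + 2 * (f w * g w)).
  by apply: intgD; [exact: intgD|apply: intgZ; exact: sqint_mul].
by apply/funext => w; ring.
Qed.

Lemma sqintZ (c : R) (f : T -> R) : sqint f -> sqint (fun w => c * f w).
Proof.
move=> [mf f2]; split; first exact: measurable_funM.
rewrite (_ : (fun w => _) = fun w => c ^+ 2 * f w ^+ 2); first exact: intgZ.
by apply/funext => w; rewrite exprMn.
Qed.

Hypotheses (sX : forall i, sqint (X i)) (X1 : forall i, Ex (X i) = 0)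
  (X2 : forall i, (\int[P]_w (X i w ^+ 2) = 1)%R).
Variable (k4 : R).
Hypotheses (sZ : forall i, sqint (fun w => X i w ^+ 2 - 1))
  (Z1 : forall i, (\int[P]_w (X i w ^+ 2 - 1) = 0)%R)
  (Z2 : forall i, (\int[P]_w ((X i w ^+ 2 - 1) ^+ 2) = k4)%R).

Let dep_cons d' (V : measurableType d') a (s : seq I) (f : T -> V) :
  depends_on X [set i in s]%SET f -> depends_on X [set i in a :: s]%SET f.
Proof.
by apply: depends_on_sub; apply/fintype.subsetP => i; rewrite !inE => ->; rewrite orbT.
Qed.

Let dep_head a (s : seq I) : depends_on X [set i in a :: s]%SET (X a).
Proof. by apply: depends_on_self; rewrite !inE eqxx. Qed.

Let dis_head a (s : seq I) : a \notin s -> [disjoint [set a]%SET & [set i in s]%SET]%B.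
Proof. by move=> sa; rewrite disjoints1 inE. Qed.

Let dep1 a : depends_on X [set a]%SET (X a).
Proof. by apply: depends_on_self; rewrite inE. Qed.

Fixpoint lin (c : I -> R) (s : seq I) (w : T) : R :=
  if s is a :: s' then c a * X a w + lin c s' w else 0.

Lemma lin_spec (c : I -> R) (s : seq I) : uniq s ->
  [/\ depends_on X [set i in s]%SET (lin c s), sqint (lin c s), Ex (lin c s) = 0 &
     (\int[P]_w (lin c s w ^+ 2) = \sum_(i <- s) c i ^+ 2)%R].
Proof.
elim: s => [_|a s IH].
  split; [exact: measurable_cst|exact: sqint_cst| |].
    by rewrite /Rintegral (expect_cst P 0).
  by rewrite big_nil /= /Rintegral expr0n (expect_cst P 0).
rewrite cons_uniq => /andP[sa us]; have [dl sl l1 l2] := IH us.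
have scX : sqint (fun w => c a * X a w) by apply: sqintZ; exact: sX.
split=> /=.
- apply: measurable_funD; last exact: dep_cons dl.
  by apply: measurable_funM => //; exact: dep_head.
- exact: sqintD.
- rewrite ExD; [|exact: sqint_intg|exact: sqint_intg].
  by rewrite ExZ ?X1 ?l1 ?mulr0 ?addr0//; exact: sqint_intg.
- rewrite big_cons.
  have [i1 e1] := Ex_indep (dis_head sa) (@dep1 a) dl (sqint_intg (sX a)) (sqint_intg sl).
  rewrite (_ : (fun w => _) = fun w => c a ^+ 2 * X a w ^+ 2 + (2 * c a * (X a w * lin c s w) + lin c s w ^+ 2)); last first.
    by apply/funext => w; ring.
  have i2 : intg (fun w => X a w ^+ 2) by case: (sX a).
  have i3 : intg (fun w => lin c s w ^+ 2) by case: sl.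
  rewrite ExD; [|exact: intgZ|by apply: intgD => //; exact: intgZ].
  rewrite ExD//; last exact: intgZ.
  by rewrite !ExZ// X2 e1 X1 l2; ring.
Qed.

(** The form on the indices in [s] with centred squares, written by peeling off the head, whose
    variable meets the later ones only through a linear form. In this shape independence can be used
    one variable at a time. *)
Fixpoint qform (D : I -> I -> R) (s : seq I) (w : T) : R :=
  if s is a :: s' then
    D a a * (X a w ^+ 2 - 1) + (X a w * lin (fun j => D a j + D j a) s' w + qform D s' w)
  else 0.

Fixpoint qvar (D : I -> I -> R) (s : seq I) : R :=
  if s is a :: s' then
    D a a ^+ 2 * k4 + (\sum_(j <- s') (D a j + D j a) ^+ 2 + qvar D s')
  else 0.

(** Every cross term is a function of the head variable times a function of the later ones, and one
    of the two factors has mean zero: [X a ^+ 2 - 1] against the remaining form, the linear form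
    against (X_a^2 - 1) X_a, and [X a] in the last case. The third moment of the entries therefore
    never appears. *)
Lemma qform_spec (D : I -> I -> R) (s : seq I) : uniq s ->
  [/\ depends_on X [set i in s]%SET (qform D s), sqint (qform D s) &
     (\int[P]_w (qform D s w ^+ 2) = qvar D s)%R].
Proof.
elim: s => [_|a s IH].
  split; [exact: measurable_cst|exact: sqint_cst|].
  by rewrite /= /Rintegral expr0n (expect_cst P 0).
rewrite cons_uniq => /andP[sa us]; have [dq sq q2] := IH us.
set c := fun j => D a j + D j a.
have [dl sl l1 l2] := lin_spec c us.
have dZ : depends_on X [set a]%SET (fun w => X a w ^+ 2 - 1).
  by apply: measurable_funB => //; apply: measurable_funX; exact: dep1.
have dX2 : depends_on X [set a]%SET (fun w => X a w ^+ 2).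
  by apply: measurable_funX; exact: dep1.
have dl2 : depends_on X [set i in s]%SET (fun w => lin c s w ^+ 2) by exact: measurable_funX.
have iX2 : intg (fun w => X a w ^+ 2) by case: (sX a).
have il2 : intg (fun w => lin c s w ^+ 2) by case: sl.
have iq2 : intg (fun w => qform D s w ^+ 2) by case: sq.
have iZ2 : intg (fun w => (X a w ^+ 2 - 1) ^+ 2) by case: (sZ a).
have dis := dis_head sa.
have [iXL eXL] := Ex_indep dis dX2 dl2 iX2 il2.
have sXL : sqint (fun w => X a w * lin c s w).
  split; first by apply: measurable_funM => //; exact: depends_on_measurable dl.
  by under eq_fun do rewrite exprMn.
have [iZq eZq] := Ex_indep dis dZ dq (sqint_intg (sZ a)) (sqint_intg sq).
have dlq : depends_on X [set i in s]%SET (fun w => lin c s w * qform D s w) by exact: measurable_funM.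
have [iXlq eXlq] := Ex_indep dis (@dep1 a) dlq (sqint_intg (sX a)) (sqint_mul sl sq).
have dZX : depends_on X [set a]%SET (fun w => (X a w ^+ 2 - 1) * X a w).
  by apply: measurable_funM => //; exact: dep1.
have [iZXl eZXl] := Ex_indep dis dZX dl (sqint_mul (sZ a) (sX a)) (sqint_intg sl).
split=> /=.
- apply: measurable_funD.
    apply: measurable_funM => //; apply: measurable_funB => //.
    by apply: measurable_funX; exact: dep_head.
  apply: measurable_funD; last exact: dep_cons dq.
  by apply: measurable_funM; [exact: dep_head|exact: dep_cons dl].
- by apply: sqintD; [exact: sqintZ|exact: sqintD].
- rewrite (_ : (fun w => _) = fun w => D a a ^+ 2 * (X a w ^+ 2 - 1) ^+ 2 +
     (X a w ^+ 2 * lin c s w ^+ 2 + (qform D s w ^+ 2 +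
     (2 * D a a * ((X a w ^+ 2 - 1) * qform D s w) +
      (2 * D a a * ((X a w ^+ 2 - 1) * X a w * lin c s w) +
       2 * (X a w * (lin c s w * qform D s w))))))); last first.
    by apply/funext => w; rewrite -/c; ring.
  have j1 := intgD (intgZ (2 * D a a) iZXl) (intgZ 2 iXlq).
  have j2 := intgD (intgZ (2 * D a a) iZq) j1.
  have j3 := intgD iq2 j2.
  have j4 := intgD iXL j3.
  have j5 := intgZ (D a a ^+ 2) iZ2.
  rewrite (ExD j5 j4) (ExD iXL j3) (ExD iq2 j2) (ExD (intgZ (2 * D a a) iZq) j1).
  rewrite (ExD (intgZ (2 * D a a) iZXl) (intgZ 2 iXlq)) !ExZ//.
  by rewrite Z2 eXL X2 l2 q2 eZq Z1 eZXl l1 eXlq X1 -/c; ring.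
Qed.

Lemma quad_qform (D : I -> I -> R) w : \sum_i D i i = 0 ->
  quad X D w = qform D (index_enum I) w.
Proof.
move=> trD; have linE c s : lin c s w = \sum_(j <- s) c j * X j w.
  by elim: s => [|a s IH] /=; rewrite ?big_nil ?big_cons ?IH.
suff h s : \sum_(i <- s) \sum_(j <- s) D i j * X i w * X j w =
    qform D s w + \sum_(i <- s) D i i.
  by rewrite /quad h trD addr0.
elim: s => [|a s IH] /=; first by rewrite !big_nil addr0.
rewrite big_cons; have -> : \sum_(i <- s) \sum_(j <- a :: s) D i j * X i w * X j w =
    \sum_(i <- s) D i a * X i w * X a w + \sum_(i <- s) \sum_(j <- s) D i j * X i w * X j w.
  by rewrite -big_split; apply: eq_bigr => i _; rewrite big_cons.
rewrite !big_cons IH linE.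
have -> : X a w * \sum_(j <- s) (D a j + D j a) * X j w =
   \sum_(j <- s) D a j * X a w * X j w + \sum_(j <- s) D j a * X j w * X a w.
  by rewrite mulr_sumr -big_split; apply: eq_bigr => j _ /=; ring.
by ring.
Qed.

(** By symmetry a pair a != j contributes (2 D a j)^2, twice its share in the squared norm, and a
    diagonal entry contributes [k4] times its square; hence the conditions [k <= 2] and [k <= k4].
    As [k4] is mu_4 - 1 for the entry law, a positive [k] is available. *)
Lemma quad_second_moment (D : I -> I -> R) (k : R) :
  (forall i j, D i j = D j i) -> \sum_i D i i = 0 -> k <= k4 -> k <= 2 -> 0 <= k ->
  k * \sum_i \sum_j D i j ^+ 2 <= \int[P]_w (quad X D w ^+ 2).
Proof.
move=> symD trD kk4 k2 k0.
have -> : (\int[P]_w (quad X D w ^+ 2) = qvar D (index_enum I))%R.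
  have [_ _ <-] := qform_spec D (index_enum_uniq I).
  by apply: eq_Rintegral => w _; rewrite quad_qform.
elim: (index_enum I) => [|a s IH] /=; first by rewrite big_nil mulr0.
rewrite big_cons; have -> : \sum_(i <- s) \sum_(j <- a :: s) D i j ^+ 2 =
    \sum_(i <- s) D i a ^+ 2 + \sum_(i <- s) \sum_(j <- s) D i j ^+ 2.
  by rewrite -big_split; apply: eq_bigr => i _; rewrite big_cons.
rewrite !big_cons.
have -> : \sum_(j <- s) D j a ^+ 2 = \sum_(j <- s) D a j ^+ 2.
  by apply: eq_bigr => j _; rewrite symD.
have -> : \sum_(j <- s) (D a j + D j a) ^+ 2 = 4 * \sum_(j <- s) D a j ^+ 2.
  by rewrite mulr_sumr; apply: eq_bigr => j _; rewrite (symD j); ring.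
have s1 : 0 <= \sum_(j <- s) D a j ^+ 2 by apply: sumr_ge0 => j _; exact: sqr_ge0.
have h1 : k * D a a ^+ 2 <= D a a ^+ 2 * k4 by rewrite mulrC ler_wpM2l ?sqr_ge0.
have h2 : k * (\sum_(j <- s) D a j ^+ 2) <= 2 * \sum_(j <- s) D a j ^+ 2 by rewrite ler_wpM2r.
move: IH; rewrite !mulrDr; lra.
Qed.

End second_moment.

(** * Uniform constants for normalized forms, depending on the entry law only *)

Section law_transfer.
Context (R : realType) (mu : probability R R) (d : measure_display)
  (T : measurableType d) (P : probability T R) (Y : {RV P >-> R}).
Hypothesis lawY : has_law Y mu.

Lemma ge0_expect_law (f : R -> \bar R) : measurable_fun setT f ->
  (forall x, (0 <= f x)%E) -> (\int[P]_w f (Y w) = \int[mu]_x f x)%E.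
Proof.
move=> mf f0; rewrite -[LHS](ge0_integral_distribution Y mf f0).
by apply: eq_measure_integral => A mA _; first [exact: lawY|exact/esym/lawY].
Qed.

Lemma integrable_law (f : R -> R) : mu.-integrable setT (EFin \o f) ->
  P.-integrable setT (EFin \o (fun w => f (Y w))).
Proof.
move=> /integrableP[mf fi]; apply/integrableP; split.
  apply/measurable_EFinP; apply: measurableT_comp => //.
  exact/measurable_EFinP.
rewrite (ge0_expect_law (f := fun x => `|(EFin \o f) x|%E))//.
exact: measurableT_comp.
Qed.

Lemma expect_law (f : R -> R) : mu.-integrable setT (EFin \o f) ->
  (\int[P]_w (f (Y w))%:E = \int[mu]_x (f x)%:E)%E.
Proof.
move=> fi; have /integrableP[mf _] := fi.
rewrite -[LHS](integral_distribution mf (integrable_law fi)).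
by apply: eq_measure_integral => A mA _; first [exact: lawY|exact/esym/lawY].
Qed.

End law_transfer.

Lemma prob_le_expect_expR (R : realType) (d : measure_display) (T : measurableType d)
    (P : probability T R) (g : T -> R) : measurable_fun setT g ->
  (P [set w | 0 <= g w]%R <= \int[P]_w (expR (g w))%:E)%E.
Proof.
move=> mg; have mA : measurable [set w | 0 <= g w].
  by have := measurable_fun_le measurableT (measurable_cst (0 : R)) mg; rewrite setTI.
apply: (@le_trans _ _ (\int[P]_w (\1_[set w | 0 <= g w]%R w)%:E)%E).
  by rewrite (integral_indic P measurableT mA) setIT.
apply: le_expect => //; first by apply: measurableT_comp.
move=> w; rewrite indicE; case: (boolP (w \in _)); rewrite ?expR_ge0 ?ler01 ?lexx//=.
by rewrite inE /= => gw; rewrite -expR0 ler_expR.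
Qed.

(** This plays the role of a Paley-Zygmund argument: a lower bound on the second moment and an upper
    bound on the fourth force E exp(-u) below 1. The quadratic term stands on the left so that all
    integrands are nonnegative. *)
Lemma expRN_le_poly (R : realType) (u : R) : 0 <= u ->
  expR (- u) + u ^+ 2 / 2 <= 1 + u ^+ 4 / 2.
Proof.
move=> u0; have h1 : expR (- u) * (1 + u) <= 1.
  have E : expR (- u) * expR u = 1 by rewrite -expRD addNr expR0.
  by rewrite -[leRHS]E ler_wpM2l ?expR_ge0 ?expR_ge1Dx.
have e0 := expR_ge0 (- u).
have u4 : u ^+ 4 = (u ^+ 2) ^+ 2 by rewrite -exprM.
have [u1|u1] := lerP u 1; last first.
  have : 1 <= u ^+ 2 by nra.
  have : expR (- u) <= 1 by rewrite -expR0 ler_expR; lra.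
  by rewrite u4; nra.
have : 0 <= u ^+ 4 by rewrite u4 sqr_ge0.
have h2 : 0 <= (1 - u) * u by rewrite mulr_ge0// subr_ge0.
by nra.
Qed.

Lemma quad_scale (R : realType) (d : measure_display) (T : measurableType d)
    (P : probability T R) (I : finType) (X : I -> {RV P >-> R}) (c : R) D w :
  quad X (fun i j => c * D i j) w = c * quad X D w.
Proof.
rewrite /quad mulr_sumr; apply: eq_bigr => i _.
by rewrite mulr_sumr; apply: eq_bigr => j _; rewrite !mulrA.
Qed.

(** The first bound comes from [expect_expR_quad] for [D] and for [-D]. It also bounds the fourth
    moment by some [B], so that E exp(-s |Q|) <= 1 - s^2 k / 2 + s^4 B / 2, where [k] bounds the
    second moment from below. *)
Lemma quad_constants (R : realType) (mu : probability R R) : entry_law mu ->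
  exists t M s delta : R, [/\ 0 < t, 1 <= M, 0 < s & 0 < delta] /\
  forall (d : measure_display) (T : measurableType d) (P : probability T R)
    (I : finType) (X : I -> {RV P >-> R}),
  mutually_independent X -> (forall i, has_law (X i) mu) ->
  forall D : I -> I -> R, (forall i j, D i j = D j i) ->
  \sum_i D i i = 0 -> \sum_i \sum_j D i j ^+ 2 = 1 ->
  (\int[P]_w (expR (t * `|quad X D w|))%:E <= M%:E)%E /\
  (\int[P]_w (expR (- (s * `|quad X D w|)))%:E <= (expR (- delta))%:E)%E.
Proof.
move=> [[K [K0 muK]] mui mu1 mu2 mu4].
have [C1 C10 m1] := subgaussian_mgf K0 muK mu1.
have [C2 [s0 [C20 s00 m2]]] := subgaussian_sqr_mgf K0 muK mu2.
pose g x : R := (x ^+ 2 - 1) ^+ 2.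
have mg : measurable_fun setT g.
  by apply: measurable_funX; apply: measurable_funB => //; exact: measurable_funX.
have K2 : 0 < K ^+ 2 by rewrite exprn_gt0.
have K4 : 0 < K ^+ 4 by rewrite exprn_gt0.
have eK x : x ^+ 4 <= 4 * K ^+ 4 * expR (x ^+ 2 / K ^+ 2).
  have -> : x ^+ 4 = K ^+ 4 * (x ^+ 2 / K ^+ 2) ^+ 2 by field; rewrite gt_eqF.
  have -> : 4 * K ^+ 4 * expR (x ^+ 2 / K ^+ 2) = K ^+ 4 * (4 * expR (x ^+ 2 / K ^+ 2)) by ring.
  by rewrite ler_pM2l// expR_ge_sqr// divr_ge0 ?sqr_ge0.
have e1 x : 1 <= expR (x ^+ 2 / K ^+ 2).
  by rewrite -expR0 ler_expR divr_ge0// sqr_ge0.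
have i4 : mu.-integrable setT (EFin \o (fun x => x ^+ 4)).
  apply: (integrable_dominated muK (C := 4 * K ^+ 4)); first exact: measurable_funX.
  by move=> x; rewrite ger0_norm// (exprM x 2 2) sqr_ge0.
have i2 : mu.-integrable setT (EFin \o (fun x => x ^+ 2)).
  apply: (integrable_dominated muK (C := 4 * K ^+ 4 + 1)); first exact: measurable_funX.
  move=> x; rewrite ger0_norm ?sqr_ge0// mulrDl mul1r.
  have := eK x; have := e1 x; have -> : x ^+ 4 = (x ^+ 2) ^+ 2 by rewrite -exprM.
  by have := sqr_ge0 x; nra.
have i1 : mu.-integrable setT (EFin \o (fun=> 1)).
  exact: (finite_measure_integrable_cst mu 1).
pose k4 : R := fine (\int[mu]_x (x ^+ 4)%:E)%E - 1.
have mu4f : (\int[mu]_x (x ^+ 4)%:E)%E \is a fin_num by exact: integrable_fin_num i4.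
have k40 : 0 < k4.
  by rewrite subr_gt0 -lte_fin fineK.
have gE : EFin \o g = (fun x => (x ^+ 4)%:E + ((-2)%:E * (x ^+ 2)%:E + 1%:E))%E.
  by apply/funext => x /=; rewrite -!EFinM -!EFinD; congr EFin; rewrite /g; ring.
have i2' : mu.-integrable setT (fun x => (-2)%:E * (x ^+ 2)%:E)%E by exact: integrableZl.
have ig : mu.-integrable setT (EFin \o g).
  by rewrite gE; apply: integrableD => //; apply: integrableD.
have Eg : (\int[mu]_x (g x)%:E = k4%:E)%E.
  transitivity (\int[mu]_x ((x ^+ 4)%:E + ((-2)%:E * (x ^+ 2)%:E + 1%:E)))%E.
    by apply: eq_integral => x _; have := congr1 (fun f => f x) gE.
  rewrite integralD//; last exact: integrableD.
  rewrite integralD// integralZl// mu2 expect_cst mule1 -EFinD -(fineK mu4f) -EFinD.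
  by congr EFin; rewrite /k4; ring.
pose k := Num.min k4 2.
have k0 : 0 < k by rewrite /k lt_min k40 ltr0n.
(* The first bound keeps 2 t within the range [s0] of the squared entries; the second gives 256 C1
   (C1 + 1) t^2 <= C1 / (C1 + 1). *)
pose t := Num.min (s0 / 2) (16 * (C1 + 1))^-1.
have c16 : 0 < 16 * (C1 + 1) by rewrite mulr_gt0 ?addr_gt0.
have t0 : 0 < t by rewrite /t lt_min divr_gt0 ?invr_gt0.
have ts : 2 * t <= s0 by rewrite mulrC -ler_pdivlMr// /t ge_min lexx.
have t1 : 256 * C1 * (C1 + 1) * t ^+ 2 <= 1.
  have h : t * (16 * (C1 + 1)) <= 1.
    by rewrite -ler_pdivlMr// mul1r /t ge_min lexx orbT.
  have h0 : 0 <= t * (16 * (C1 + 1)) by rewrite mulr_ge0 ?ltW.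
  have : (t * (16 * (C1 + 1))) ^+ 2 <= 1 by rewrite exprn_ile1.
  have : 0 <= 256 * (C1 + 1) * t ^+ 2.
    by rewrite !mulr_ge0 ?sqr_ge0 ?ltW// addr_gt0.
  by lra.
pose M0 := expR (4 * C2 * t ^+ 2) + (1 + 4 * expR (C1 + 1)).
have M01 : 1 <= M0.
  by rewrite /M0; have := expR_ge0 (4 * C2 * t ^+ 2); have := expR_ge0 (C1 + 1); lra.
(* From x^2 <= 4 exp x at x = t |Q| / 2 follows Q^4 <= (256 / t^4) exp(t |Q|), whose mean is at most
   this [B]. *)
pose B := 256 * (2 * M0) / t ^+ 4.
have M00 : 0 < M0 by exact: lt_le_trans M01.
have B0 : 0 < B by apply: divr_gt0; rewrite ?exprn_gt0// mulr_gt0// mulr_gt0.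
(* This value minimizes - s^2 k / 2 + s^4 B / 2; the minimum is - k^2 / (8 B), whence [delta]. *)
pose s := Num.sqrt (k / (2 * B)).
have s0' : 0 < s by rewrite /s sqrtr_gt0 divr_gt0// mulr_gt0.
have s2 : s ^+ 2 = k / (2 * B) by rewrite /s sqr_sqrtr// ltW// divr_gt0// mulr_gt0.
exists t, (2 * M0), s, (k ^+ 2 / (8 * B)); split.
  split => //; first by lra.
  by apply: divr_gt0; [exact: exprn_gt0|exact: mulr_gt0].
move=> d T P I X indX lawX D symD trD D1.
have mgf1 i a : (\int[P]_w (expR (a * X i w))%:E <= (expR (C1 * a ^+ 2))%:E)%E.
  rewrite (ge0_expect_law (lawX i) (f := fun x => (expR (a * x))%:E))//.
  by apply/measurable_EFinP; apply: measurableT_comp => //; exact: measurable_funM.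
have mgf2 i a : `|a| <= s0 ->
    (\int[P]_w (expR (a * (X i w ^+ 2 - 1)))%:E <= (expR (C2 * a ^+ 2))%:E)%E.
  move=> as0; rewrite (ge0_expect_law (lawX i) (f := fun x => (expR (a * (x ^+ 2 - 1)))%:E))//; first exact: m2.
  apply/measurable_EFinP; apply: measurableT_comp => //; apply: measurable_funM => //.
  by apply: measurable_funB => //; exact: measurable_funX.
set Q := quad X D.
have mQ : measurable_fun setT Q by exact: measurable_quad.
have mE a : measurable_fun setT (fun w => expR (a * Q w)).
  by apply: measurableT_comp => //; exact: measurable_funM.
have mEa a : measurable_fun setT (fun w => expR (a * `|Q w|)).
  apply: measurableT_comp => //; apply: measurable_funM => //; exact: measurableT_comp.
have QM : (\int[P]_w (expR (t * `|Q w|))%:E <= (2 * M0)%:E)%E.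
  apply: (@le_trans _ _ (\int[P]_w (expR (t * Q w) + expR (- t * Q w))%:E)%E).
    apply: le_expect => //; first exact: measurable_funD.
    move=> w; rewrite expR_ge0 /=; case: (ler0P (Q w)) => _.
      by rewrite mulrN -mulNr lerDr expR_ge0.
    by rewrite lerDl expR_ge0.
  rewrite expectD//; try by move=> w; exact: expR_ge0.
  rewrite mulrDl mul1r EFinD leeD//.
    by apply: (expect_expR_quad indX C10 C20 mgf1 mgf2) => //; rewrite D1.
  have -> : (\int[P]_w (expR (- t * Q w))%:E =
      \int[P]_w (expR (t * quad X (fun i j => -1 * D i j) w))%:E)%E.
    by apply: eq_integral => w _; rewrite quad_scale mulN1r mulrN mulNr.
  apply: (expect_expR_quad indX C10 C20 mgf1 mgf2) => //.
    by rewrite -mulr_sumr trD mulr0.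
  under eq_bigr do under eq_bigr do rewrite mulN1r sqrrN.
  by rewrite D1.
split=> //.
have iX i : P.-integrable setT (EFin \o X i).
  by apply: (integrable_law (lawX i) (f := fun x => x)); exact: mui.
have iX2 i : P.-integrable setT (EFin \o (fun w => X i w ^+ 2)).
  exact: (integrable_law (lawX i) (f := fun x => x ^+ 2)).
have EX2 i : (\int[P]_w (X i w ^+ 2)%:E = 1)%E.
  by rewrite (expect_law (lawX i) (f := fun x => x ^+ 2)).
have i1P : P.-integrable setT (EFin \o (fun=> 1)).
  exact: (finite_measure_integrable_cst P 1).
have sX i : sqint P (X i) by split => //; exact: iX2.
have EX i : (\int[P]_w X i w = 0)%R.
  by rewrite /Rintegral (expect_law (lawX i) (f := fun x => x))// mu1.
have EX2' i : (\int[P]_w (X i w ^+ 2) = 1)%R by rewrite /Rintegral EX2.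
have sZ i : sqint P (fun w => X i w ^+ 2 - 1).
  split; first by apply: measurable_funB => //; exact: measurable_funX.
  exact: (integrable_law (lawX i) (f := g)).
have EZ i : (\int[P]_w (X i w ^+ 2 - 1) = 0)%R.
  have im1 : P.-integrable setT (EFin \o (fun=> -1)).
    exact: (finite_measure_integrable_cst P (-1)).
  by rewrite (ExD (iX2 i) im1) EX2' /Rintegral expect_cst /= subrr.
have EZ2 i : (\int[P]_w (X i w ^+ 2 - 1) ^+ 2 = k4)%R.
  by rewrite /Rintegral (expect_law (lawX i) (f := g))// Eg.
have kk4 : k <= k4 by rewrite /k ge_min lexx.
have kk2 : k <= 2 by rewrite /k ge_min lexx orbT.
have := quad_second_moment indX sX EX EX2' sZ EZ EZ2 symD trD kk4 kk2 (ltW k0).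
rewrite D1 mulr1.
rewrite /Rintegral => Q2.
have mQ2 a : measurable_fun setT (fun w => a * Q w ^+ 2).
  by apply: measurable_funM => //; exact: measurable_funX.
have mQ4 a : measurable_fun setT (fun w => a * Q w ^+ 4).
  by apply: measurable_funM => //; exact: measurable_funX.
have q4 x : 0 <= x ^+ 4 :> R by rewrite (exprM x 2 2) sqr_ge0.
have Q4 : (\int[P]_w (1 * Q w ^+ 4)%:E <= B%:E)%E.
  apply: (@le_trans _ _ (\int[P]_w (256 / t ^+ 4 * expR (t * `|Q w|))%:E)%E).
    apply: le_expect => //; first exact: measurable_funM.
    move=> w; rewrite mul1r q4 /=.
    have h := @expR_ge_sqr R (t * `|Q w| / 2).
    have {h} : (t * `|Q w| / 2) ^+ 2 <= 4 * expR (t * `|Q w| / 2).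
      by apply: h; rewrite divr_ge0 ?mulr_ge0// ltW.
    move=> h; have : ((t * `|Q w| / 2) ^+ 2) ^+ 2 <= (4 * expR (t * `|Q w| / 2)) ^+ 2.
      by rewrite lerXn2r ?nnegrE ?sqr_ge0 ?mulr_ge0 ?expR_ge0.
    have -> : (4 * expR (t * `|Q w| / 2)) ^+ 2 = 16 * expR (t * `|Q w|).
      rewrite exprMn (expr2 (expR _)) -expRD -splitr; ring.
    have -> : ((t * `|Q w| / 2) ^+ 2) ^+ 2 = t ^+ 4 * Q w ^+ 4 / 16.
      have -> : Q w ^+ 4 = `|Q w| ^+ 4 by rewrite (exprM _ 2 2) (exprM `|_| 2 2) real_normK ?num_real.
      by field.
    move=> h4; rewrite mulrAC ler_pdivlMr ?exprn_gt0//.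
    by move: h4; rewrite mulrC; lra.
  rewrite expectZ//; last by rewrite divr_ge0// exprn_ge0 ?ltW.
  apply: le_trans (lee_wpmul2l _ QM) _.
    by rewrite lee_fin divr_ge0// exprn_ge0 ?ltW.
  by rewrite -EFinM lee_fin /B le_eqVlt; apply/orP; left; apply/eqP; ring.
have fin2 : (\int[P]_w (1 * Q w ^+ 2)%:E)%E \is a fin_num.
  rewrite ge0_fin_numE; last by apply: integral_ge0 => w _; rewrite lee_fin mul1r sqr_ge0.
  apply: le_lt_trans (ltry (1 + B)).
  apply: (@le_trans _ _ (\int[P]_w (1 + 1 * Q w ^+ 4)%:E)%E).
    apply: le_expect => //; first exact: measurable_funD.
    move=> w; rewrite !mul1r sqr_ge0 /= (exprM _ 2 2).
    by have := sqr_ge0 (Q w ^+ 2 - 1); have := sqr_ge0 (Q w); nra.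
  rewrite expectD//; last by move=> w; rewrite mul1r.
  by rewrite expect_cst EFinD leeD2l.
have mEs : measurable_fun setT (fun w => expR (- (s * `|Q w|))).
  by under eq_fun do rewrite -mulNr; exact: mEa.
have main : (\int[P]_w (expR (- (s * `|Q w|)))%:E +
    (s ^+ 2 / 2)%:E * \int[P]_w (1 * Q w ^+ 2)%:E <= (1 + s ^+ 4 / 2 * B)%:E)%E.
  rewrite -expectZ ?divr_ge0 ?sqr_ge0//; last by move=> w; rewrite mul1r sqr_ge0.
  have mQ2' : measurable_fun setT (fun w => s ^+ 2 / 2 * (1 * Q w ^+ 2)) by exact: measurable_funM.
  have mQ4' : measurable_fun setT (fun w => s ^+ 4 / 2 * (1 * Q w ^+ 4)) by exact: measurable_funM.
  rewrite -expectD//; try by move=> w; rewrite mul1r mulr_ge0 ?divr_ge0 ?sqr_ge0.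
  apply: (@le_trans _ _ (\int[P]_w (1 + s ^+ 4 / 2 * (1 * Q w ^+ 4))%:E)%E).
    apply: le_expect.
    - by apply: measurable_funD => //; apply: measurable_funM.
    - by apply: measurable_funD => //; apply: measurable_funM.
    - move=> w.
      have n0 : 0 <= s ^+ 2 / 2 * Q w ^+ 2.
        by apply: mulr_ge0; [apply: divr_ge0; [exact: sqr_ge0|]|exact: sqr_ge0].
      rewrite !mul1r (addr_ge0 (expR_ge0 _) n0) /=.
      have := @expRN_le_poly R (s * `|Q w|); rewrite !exprMn real_normK ?num_real//.
      have -> : `|Q w| ^+ 4 = Q w ^+ 4 by rewrite (exprM `|_| 2 2) real_normK ?num_real// -exprM.
      by move=> /(_ (mulr_ge0 (ltW s0') (normr_ge0 _))); lra.
  rewrite expectD//; try by move=> w; rewrite mul1r mulr_ge0 ?divr_ge0.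
  rewrite expectZ ?divr_ge0//; last by move=> w; rewrite mul1r.
  by rewrite expect_cst [leRHS]EFinD leeD2l// [leRHS]EFinM lee_wpmul2l// lee_fin divr_ge0.
have Q2' : (k%:E <= \int[P]_w (1 * Q w ^+ 2)%:E)%E.
  rewrite -(fineK fin2) lee_fin; apply: le_trans Q2 _.
  have -> // : (\int[P]_w (1 * Q w ^+ 2)%:E = \int[P]_w (Q w ^+ 2)%:E)%E.
  by apply: eq_integral => w _; rewrite mul1r.
have fE : (\int[P]_w (expR (- (s * `|Q w|)))%:E)%E \is a fin_num.
  rewrite ge0_fin_numE; last by apply: integral_ge0 => w _; rewrite lee_fin expR_ge0.
  apply: le_lt_trans (ltry 1); rewrite -(expect_cst P 1); apply: le_expect => //.
  by move=> w; rewrite expR_ge0 -expR0 ler_expR oppr_le0 mulr_ge0// ltW.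
move: main Q2'; rewrite -(fineK fE) -(fineK fin2) -EFinM -EFinD !lee_fin => main Q2'.
apply: le_trans (expR_ge1Dx _).
have h1 : s ^+ 2 / 2 * k <= s ^+ 2 / 2 * fine (\int[P]_w (1 * Q w ^+ 2)%:E)%E.
  by rewrite ler_wpM2l// divr_ge0 ?sqr_ge0.
have h2 : s ^+ 2 / 2 * k = k ^+ 2 / (4 * B) by rewrite s2; field; rewrite gt_eqF.
have h3 : s ^+ 4 / 2 * B = k ^+ 2 / (8 * B).
  by rewrite (exprM _ 2 2) s2; field; rewrite gt_eqF.
have h4 : k ^+ 2 / (4 * B) = k ^+ 2 / (8 * B) + k ^+ 2 / (8 * B) by field; rewrite gt_eqF.
by move: main h1; rewrite h2 h3 h4; lra.
Qed.

(** * Two-sided estimate for one fixed symmetric matrix *)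

Section block_independence.
Context (R : realType) (d : measure_display) (T : measurableType d)
  (P : probability T R) (I J : finType) (X : I -> {RV P >-> R}).
Hypothesis indX : mutually_independent X.

Lemma expect_prod_blocks (A : J -> {set I}) (f : J -> T -> R) (c : R) (s : seq J) :
  (forall k l, k != l -> [disjoint A k & A l]%B) ->
  (forall k, depends_on X (A k) (f k)) -> (forall k w, 0 <= f k w) ->
  (forall k, (\int[P]_w (f k w)%:E <= c%:E)%E) -> 0 <= c -> uniq s ->
  (\int[P]_w (\prod_(k <- s) f k w)%:E <= (c ^+ size s)%:E)%E.
Proof.
move=> dA df f0 fc c0; elim: s => [_|a s IH].
  by under eq_integral do rewrite big_nil; rewrite expect_cst.
rewrite cons_uniq => /andP[sa us].
pose U := [set x | [exists k in s, x \in A k]]%SET.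
under eq_integral do rewrite big_cons.
rewrite (ge0_expectM indX (A := A a) (B := U)).
- rewrite /= exprS EFinM lee_pmul ?IH//.
    by apply: integral_ge0 => w _; rewrite lee_fin.
  by apply: integral_ge0 => w _; rewrite lee_fin prodr_ge0.
- rewrite -setI_eq0; apply/eqP/setP => x; rewrite !inE; apply/negP => /andP[xa].
  move=> /existsP[k /andP[ks xk]].
  have ak : a != k by apply: contraNneq sa => ->.
  by have := disjointFr (dA _ _ ak) xa; rewrite xk.
- exact: df.
- rewrite (_ : (fun w => _) = fun w => \prod_(k <- s) (if k \in s then f k w else 1)); last first.
    by apply/funext => w; rewrite big_seq [RHS]big_seq; apply: eq_bigr => k ->.
  apply: measurable_prod => k _; case: (boolP (k \in s)) => ks; last exact: measurable_cst.
  apply: depends_on_sub (df k); apply/fintype.subsetP => x xk; rewrite inE.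
  by apply/existsP; exists k; rewrite ks.
- by [].
- by move=> w; rewrite prodr_ge0.
Qed.

Lemma depends_on_quad (A : {set I}) (D : I -> I -> R) :
  (forall i j, (i \notin A) || (j \notin A) -> D i j = 0) ->
  depends_on X A (quad X D).
Proof.
move=> D0; rewrite (_ : quad X D = fun w => \sum_i \sum_j
    (if (i \in A) && (j \in A) then D i j * X i w * X j w else 0)).
  apply: measurable_sum => i; apply: measurable_sum => j.
  case: (boolP (i \in A)) => iA /=; last exact: measurable_cst.
  case: (boolP (j \in A)) => jA; last exact: measurable_cst.
  apply: measurable_funM; last exact: depends_on_self.
  by apply: measurable_funM => //; exact: depends_on_self.
apply/funext => w; apply: eq_bigr => i _; apply: eq_bigr => j _.
case: ifPn => //; rewrite negb_and => /D0 ->.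
by rewrite !mul0r.
Qed.

End block_independence.

Section paired_forms.
Context (R : realType) (d : measure_display) (T : measurableType d)
  (P : probability T R) (m n : nat) (X : 'I_m * 'I_n -> {RV P >-> R}).

(** The Kronecker product of the diagonal sign matrix, 1 at [i1] and -1 at [i2], with [M]: a
    difference of two measurements seen as one form in all entries of all sensing vectors. The
    opposite signs cancel the trace for every [M]. *)
Definition pair_form (M : 'M[R]_n) (i1 i2 : 'I_m) (x y : 'I_m * 'I_n) : R :=
  (x.1 == y.1)%:R * ((x.1 == i1)%:R - (x.1 == i2)%:R) * M x.2 y.2.

Let sum_sign (i1 i2 : 'I_m) (F : 'I_m -> R) :
  \sum_i ((i == i1)%:R - (i == i2)%:R) * F i = F i1 - F i2.
Proof.
have h k : \sum_i (i == k)%:R * F i = F k.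
  rewrite (bigD1 k)//= eqxx mul1r big1 ?addr0// => i /negbTE ->.
  by rewrite mul0r.
by under eq_bigr do rewrite mulrBl; rewrite sumrB !h.
Qed.

Let sum_block (s : 'I_m -> R) (G : 'I_m -> 'I_n -> 'I_n -> R) :
  \sum_(x : 'I_m * 'I_n) \sum_(y : 'I_m * 'I_n) (x.1 == y.1)%:R * s x.1 * G x.1 x.2 y.2 =
  \sum_i s i * \sum_j \sum_l G i j l.
Proof.
rewrite -(pair_bigA _ (fun i j => \sum_(y : 'I_m * 'I_n) (i == y.1)%:R * s i * G i j y.2)) /=.
apply: eq_bigr => i _; rewrite mulr_sumr; apply: eq_bigr => j _.
rewrite -(pair_bigA _ (fun i' l => (i == i')%:R * s i * G i j l)) /=.
rewrite (bigD1 i)//= [X in _ + X]big1 ?addr0; last first.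
  by move=> i' /negbTE ii'; rewrite big1// => l _; rewrite eq_sym ii' !mul0r.
by rewrite mulr_sumr; apply: eq_bigr => l _; rewrite eqxx mul1r.
Qed.

Lemma quad_pair_form (M : 'M[R]_n) (i1 i2 : 'I_m) w :
  quad X (pair_form M i1 i2) w =
  meas (fun i => \col_j X (i, j) w) M i1 - meas (fun i => \col_j X (i, j) w) M i2.
Proof.
rewrite -sum_sign -[RHS]/(\sum_i _ * (((\col_j X (i, j) w)^T *m M *m \col_j X (i, j) w) 0 0)).
transitivity (\sum_i ((i == i1)%:R - (i == i2)%:R) *
    \sum_j \sum_l M j l * X (i, j) w * X (i, l) w).
  rewrite -(sum_block _ (fun i j l => M j l * X (i, j) w * X (i, l) w)).
  apply: eq_bigr => -[i j] _; apply: eq_bigr => -[i' l] _; rewrite /pair_form /=.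
  by case: eqVneq => [->|_]; rewrite ?mul0r// !mulrA.
apply: eq_bigr => i _; congr (_ * _); rewrite mxE exchange_big.
apply: eq_bigr => l _; rewrite !mxE mulr_suml; apply: eq_bigr => j _.
by rewrite !mxE mulrC [M j l * _]mulrC mulrC.
Qed.

Lemma pair_form_sym (M : 'M[R]_n) i1 i2 x y : M^T = M ->
  pair_form M i1 i2 x y = pair_form M i1 i2 y x.
Proof.
move=> Ms; rewrite /pair_form eq_sym; case: eqVneq => [->|_]; last by rewrite !mul0r.
by rewrite -{1}Ms mxE.
Qed.

Lemma pair_form_trace (M : 'M[R]_n) i1 i2 : \sum_x pair_form M i1 i2 x x = 0.
Proof.
rewrite -(pair_bigA _ (fun i j => pair_form M i1 i2 (i, j) (i, j))) /=.
transitivity (\sum_i ((i == i1)%:R - (i == i2)%:R) * \sum_j M j j).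
  apply: eq_bigr => i _; rewrite mulr_sumr; apply: eq_bigr => j _.
  by rewrite /pair_form eqxx mul1r.
by rewrite sum_sign subrr.
Qed.

Lemma frob_sqr (p q : nat) (M : 'M[R]_(p, q)) :
  frob M ^+ 2 = \sum_(i < p) \sum_(j < q) M i j ^+ 2.
Proof.
rewrite sqr_sqrtr//; apply: sumr_ge0 => i _; apply: sumr_ge0 => j _.
exact: sqr_ge0.
Qed.

Lemma pair_form_norm (M : 'M[R]_n) i1 i2 : i1 != i2 ->
  \sum_x \sum_y pair_form M i1 i2 x y ^+ 2 = 2 * frob M ^+ 2.
Proof.
move=> i12.
pose s (i : 'I_m) : R := ((i == i1)%:R - (i == i2)%:R) ^+ 2.
transitivity (\sum_i s i * \sum_j \sum_l M j l ^+ 2).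
  rewrite -(sum_block s (fun i j l => M j l ^+ 2)).
  apply: eq_bigr => x _; apply: eq_bigr => y _; rewrite /pair_form /s.
  by case: eqP => _; rewrite ?mul0r ?mul1r ?expr0n// exprMn.
rewrite -mulr_suml frob_sqr; congr (_ * _); rewrite /s.
under eq_bigr do rewrite expr2.
have i21 : i2 != i1 by rewrite eq_sym.
by rewrite sum_sign !eqxx (negbTE i12) (negbTE i21) subr0 sub0r opprK.
Qed.

End paired_forms.

(** The differences involve disjoint pairs of sensing vectors, hence are independent, and each is
    sqrt 2 |M|_F times a form of unit coefficient norm covered by [quad_constants]. Chernoff bounds
    on both sides follow. *)
Lemma rip_fixed (R : realType) (mu : probability R R) : entry_law mu ->
  exists c C c' : R, [/\ 0 < c, 0 < C & 0 < c'] /\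
  forall (m n p : nat) (d : measure_display) (T : measurableType d)
    (P : probability T R) (X : 'I_m * 'I_n -> {RV P >-> R}),
  mutually_independent X -> (forall k, has_law (X k) mu) ->
  forall i1 i2 : 'I_p -> 'I_m, injective i1 -> injective i2 ->
  (forall k l, i1 k != i2 l) ->
  forall M : 'M[R]_n, M^T = M ->
  exists G : set T, [/\ measurable G,
    (P (~` G) <= (2 * expR (- (c' * p%:R)))%:E)%E &
    forall w, G w -> let a i := \col_j X (i, j) w in
      c * p%:R * frob M <= \sum_k `|meas a M (i1 k) - meas a M (i2 k)| /\
      \sum_k `|meas a M (i1 k) - meas a M (i2 k)| <= C * p%:R * frob M].
Proof.
move=> muE; have [t [B [s [delta [[t0 B1 s0 d0] cst]]]]] := quad_constants muE.
(* With this [C0] the upper tail bound exp(- t C0 p) B^p is exp(-p); with this [c0] the lower one,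
   exp(s c0 p - delta p), is exp(- delta p / 2). *)
pose C0 := (1 + ln B) / t; pose c0 := delta / (2 * s).
have B0 : 0 < B by exact: lt_le_trans B1.
have lnB : 0 <= ln B by rewrite ln_ge0.
have C00 : 0 < C0 by rewrite /C0 divr_gt0// ltr_wpDr.
have c00 : 0 < c0 by rewrite /c0 divr_gt0// mulr_gt0.
have s2 : 0 < Num.sqrt 2 :> R by rewrite sqrtr_gt0.
exists (c0 * Num.sqrt 2), (C0 * Num.sqrt 2), (Num.min 1 (delta / 2)); split.
  split; [exact: mulr_gt0|exact: mulr_gt0|].
  by rewrite lt_min ltr01 divr_gt0.
move=> m n p d T P X indX lawX i1 i2 inj1 inj2 i12 M Ms.
pose mdiff w k := meas (fun i => \col_j X (i, j) w) M (i1 k) -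
  meas (fun i => \col_j X (i, j) w) M (i2 k).
have F0 : 0 <= frob M by exact: sqrtr_ge0.
(* The forms are normalized by |M|_F below; for M = 0 both bounds hold on the whole space. *)
have [FM0|FM0] := eqVneq (frob M) 0.
  exists setT; split => //.
    by rewrite setCT measure0 lee_fin mulr_ge0 ?expR_ge0.
  have M0 : M = 0.
    apply/matrixP => i j; rewrite mxE; apply/eqP; rewrite -sqrf_eq0.
    have := frob_sqr M; rewrite FM0 expr0n /= => /esym/eqP.
    rewrite psumr_eq0 => [|i' _]; last by apply: sumr_ge0 => j' _; exact: sqr_ge0.
    move=> /allP/(_ i (mem_index_enum _)) /=.
    rewrite psumr_eq0 => [|j' _]; last exact: sqr_ge0.
    by move=> /allP/(_ j (mem_index_enum _)).
  move=> w _ a; rewrite FM0 !mulr0; split; first exact: sumr_ge0.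
  by rewrite big1// => k _; rewrite /meas M0 !mulmx0 !mul0mx !mxE subrr normr0.
have FM : 0 < frob M by rewrite lt_def FM0 F0.
pose N := Num.sqrt 2 * frob M.
have N0 : 0 < N by rewrite /N mulr_gt0.
pose D k x y := N^-1 * pair_form M (i1 k) (i2 k) x y.
pose q k w := quad X (D k) w.
have qE k w : mdiff w k = N * q k w.
  by rewrite /q quad_scale mulrA mulfV ?gt_eqF// mul1r quad_pair_form.
have qc k : (\int[P]_w (expR (t * `|q k w|))%:E <= B%:E)%E /\
    (\int[P]_w (expR (- (s * `|q k w|)))%:E <= (expR (- delta))%:E)%E.
  apply: cst => //.
  - by move=> x y; rewrite /D pair_form_sym.
  - by rewrite /D -mulr_sumr pair_form_trace mulr0.
  - under eq_bigr do under eq_bigr do rewrite exprMn.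
    under eq_bigr do rewrite -mulr_sumr.
    rewrite -mulr_sumr pair_form_norm// /N exprVn exprMn sqr_sqrtr// mulVf//.
    by rewrite mulf_neq0// sqrf_eq0.
pose A k := [set x : 'I_m * 'I_n | (x.1 == i1 k) || (x.1 == i2 k)]%SET.
have dA k l : k != l -> [disjoint A k & A l]%B.
  move=> kl; rewrite -setI_eq0; apply/eqP/setP => x; rewrite !inE; apply/negP.
  move=> /andP[/orP[]/eqP -> /orP[]/eqP E].
  - by move: kl; rewrite (inj1 _ _ E) eqxx.
  - by have := i12 k l; rewrite E eqxx.
  - by have := i12 l k; rewrite E eqxx.
  - by move: kl; rewrite (inj2 _ _ E) eqxx.
have dq k : depends_on X (A k) (q k).
  apply: depends_on_quad => x y; rewrite /D /pair_form !inE !negb_or => h.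
  have [xy|_] := eqVneq x.1 y.1; last by rewrite !mul0r mulr0.
  move: h; rewrite -xy orbb => /andP[/negbTE -> /negbTE ->].
  by rewrite subrr mulr0 mul0r mulr0.
have mq k : measurable_fun setT (q k) by exact: depends_on_measurable (dq k).
pose S w := \sum_k `|q k w|.
have mS : measurable_fun setT S.
  by apply: measurable_sum => k; exact: measurableT_comp.
pose gu w := t * S w - t * C0 * p%:R.
pose gl w := s * c0 * p%:R - s * S w.
have mgu : measurable_fun setT gu.
  by apply: measurable_funB => //; exact: measurable_funM.
have mgl : measurable_fun setT gl.
  by apply: measurable_funB => //; exact: measurable_funM.
have mge0 (g : T -> R) : measurable_fun setT g -> measurable [set w | 0 <= g w].
  by move=> mg; have := measurable_fun_le measurableT (measurable_cst (0 : R)) mg; rewrite setTI.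
have Pu : (P [set w | 0 <= gu w]%R <= (expR (- p%:R))%:E)%E.
  apply: le_trans (prob_le_expect_expR P mgu) _.
  have -> : (\int[P]_w (expR (gu w))%:E =
      \int[P]_w (expR (- (t * C0 * p%:R)) * \prod_(k <- index_enum 'I_p) expR (t * `|q k w|))%:E)%E.
    by apply: eq_integral => w _; rewrite /gu /S addrC expRD mulr_sumr expR_sum.
  rewrite expectZ ?expR_ge0//; last 2 first.
  - apply: measurable_prod => k _; apply: measurableT_comp => //.
    by apply: measurable_funM => //; exact: measurableT_comp.
  - by move=> w; rewrite prodr_ge0// => k _; exact: expR_ge0.
  apply: le_trans (lee_wpmul2l _ (expect_prod_blocks indX (c := B) dA _ _ _ _ (index_enum_uniq _))) _.
  - by rewrite lee_fin expR_ge0.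
  - move=> k; apply: measurableT_comp => //; apply: measurable_funM => //.
    by apply: measurableT_comp => //; exact: dq.
  - by move=> k w; exact: expR_ge0.
  - by move=> k; case: (qc k).
  - exact: ltW.
  rewrite -EFinM lee_fin -[B]lnK ?posrE// -expRM_natr.
  have -> : size (index_enum 'I_p) = p by rewrite -[RHS]card_ord cardT enumT.
  rewrite -expRD ler_expR /C0.
  rewrite (_ : t * ((1 + ln B) / t) = 1 + ln B); last by field; rewrite gt_eqF.
  by rewrite mulrDl mul1r opprD addrNK.
have Pl : (P [set w | 0 <= gl w]%R <= (expR (- (delta / 2 * p%:R)))%:E)%E.
  apply: le_trans (prob_le_expect_expR P mgl) _.
  have -> : (\int[P]_w (expR (gl w))%:E =
      \int[P]_w (expR (s * c0 * p%:R) * \prod_(k <- index_enum 'I_p) expR (- (s * `|q k w|)))%:E)%E.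
    by apply: eq_integral => w _; rewrite /gl /S expRD mulr_sumr -sumrN expR_sum.
  have mE k : measurable_fun setT (fun w => expR (- (s * `|q k w|))).
    apply: measurableT_comp => //; apply: measurable_funN.
    by apply: measurable_funM => //; exact: measurableT_comp.
  rewrite expectZ ?expR_ge0//; last 2 first.
  - by apply: measurable_prod.
  - by move=> w; rewrite prodr_ge0// => k _; exact: expR_ge0.
  apply: le_trans (lee_wpmul2l _ (expect_prod_blocks indX (c := expR (- delta)) dA _ _ _ _ (index_enum_uniq _))) _.
  - by rewrite lee_fin expR_ge0.
  - move=> k; apply: measurableT_comp => //; apply: measurable_funN.
    by apply: measurable_funM => //; apply: measurableT_comp => //; exact: dq.
  - by move=> k w; exact: expR_ge0.
  - by move=> k; case: (qc k).
  - exact: expR_ge0.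
  rewrite -EFinM lee_fin -expRM_natr.
  have -> : size (index_enum 'I_p) = p by rewrite -[RHS]card_ord cardT enumT.
  rewrite -expRD ler_expR /c0 le_eqVlt; apply/orP; left; apply/eqP.
  by field; rewrite gt_eqF.
exists (~` ([set w | 0 <= gu w] `|` [set w | 0 <= gl w])); split.
- by apply: measurableC; apply: measurableU; exact: mge0.
- rewrite setCK; apply: le_trans (measureU2 _ _ _) _; [exact: mge0|exact: mge0|].
  rewrite mulrDl mul1r EFinD leeD//.
    apply: le_trans Pu _; rewrite lee_fin ler_expR lerN2 ler_piMl//.
    by rewrite ge_min lexx.
  apply: le_trans Pl _; rewrite lee_fin ler_expR lerN2 ler_wpM2r//.
  by rewrite ge_min lexx orbT.
move=> w; rewrite setCU => -[/negP hu /negP hl] a.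
have SE : \sum_k `|meas a M (i1 k) - meas a M (i2 k)| = N * S w.
  rewrite /S mulr_sumr; apply: eq_bigr => k _; rewrite -[_ - _]/(mdiff w k) qE.
  by rewrite normrM gtr0_norm.
move: hu hl; rewrite -!ltNge /gu /gl !subr_lt0 -mulrA ltr_pM2l// -mulrA ltr_pM2l// => hu hl.
rewrite SE /N; split.
  have -> : c0 * Num.sqrt 2 * p%:R * frob M = Num.sqrt 2 * frob M * (c0 * p%:R) by ring.
  by rewrite ler_pM2l ?ltW.
have -> : C0 * Num.sqrt 2 * p%:R * frob M = Num.sqrt 2 * frob M * (C0 * p%:R) by ring.
by rewrite ler_pM2l ?ltW.
Qed.

(** * Lattice points whose convex hull contains the unit ball *)

Lemma geometric_half_le (R : realType) (N : nat) : \sum_(i < N) (2^-1 : R) ^+ i <= 2.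
Proof.
suff : \sum_(i < N) (2^-1 : R) ^+ i = 2 - 2 * 2^-1 ^+ N.
  by move=> ->; rewrite gerBl mulr_ge0// exprn_ge0// invr_ge0.
elim: N => [|N IH]; first by rewrite big_ord0 expr0; lra.
by rewrite big_ord_recr /= IH exprS; lra.
Qed.

Section lattice.
Context (R : realType) (n : nat).
Local Notation coord := 'I_(n.+1 + n.+2).

(** The index [k] stands for the integer k - (n + 1), between -(n + 1) and n + 1. A coordinate of
    sqrt n times a unit vector has absolute value at most n, so both of its neighbouring integers
    are in range. *)
Definition lat_coord (k : coord) : R := k%:R - n.+1%:R.
Definition lat_dist (k : coord) : nat := (n.+1 - k) + (k - n.+1).

Lemma lat_coord_sqr k : lat_coord k ^+ 2 = (lat_dist k ^ 2)%:R.
Proof.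
rewrite /lat_coord /lat_dist natrX.
case: (leqP k n.+1) => [kn|/ltnW kn].
  by rewrite (eqP (kn : (k - n.+1 == 0)%N)) addn0 natrB// -sqrrN opprB.
by rewrite (eqP (kn : (n.+1 - k == 0)%N)) add0n natrB.
Qed.

(** Integer vectors of Euclidean norm at most 2 sqrt n; divided by sqrt n they lie in the ball of
    radius 2. *)
Definition lat_points : {set {ffun 'I_n -> coord}} :=
  [set f : {ffun 'I_n -> coord} | (\sum_j lat_dist (f j) ^ 2 <= 4 * n)%N]%SET.

(** The weight 16^n 2^(-|z|^2) is at least 1 on the points counted, because |z|^2 <= 4 n there.
    Summed over all vectors it factorizes over coordinates, each factor being at most 16 * 3:
    nonnegative integers contribute at most 2 and negative ones at most 1. *)
Lemma card_lat_points : (#|lat_points|%:R : R) <= 48 ^+ n.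
Proof.
apply: (@le_trans _ _ (\sum_(f : {ffun 'I_n -> coord}) 16 ^+ n *
    \prod_j (2^-1 : R) ^+ (lat_dist (f j) ^ 2))).
  rewrite -sum1_card natr_sum big_mkcond; apply: ler_sum => f _.
  have p0 : 0 <= 16 ^+ n * \prod_j (2^-1 : R) ^+ (lat_dist (f j) ^ 2).
    by rewrite mulr_ge0 ?exprn_ge0// prodr_ge0// => j _; rewrite exprn_ge0// invr_ge0.
  case: ifP => //; rewrite inE => hf; rewrite prodrXr exprVn ler_pdivlMr ?exprn_gt0//.
  have -> : 16 = 2 ^+ 4 :> R by ring.
  rewrite mul1r -exprM.
  by rewrite ler_weXn2l// ler1n.
rewrite -mulr_sumr -(bigA_distr_bigA (fun _ k => (2^-1 : R) ^+ (lat_dist k ^ 2))) /=.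
rewrite prodr_const card_ord -exprMn lerXn2r ?nnegrE//.
  by rewrite mulr_ge0// sumr_ge0// => k _; rewrite exprn_ge0// invr_ge0.
have -> : 48 = 16 * (1 + 2) :> R by lra.
rewrite ler_pM2l// big_split_ord /= lerD//.
  rewrite (reindex_inj rev_ord_inj) /=.
  have : \sum_(i < n.+1) (2^-1 : R) * 2^-1 ^+ i <= 1.
    by rewrite -mulr_sumr mulrC ler_pdivrMr// mul1r geometric_half_le.
  apply: le_trans; apply: ler_sum => i _; rewrite -exprS /lat_dist /=.
  have -> : (n.+1 - (n.+1 - i.+1) + (n.+1 - i.+1 - n.+1) = i.+1)%N.
    rewrite subKn ?ltn_ord// (_ : (_ - _ - _ = 0)%N) ?addn0//.
    by apply/eqP; rewrite subn_eq0 leq_subr.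
  by rewrite ler_wiXn2l ?invr_ge0 ?invf_le1 ?ler1n// expnS expn1 leq_pmulr.
apply: le_trans (geometric_half_le R n.+2); apply: ler_sum => i _.
rewrite /lat_dist /= addKn (_ : (_ - _ = 0)%N) ?add0n; last first.
  by apply/eqP; rewrite subn_eq0 leq_addr.
rewrite ler_wiXn2l ?invr_ge0 ?invf_le1 ?ler1n//.
by case: (nat_of_ord i) => // k; rewrite expnS expn1 leq_pmulr.
Qed.

Definition lat_vec (f : {ffun 'I_n -> coord}) : 'cV[R]_n :=
  \col_j (lat_coord (f j) / Num.sqrt n%:R).

Lemma lat_vec_norm f : f \in lat_points -> \sum_j lat_vec f j 0 ^+ 2 <= 4.
Proof.
rewrite inE => hf; case: (posnP n) => [n0|n0].
  by rewrite big1 ?ler0n// => j _; have := leq_ltn_trans (leq0n _) (ltn_ord j); rewrite {1}n0.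
under eq_bigr do rewrite mxE exprMn exprVn sqr_sqrtr// lat_coord_sqr.
rewrite -mulr_suml ler_pdivrMr ?ltr0n// -natr_sum -natrM ler_nat.
exact: hf.
Qed.

(* Round each coordinate of sqrt(n) v to one of the two neighbouring integers,
   independently and without bias. *)
Lemma unit_ball_hull (v : 'cV[R]_n) : (0 < n)%N -> \sum_j v j 0 ^+ 2 <= 1 ->
  exists p : {ffun 'I_n -> coord} -> R,
    [/\ forall f, 0 <= p f, forall f, f \notin lat_points -> p f = 0,
      \sum_f p f = 1 & \sum_f p f *: lat_vec f = v].
Proof.
move=> n0 v1; pose sn : R := Num.sqrt n%:R.
have sn0 : 0 < sn by rewrite sqrtr_gt0 ltr0n.
have sn2 : sn ^+ 2 = n%:R by rewrite sqr_sqrtr.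
have snn : sn <= n%:R.
  have sn1 : 1 <= sn by rewrite /sn -[leLHS]sqrtr1 ler_sqrt// ler1n.
  by rewrite -sn2 expr2 ler_peMl ?(ltW sn0).
pose x j := sn * v j 0.
have xsum : \sum_j x j ^+ 2 <= n%:R.
  under eq_bigr do rewrite exprMn sn2.
  by rewrite -mulr_sumr ler_piMr.
have xn j : `|x j| <= n%:R.
  apply: le_trans snn; rewrite -(@ler_pXn2r _ 2)// ?nnegrE ?(ltW sn0)// real_normK ?num_real// sn2.
  apply: le_trans xsum; rewrite (bigD1 j)//= lerDl sumr_ge0// => i _.
  exact: sqr_ge0.
pose y j := x j + n.+1%:R.
have y0 j : 0 <= y j.
  by have := xn j; rewrite ler_norml => /andP[h _]; rewrite /y -natr1; lra.
pose K j := Num.truncn (y j).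
have Ky j : (K j)%:R <= y j < (K j).+1%:R by exact: truncn_itv.
have Kn j : ((K j).+1 < n.+1 + n.+2)%N.
  have : (K j)%:R < (n + n.+1).+1%:R :> R.
    have /andP[h _] := Ky j; apply: le_lt_trans h _.
    have := xn j; rewrite ler_norml => /andP[_ h]; rewrite /y -!natr1 natrD -natr1; lra.
  by rewrite ltr_nat addSn !addnS !ltnS.
(* The fractional part is the probability of rounding up. *)
pose phi j := y j - (K j)%:R.
have phi01 j : 0 <= phi j <= 1.
  have /andP[h1 h2] := Ky j; rewrite /phi subr_ge0 h1 /=.
  by move: h2; rewrite -natr1; lra.
pose k0 j : coord := Ordinal (ltnW (Kn j)).
pose k1 j : coord := Ordinal (Kn j).
pose w j (k : coord) : R := (1 - phi j) * (k == k0 j)%:R + phi j * (k == k1 j)%:R.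
have w0 j k : 0 <= w j k.
  by have /andP[h1 h2] := phi01 j; rewrite addr_ge0// mulr_ge0// subr_ge0.
have sw j (g : coord -> R) : \sum_k w j k * g k = (1 - phi j) * g (k0 j) + phi j * g (k1 j).
  have d (l : coord) (c : R) : \sum_k c * (k == l)%:R * g k = c * g l.
    rewrite (bigD1 l)//= eqxx mulr1 big1 ?addr0// => k /negbTE ->.
    by rewrite mulr0 mul0r.
  by under eq_bigr do rewrite mulrDl; rewrite big_split /= !d.
have w1 j : \sum_k w j k = 1.
  have := sw j (fun=> 1); rewrite !mulr1 subrK => <-.
  by apply: eq_bigr => k _; rewrite mulr1.
have wx j : \sum_k w j k * lat_coord k = x j.
  rewrite sw /lat_coord /= /phi /y -natr1; ring.
pose p (f : {ffun 'I_n -> coord}) := \prod_j w j (f j).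
exists p; split.
- by move=> f; apply: prodr_ge0.
- move=> f; apply: contraNeq; rewrite /p => pf; rewrite inE.
  (* Rounding moves a coordinate by at most 1, so its square is at most 2 x^2 + 2; summed, this
     gives 2 n + 2 n, the radius in [lat_points]. *)
  have h j : lat_coord (f j) ^+ 2 <= 2 * x j ^+ 2 + 2.
    have /andP[p1 p2] := phi01 j.
    have : w j (f j) != 0 by move: pf; rewrite prodf_seq_neq0 => /allP/(_ j (mem_index_enum _)).
    rewrite /w; have [->|_] := eqVneq (f j) (k0 j).
      move=> _; rewrite /lat_coord /=.
      have -> : (K j)%:R - n.+1%:R = x j - phi j by rewrite /phi /y; ring.
      have := sqr_ge0 (x j + phi j); have : phi j ^+ 2 <= 1 by rewrite exprn_ile1.
      by lra.
    have [->|_] := eqVneq (f j) (k1 j); last by rewrite !mulr0 addr0 eqxx.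
    move=> _; rewrite /lat_coord /= -natr1.
    have -> : (K j)%:R + 1 - n.+1%:R = x j + (1 - phi j) by rewrite /phi /y; ring.
    have := sqr_ge0 (x j - (1 - phi j)).
    have : (1 - phi j) ^+ 2 <= 1 by rewrite exprn_ile1//; lra.
    by lra.
  rewrite -(ler_nat R) natr_sum natrM.
  under eq_bigr do rewrite -lat_coord_sqr.
  apply: (@le_trans _ _ (\sum_j (2 * x j ^+ 2 + 2))); first by apply: ler_sum => j _.
  rewrite big_split /= -mulr_sumr sumr_const card_ord -[2 *+ n]mulr_natr; lra.
- rewrite -(bigA_distr_bigA w) /=.
  by rewrite big1// => j _.
- apply/matrixP => j0 j1; rewrite ord1 summxE.
  under eq_bigr do rewrite !mxE mulrA.
  rewrite -mulr_suml.
  have -> : \sum_f p f * lat_coord (f j0) = x j0.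
    (* Inserting the coordinate into the factor [j0] keeps the product form, so the mean of one
       coordinate factorizes and all other factors sum to 1. *)
    pose w' j k := w j k * (if j == j0 then lat_coord k else 1).
    transitivity (\sum_(f : {ffun 'I_n -> coord}) \prod_j w' j (f j)).
      apply: eq_bigr => f _; rewrite /p /w' big_split /=; congr (_ * _).
      by rewrite -big_mkcond /= big_pred1_eq.
    have E1 j : j != j0 -> \sum_k w' j k = 1.
      move=> /negbTE jj; rewrite -[RHS](w1 j); apply: eq_bigr => k _.
      by rewrite /w' jj mulr1.
    rewrite -(bigA_distr_bigA w') /= (bigD1 j0)//= (eq_bigr (fun=> 1) E1) big1_eq mulr1.
    by rewrite -(wx j0); apply: eq_bigr => k _; rewrite /w' eqxx.
  by rewrite /x mulrC mulKf// gt_eqF.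
Qed.

End lattice.

(** * The Frobenius inner product and rank-one peeling of positive semidefinite matrices *)

Section frobenius.
Context (R : realType) (p q : nat).
Implicit Types A B : 'M[R]_(p, q).

Definition ip A B : R := \sum_i \sum_j A i j * B i j.

Lemma frob_ip A : frob A ^+ 2 = ip A A.
Proof. by rewrite frob_sqr; under eq_bigr do under eq_bigr do rewrite expr2. Qed.

Lemma ipC A B : ip A B = ip B A.
Proof. by apply: eq_bigr => i _; apply: eq_bigr => j _; rewrite mulrC. Qed.

Lemma ipDr A B C : ip A (B + C) = ip A B + ip A C.
Proof.
rewrite -big_split; apply: eq_bigr => i _; rewrite -big_split.
by apply: eq_bigr => j _; rewrite mxE mulrDr.
Qed.

Lemma ipZr c A B : ip A (c *: B) = c * ip A B.
Proof.
rewrite mulr_sumr; apply: eq_bigr => i _; rewrite mulr_sumr.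
by apply: eq_bigr => j _; rewrite mxE mulrCA.
Qed.

Lemma ipDl A B C : ip (A + B) C = ip A C + ip B C.
Proof. by rewrite ipC ipDr !(ipC C). Qed.

Lemma ipZl c A B : ip (c *: A) B = c * ip A B.
Proof. by rewrite ipC ipZr ipC. Qed.

Lemma ip0r A : ip A 0 = 0.
Proof. by rewrite -(scale0r 0) ipZr mul0r. Qed.

Lemma frob_ge0 A : 0 <= frob A. Proof. exact: sqrtr_ge0. Qed.

Lemma ip_ge0 A : 0 <= ip A A. Proof. by rewrite -frob_ip sqr_ge0. Qed.

Lemma frobZ c A : frob (c *: A) = `|c| * frob A.
Proof.
apply/eqP; rewrite -(@eqrXn2 _ 2)// ?mulr_ge0 ?frob_ge0//.
by rewrite exprMn !frob_ip ipZr ipZl mulrA real_normK ?num_real.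
Qed.

Lemma frob_eq0 A : frob A = 0 -> A = 0.
Proof.
move=> A0; apply/matrixP => i j; rewrite mxE; apply/eqP; rewrite -sqrf_eq0.
have := frob_sqr A; rewrite A0 expr0n /= => /esym/eqP.
rewrite psumr_eq0 => [|i' _]; last by apply: sumr_ge0 => j' _; exact: sqr_ge0.
move=> /allP/(_ i (mem_index_enum _)) /=.
rewrite psumr_eq0 => [|j' _]; last exact: sqr_ge0.
by move=> /allP/(_ j (mem_index_enum _)).
Qed.

Lemma ip_le A B : ip A B <= frob A * frob B.
Proof.
have [A0|A0] := eqVneq (frob A) 0.
  by rewrite (frob_eq0 A0) ipC ip0r mulr_ge0 ?frob_ge0.
have Ap : 0 < frob A by rewrite lt_def A0 frob_ge0.
have [B0|B0] := eqVneq (frob B) 0.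
  by rewrite (frob_eq0 B0) ip0r mulr_ge0 ?frob_ge0.
have Bp : 0 < frob B by rewrite lt_def B0 frob_ge0.
have := ip_ge0 ((frob B) *: A + (- frob A) *: B).
rewrite !ipDr !ipDl !ipZr !ipZl -!frob_ip (ipC B A) => h.
have : 0 <= 2 * (frob A * frob B) * (frob A * frob B - ip A B) by lra.
by rewrite pmulr_rge0 ?subr_ge0// !mulr_gt0.
Qed.

Lemma frobD A B : frob (A + B) <= frob A + frob B.
Proof.
rewrite -(@ler_pXn2r _ 2)// ?nnegrE ?addr_ge0 ?frob_ge0//.
rewrite sqrrD !frob_ip ipDr !ipDl (ipC B A).
by have := ip_le A B; lra.
Qed.

End frobenius.

Section psd_induction.
Context (R : realType) (n : nat).
Implicit Types (A : 'M[R]_n) (x y v : 'cV[R]_n).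

Definition bf A x y : R := (x^T *m A *m y) 0 0.

Lemma bfDl A x y z : bf A (x + y) z = bf A x z + bf A y z.
Proof. by rewrite /bf linearD !mulmxDl mxE. Qed.

Lemma bfDr A x y z : bf A z (x + y) = bf A z x + bf A z y.
Proof. by rewrite /bf mulmxDr mxE. Qed.

Lemma bfZl A c x y : bf A (c *: x) y = c * bf A x y.
Proof. by rewrite /bf linearZ -!scalemxAl mxE. Qed.

Lemma bfZr A c x y : bf A x (c *: y) = c * bf A x y.
Proof. by rewrite /bf -scalemxAr mxE. Qed.

Lemma bf_sym A x y : A^T = A -> bf A x y = bf A y x.
Proof.
move=> As; rewrite /bf -[in LHS](trmxK (x^T *m A *m y)) mxE.
by rewrite !trmx_mul trmxK As mulmxA.
Qed.

Lemma bf_delta A i j : bf A (delta_mx i 0) (delta_mx j 0) = A i j.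
Proof. by rewrite /bf trmx_delta -rowE -colE !mxE. Qed.

Lemma bfB A B x y : bf (A - B) x y = bf A x y - bf B x y.
Proof. by rewrite /bf mulmxBr mulmxBl !mxE. Qed.

Lemma bf_rank1 v x y : bf (v *m v^T) x y = (x^T *m v) 0 0 * (v^T *m y) 0 0.
Proof. by rewrite /bf mulmxA -mulmxA [in LHS]mxE big_ord1. Qed.

Lemma psd_diag_ge0 A i : psd A -> 0 <= A i i.
Proof. by move=> [_ /(_ (delta_mx i 0))]; rewrite -/(bf _ _ _) bf_delta. Qed.

Lemma psd_diag0 A : psd A -> (forall i, A i i = 0) -> A = 0.
Proof.
move=> [As A0] d0; apply/matrixP => i j; rewrite mxE.
have h (c : R) : 0 <= 2 * c * A i j.
  have := A0 (delta_mx i 0 + c *: delta_mx j 0); rewrite -/(bf _ _ _).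
  rewrite !bfDl !bfDr !bfZl !bfZr !bf_delta !d0.
  have -> : A j i = A i j by rewrite -[in LHS]As mxE.
  by lra.
by apply/eqP; rewrite eq_le; have := h 1; have := h (-1); lra.
Qed.

(** One Cholesky step: [v *m v^T] agrees with [A] on row and column [j], and the difference is a
    Schur complement, whose form at [x] is the minimum over c of the form of [A] at x - c e_j.
    Diagonal entries can only decrease and stay nonnegative, so zeros persist. *)
Lemma psd_peel A j : psd A -> 0 < A j j ->
  let v := (Num.sqrt (A j j))^-1 *: col j A in
  psd (A - v *m v^T) /\ forall i, (A i i = 0 \/ i = j) -> (A - v *m v^T) i i = 0.
Proof.
move=> [As A0] Aj v.
have s0 : 0 < Num.sqrt (A j j) by rewrite sqrtr_gt0.
have s2 : Num.sqrt (A j j) ^+ 2 = A j j by rewrite sqr_sqrtr// ltW.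
have vx x : (x^T *m v) 0 0 = (Num.sqrt (A j j))^-1 * bf A x (delta_mx j 0).
  by rewrite /v -scalemxAr mxE colE /bf mulmxA.
have p : psd (A - v *m v^T).
  split; first by rewrite linearB /= trmx_mul trmxK As.
  move=> x; rewrite -/(bf _ _ _) bfB bf_rank1.
  have -> : (v^T *m x) 0 0 = (x^T *m v) 0 0.
    by rewrite -[in LHS](trmxK (v^T *m x)) mxE trmx_mul trmxK.
  pose c := bf A x (delta_mx j 0) / A j j.
  have := A0 (x + (- c) *: delta_mx j 0); rewrite -/(bf _ _ _).
  rewrite !bfDl !bfDr !bfZl !bfZr bf_delta (bf_sym (delta_mx j 0) x As) !vx.
  set b := bf A x (delta_mx j 0).
  have -> : bf A x x + - c * b + (- c * b + - c * (- c * A j j)) = bf A x x - b ^+ 2 / A j j.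
    by rewrite /c -/b; field; rewrite gt_eqF.
  suff -> : (Num.sqrt (A j j))^-1 * b * ((Num.sqrt (A j j))^-1 * b) = b ^+ 2 / A j j by [].
  by rewrite -[in RHS]s2; field; rewrite gt_eqF.
have E i k : (A - v *m v^T) i k = A i k - A i j * A k j / A j j.
  rewrite !mxE big_ord1 !mxE -[in RHS]s2; congr (_ - _); field.
  by rewrite gt_eqF.
split=> // i [Ai|->]; last by rewrite E mulfK ?subrr// gt_eqF.
apply/eqP; rewrite eq_le psd_diag_ge0// andbT E Ai sub0r oppr_le0.
by apply: divr_ge0; [rewrite -expr2 sqr_ge0|exact: ltW].
Qed.

(** Induction on the number of nonzero diagonal entries: each peeling clears one and creates none,
    and a positive semidefinite matrix with zero diagonal is 0. *)
Lemma psd_ind (Q : 'M[R]_n -> Prop) : Q 0 ->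
  (forall v A, Q A -> Q (v *m v^T + A)) -> forall A, psd A -> Q A.
Proof.
move=> Q0 QS A; have [k] := ubnP #|[set i | A i i != 0]%SET|.
elim: k A => // k IH A; rewrite ltnS => Ak pA.
case: (pickP [pred i | A i i != 0]) => [j /= Aj|d0]; last first.
  by rewrite (psd_diag0 pA)// => i; apply/eqP; have := d0 i; rewrite /= => /negbFE.
have Aj0 : 0 < A j j by rewrite lt_def Aj psd_diag_ge0.
have := psd_peel pA Aj0; set v := _ *: _ => /= -[pB dB].
have -> : A = v *m v^T + (A - v *m v^T) by rewrite addrC subrK.
apply: QS; apply: IH => //; apply: leq_trans Ak; apply: proper_card.
apply/properP; split; last by exists j; rewrite !inE ?Aj// dB ?eqxx//; right.
apply/fintype.subsetP => i; rewrite !inE; apply: contraNneq => Ai.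
by rewrite dB//; left.
Qed.

End psd_induction.

(** * Atoms and atomic decompositions *)

Section atoms.
Context (R : realType) (n : nat).

Definition lat_pt := {f | f \in lat_points n}.
(** The boolean carries a sign, so the atoms are closed under negation and a difference of two
    decompositions has nonnegative weights again. *)
Definition atom_idx : finType := (bool * (lat_pt * lat_pt))%type.

Definition sym_prod (u v : 'cV[R]_n) : 'M[R]_n := 2^-1 *: (u *m v^T + v *m u^T).

Lemma sym_prodC u v : sym_prod u v = sym_prod v u.
Proof. by rewrite /sym_prod addrC. Qed.

Lemma sym_prod_suml (J : finType) (c : J -> R) (x : J -> 'cV[R]_n) y :
  sym_prod (\sum_k c k *: x k) y = \sum_k c k *: sym_prod (x k) y.
Proof.
rewrite /sym_prod mulmx_suml linear_sum mulmx_sumr -big_split scaler_sumr.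
apply: eq_bigr => k _ /=; rewrite linearZ /= -scalemxAl -scalemxAr -scalerDr.
by rewrite !scalerA mulrC.
Qed.

Definition atom (th : atom_idx) : 'M[R]_n :=
  (-1) ^+ th.1 *: sym_prod (lat_vec R (val th.2.1)) (lat_vec R (val th.2.2)).

Lemma card_atom_idx : (#|{: atom_idx}|%:R : R) <= 2 * (48 ^+ n) ^+ 2.
Proof.
rewrite !card_prod card_bool natrM ler_pM2l// natrM expr2.
have h : (#|{: lat_pt}|%:R : R) <= 48 ^+ n.
  by rewrite card_sig; apply: le_trans (card_lat_points R n).
by rewrite ler_pM.
Qed.

Lemma atom_sym th : (atom th)^T = atom th.
Proof.
rewrite /atom linearZ /=; congr (_ *: _).
by rewrite /sym_prod linearZ /= linearD /= !trmx_mul !trmxK addrC.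
Qed.

Lemma frob_sym_prod (u v : 'cV[R]_n) :
  ip (sym_prod u v) (sym_prod u v) <= (\sum_i u i 0 ^+ 2) * (\sum_j v j 0 ^+ 2).
Proof.
have -> : (\sum_i u i 0 ^+ 2) * (\sum_j v j 0 ^+ 2) =
    \sum_i \sum_j 2^-1 * (u i 0 ^+ 2 * v j 0 ^+ 2 + v i 0 ^+ 2 * u j 0 ^+ 2).
  have h (f g : 'I_n -> R) : (\sum_i f i) * (\sum_j g j) = \sum_i \sum_j f i * g j.
    by rewrite mulr_suml; apply: eq_bigr => i _; rewrite mulr_sumr.
  transitivity (2^-1 * ((\sum_i u i 0 ^+ 2) * (\sum_j v j 0 ^+ 2) + (\sum_i v i 0 ^+ 2) * (\sum_j u j 0 ^+ 2))).
    by rewrite [(\sum_i v i 0 ^+ 2) * _]mulrC; lra.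
  rewrite !h -big_split mulr_sumr; apply: eq_bigr => i _ /=.
  by rewrite -big_split mulr_sumr.
apply: ler_sum => i _; apply: ler_sum => j _; rewrite !mxE !big_ord1 !mxE.
by have := sqr_ge0 (u i 0 * v j 0 - v i 0 * u j 0); lra.
Qed.

Lemma frob_atom th : ip (atom th) (atom th) <= 16.
Proof.
rewrite /atom ipZl ipZr mulrA -expr2 sqrr_sign mul1r.
apply: le_trans (frob_sym_prod _ _) _.
have h (a : lat_pt) := lat_vec_norm R (valP a).
have -> : 16 = 4 * 4 :> R by lra.
by rewrite ler_pM ?h//; apply: sumr_ge0 => i _; exact: sqr_ge0.
Qed.

(** A decomposition of total weight [W]; the infimum of such [W] is the atomic norm of [H], the
    gauge of the convex hull of the atoms. *)
Definition rep (H : 'M[R]_n) (W : R) := exists q : atom_idx -> R,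
  [/\ forall th, 0 <= q th, \sum_th q th = W & H = \sum_th q th *: atom th].

Lemma rep0 : rep 0 0.
Proof.
by exists (fun=> 0); split => //; rewrite big1// => th _; rewrite scale0r.
Qed.

Lemma repD H1 W1 H2 W2 : rep H1 W1 -> rep H2 W2 -> rep (H1 + H2) (W1 + W2).
Proof.
move=> [q1 [p1 <- ->]] [q2 [p2 <- ->]]; exists (fun th => q1 th + q2 th); split.
- by move=> th; rewrite addr_ge0.
- by rewrite big_split.
- by rewrite -big_split; apply: eq_bigr => th _; rewrite scalerDl.
Qed.

Lemma repZ (c : R) H W : 0 <= c -> rep H W -> rep (c *: H) (c * W).
Proof.
move=> c0 [q [p1 <- ->]]; exists (fun th => c * q th); split.
- by move=> th; rewrite mulr_ge0.
- by rewrite mulr_sumr.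
- by rewrite scaler_sumr; apply: eq_bigr => th _; rewrite scalerA.
Qed.

Lemma repN H W : rep H W -> rep (- H) W.
Proof.
pose fl (th : atom_idx) : atom_idx := (~~ th.1, th.2).
have flK : involutive fl by move=> [b t]; rewrite /fl /= negbK.
move=> [q [p1 <- ->]]; exists (q \o fl); split.
- by move=> th /=.
- by rewrite [RHS](reindex_inj (inv_inj flK)).
- rewrite -sumrN [RHS](reindex_inj (inv_inj flK)); apply: eq_bigr => th _ /=.
  rewrite flK /atom /fl /= -scalerN; congr (_ *: _); rewrite -scaleNr; congr (_ *: _).
  by case: (th.1); rewrite /= ?expr0 ?expr1 ?opprK.
Qed.

(** The unit vector v / |v| is a convex combination of lattice vectors; expanding its symmetrized
    square bilinearly gives a convex combination of atoms, with product weights. *)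
Lemma rep_rank1 (v : 'cV[R]_n) : rep (v *m v^T) (\sum_i v i 0 ^+ 2).
Proof.
set s := \sum_i _.
have s0 : 0 <= s by apply: sumr_ge0 => i _; exact: sqr_ge0.
have [sz|sz] := eqVneq s 0.
  have v0 : v = 0.
    apply/matrixP => i j; rewrite ord1 mxE; apply/eqP; rewrite -sqrf_eq0.
    by move/eqP: sz; rewrite /s psumr_eq0 => [/allP/(_ i (mem_index_enum _))|k _]; rewrite ?sqr_ge0.
  by rewrite sz v0 mul0mx; exact: rep0.
have sp : 0 < s by rewrite lt_def sz.
have n0 : (0 < n)%N.
  case: (posnP n) => // n0; exfalso; move/eqP: sz; apply.
  by rewrite /s big1// => j _; have := leq_ltn_trans (leq0n _) (ltn_ord j); rewrite {1}n0.
pose v' := (Num.sqrt s)^-1 *: v.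
have s2 : Num.sqrt s ^+ 2 = s by rewrite sqr_sqrtr.
have v'1 : \sum_i v' i 0 ^+ 2 <= 1.
  under eq_bigr do rewrite mxE exprMn exprVn s2.
  by rewrite -mulr_sumr mulVf ?gt_eqF.
have -> : v *m v^T = s *: (v' *m v'^T).
  rewrite /v' linearZ -scalemxAl -scalemxAr !scalerA.
  have -> : s / Num.sqrt s / Num.sqrt s = 1.
    by rewrite -mulrA -invfM -expr2 s2 mulfV ?gt_eqF.
  by rewrite scale1r.
rewrite -[X in rep _ X]mulr1; apply: repZ => //.
have [p [p0 pU p1 pv]] := unit_ball_hull n0 v'1.
have pe (V : lmodType R) (F : {ffun 'I_n -> 'I_(n.+1 + n.+2)} -> V) :
    \sum_f p f *: F f = \sum_(a : lat_pt) p (val a) *: F (val a).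
  rewrite (bigID (mem (lat_points n))) /= [X in _ + X]big1 ?addr0; last first.
    by move=> f fU; rewrite pU// scale0r.
  exact: (big_sub (mem (lat_points n)) (fun f => p f *: F f)).
have pv' : \sum_(a : lat_pt) p (val a) *: lat_vec R (val a) = v' by rewrite -pe.
have p1' : \sum_(a : lat_pt) p (val a) = 1.
  have := pe R^o (fun=> 1); rewrite /GRing.scale /=.
  under eq_bigr do rewrite mulr1.
  by under [in RHS]eq_bigr do rewrite mulr1; rewrite p1 => <-.
(* The sign is (-1) to the power [th.1], so [false] marks the positive atoms, the only ones given
   weight. *)
pose q (th : atom_idx) := (if th.1 then 0 else 1) * (p (val th.2.1) * p (val th.2.2)).
have sumE (V : zmodType) (F : atom_idx -> V) :
    \sum_th F th = \sum_(a : lat_pt) \sum_(b : lat_pt) F (true, (a, b)) +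
      \sum_(a : lat_pt) \sum_(b : lat_pt) F (false, (a, b)).
  transitivity (\sum_(t : bool * (lat_pt * lat_pt)) F (t.1, t.2)).
    by apply: eq_bigr => -[b t] _.
  rewrite -(pair_bigA _ (fun b t => F (b, t))) /= big_bool.
  have h b : \sum_(t : lat_pt * lat_pt) F (b, t) = \sum_(x : lat_pt) \sum_(y : lat_pt) F (b, (x, y)).
    by rewrite (pair_bigA _ (fun x y => F (b, (x, y)))); apply: eq_bigr => -[x y] _.
  by rewrite !h.
exists q; split.
- by move=> th; rewrite /q !mulr_ge0//; case: ifP.
- rewrite sumE [X in X + _]big1 ?add0r; last first.
    by move=> a _; rewrite big1// => b _; rewrite /q mul0r.
  transitivity (\sum_(a : lat_pt) p (val a) * 1); last by rewrite -mulr_suml p1' mulr1.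
  apply: eq_bigr => a _; rewrite -[in RHS]p1' mulr_sumr; apply: eq_bigr => b _.
  by rewrite /q mul1r.
- rewrite sumE [X in X + _]big1 ?add0r; last first.
    by move=> a _; rewrite big1// => b _; rewrite /q mul0r scale0r.
  have -> : v' *m v'^T = sym_prod v' v'.
    rewrite /sym_prod; have -> : v' *m v'^T + v' *m v'^T = 2 *: (v' *m v'^T).
      by rewrite scalerDl scale1r.
    by rewrite scalerA mulVf ?scale1r.
  rewrite -[in X in sym_prod X _]pv' sym_prod_suml; apply: eq_bigr => a _.
  rewrite sym_prodC -[in X in sym_prod X _]pv' sym_prod_suml scaler_sumr.
  apply: eq_bigr => b _.
  by rewrite /q /atom /= expr0 scale1r mul1r scalerA sym_prodC.
Qed.

Lemma tr_rank1 (v : 'cV[R]_n) : \tr (v *m v^T) = \sum_i v i 0 ^+ 2.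
Proof. by apply: eq_bigr => i _; rewrite mxE big_ord1 mxE expr2. Qed.

Lemma rep_psd A : psd A -> rep A (\tr A).
Proof.
move: A; apply: psd_ind; first by rewrite linear0; exact: rep0.
by move=> v A rA; rewrite linearD /= tr_rank1; apply: repD => //; exact: rep_rank1.
Qed.

End atoms.

(** * Sampling atoms from a decomposition *)

Section sampling.
Context (R : realType) (n : nat) (w : atom_idx n -> R) (N : nat).
Hypotheses (w0 : forall th, 0 <= w th) (w1 : \sum_th w th = 1).
Local Notation sample := {ffun 'I_N -> atom_idx n}.
Implicit Types (t : sample) (y : atom_idx n -> R).

Definition wprod t : R := \prod_k w (t k).
Definition atom_sum t : 'M[R]_n := \sum_k atom R (t k).

Lemma wprod_ge0 t : 0 <= wprod t.
Proof. exact: prodr_ge0. Qed.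

Lemma sum_wprod_prod (g : 'I_N -> atom_idx n -> R) :
  \sum_t wprod t * \prod_k g k (t k) = \prod_k \sum_th w th * g k th.
Proof.
rewrite (bigA_distr_bigA (fun k th => w th * g k th)).
by apply: eq_bigr => t _; rewrite big_split.
Qed.

Lemma sum_wprod : \sum_t wprod t = 1.
Proof.
transitivity (\sum_t wprod t * \prod_k (fun _ _ => 1) k (t k)).
  by apply: eq_bigr => t _; rewrite big1// mulr1.
rewrite (sum_wprod_prod (fun _ _ => 1)) big1// => k _.
by under eq_bigr do rewrite mulr1.
Qed.

Lemma sum_wprod1 y k : \sum_t wprod t * y (t k) = \sum_th w th * y th.
Proof.
pose g k' th := if k' == k then y th else 1.
transitivity (\sum_t wprod t * \prod_k' g k' (t k')).
  by apply: eq_bigr => t _; rewrite /g -big_mkcond big_pred1_eq.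
rewrite sum_wprod_prod (bigD1 k)//= [X in _ * X]big1 ?mulr1; last first.
  by move=> k' /negbTE kk; under eq_bigr do rewrite /g kk mulr1.
by apply: eq_bigr => th _; rewrite /g eqxx.
Qed.

Lemma sum_wprod2 y k l : k != l -> \sum_th w th * y th = 0 ->
  \sum_t wprod t * (y (t k) * y (t l)) = 0.
Proof.
move=> kl y0; pose g k' th := (if k' == k then y th else 1) * (if k' == l then y th else 1).
transitivity (\sum_t wprod t * \prod_k' g k' (t k')).
  apply: eq_bigr => t _; rewrite /g big_split /= -!big_mkcond /=.
  by rewrite !big_pred1_eq.
rewrite sum_wprod_prod (bigD1 k)//=.
have -> : \sum_th w th * g k th = \sum_th w th * y th.
  by apply: eq_bigr => th _; rewrite /g eqxx (negbTE kl) mulr1.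
by rewrite y0 mul0r.
Qed.

(** Under the product weight [wprod] the sampled values are independent with mean zero, so only the
    diagonal of the expanded square survives. *)
Lemma sum_wprod_sqr y : \sum_th w th * y th = 0 ->
  \sum_t wprod t * (\sum_k y (t k)) ^+ 2 = N%:R * \sum_th w th * y th ^+ 2.
Proof.
move=> y0.
transitivity (\sum_t \sum_k \sum_l wprod t * (y (t k) * y (t l))).
  apply: eq_bigr => t _; rewrite expr2 mulr_suml mulr_sumr; apply: eq_bigr => k _.
  by rewrite -!mulr_sumr.
rewrite exchange_big /=.
transitivity (\sum_(k < N) \sum_th w th * y th ^+ 2).
  apply: eq_bigr => k _; rewrite exchange_big /= (bigD1 k)//= [X in _ + X]big1 ?addr0.
    by rewrite -(sum_wprod1 (fun th => y th ^+ 2) k); apply: eq_bigr => t _; rewrite expr2.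
  by move=> l lk; apply: sum_wprod2 => //; rewrite eq_sym.
by rewrite sumr_const card_ord mulr_natl.
Qed.

Let h := \sum_th w th *: atom R th.

Lemma sum_wprod_atom_sum : \sum_t wprod t *: atom_sum t = N%:R *: h.
Proof.
apply/matrixP => i j; rewrite summxE mxE /h summxE.
transitivity (\sum_t \sum_k wprod t * atom R (t k) i j).
  by apply: eq_bigr => t _; rewrite mxE /atom_sum summxE mulr_sumr.
rewrite exchange_big /=.
under eq_bigr do rewrite (sum_wprod1 (fun th => atom R th i j)).
rewrite sumr_const card_ord mulr_natl; congr (_ *+ N).
by apply: eq_bigr => th _; rewrite [in RHS]mxE.
Qed.

(** The variance of a sum of N independent matrices is computed entrywise; each variance is at most
    the second moment, and atoms have squared norm at most 16. *)
Lemma sum_wprod_deviation_sqr :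
  \sum_t wprod t * frob (atom_sum t - N%:R *: h) ^+ 2 <= 16 * N%:R.
Proof.
have y0 i j : \sum_th w th * (atom R th i j - h i j) = 0.
  under eq_bigr do rewrite mulrBr.
  rewrite sumrB -mulr_suml w1 mul1r; apply/eqP; rewrite subr_eq0 /h summxE; apply/eqP.
  by apply: eq_bigr => th _; rewrite [in RHS]mxE.
have -> : \sum_t wprod t * frob (atom_sum t - N%:R *: h) ^+ 2 =
    \sum_i \sum_j N%:R * \sum_th w th * (atom R th i j - h i j) ^+ 2.
  under eq_bigr do rewrite frob_sqr mulr_sumr.
  rewrite exchange_big /=; apply: eq_bigr => i _.
  under eq_bigr do rewrite mulr_sumr.
  rewrite exchange_big /=; apply: eq_bigr => j _.
  rewrite -(sum_wprod_sqr (y0 i j)); apply: eq_bigr => t _; congr (_ * _ ^+ 2).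
  rewrite !mxE /atom_sum summxE sumrB sumr_const card_ord mulr_natl.
  by [].
rewrite mulrC; under eq_bigr do rewrite -mulr_sumr.
rewrite -mulr_sumr ler_wpM2l//.
apply: (@le_trans _ _ (\sum_i \sum_j \sum_th w th * atom R th i j ^+ 2)).
  apply: ler_sum => i _; apply: ler_sum => j _.
  have -> : \sum_th w th * (atom R th i j - h i j) ^+ 2 =
      \sum_th w th * atom R th i j ^+ 2 -
      \sum_th (w th * (atom R th i j - h i j)) * (2 * h i j) - \sum_th w th * h i j ^+ 2.
    by rewrite -!sumrB; apply: eq_bigr => th _; ring.
  by rewrite -mulr_suml y0 mul0r subr0 -mulr_suml w1 mul1r gerBl sqr_ge0.
under eq_bigr do rewrite exchange_big /=.
rewrite exchange_big /=.
apply: (@le_trans _ _ (\sum_th w th * 16)); last by rewrite -mulr_suml w1 mul1r.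
apply: ler_sum => th _.
have -> : \sum_i \sum_j w th * atom R th i j ^+ 2 = w th * ip (atom R th) (atom R th).
  rewrite -frob_ip frob_sqr mulr_sumr; apply: eq_bigr => i _.
  by rewrite mulr_sumr.
by rewrite ler_wpM2l// frob_atom.
Qed.

Lemma sum_wprod_deviation : (0 < N)%N ->
  \sum_t wprod t * frob (atom_sum t - N%:R *: h) <= 4 * Num.sqrt N%:R.
Proof.
move=> N0; set s := 4 * _.
have s0 : 0 < s by rewrite /s mulr_gt0// sqrtr_gt0 ltr0n.
have s2 : s ^+ 2 = 16 * N%:R by rewrite /s exprMn sqr_sqrtr//; congr (_ * _); ring.
have := sum_wprod_deviation_sqr; rewrite -s2 => S2.
have s2p : 0 < 2 * s by lra.
(* From the second moment to the first through |U| <= (|U|^2 + s^2) / (2 s), with s^2 the variance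
   bound. *)
apply: (@le_trans _ _ ((2 * s)^-1 * \sum_t wprod t *
    (frob (atom_sum t - N%:R *: h) ^+ 2 + s ^+ 2))).
  rewrite mulr_sumr; apply: ler_sum => t _; rewrite mulrCA ler_wpM2l ?wprod_ge0//.
  rewrite mulrC ler_pdivlMr//.
  by have := sqr_ge0 (frob (atom_sum t - N%:R *: h) - s); lra.
rewrite mulrC ler_pdivrMr//.
under eq_bigr do rewrite mulrDr.
by rewrite big_split /= -mulr_suml sum_wprod; lra.
Qed.

End sampling.

Section maurey.
Context (R : realType) (n : nat) (f : 'M[R]_n -> R).
Hypothesis fD : forall A B, f (A + B) <= f A + f B.
Hypothesis fZ : forall c A, 0 <= c -> f (c *: A) = c * f A.

Lemma sublinear_sum (J : finType) (c : J -> R) (F : J -> 'M[R]_n) :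
  (forall k, 0 <= c k) -> f (\sum_k c k *: F k) <= \sum_k c k * f (F k).
Proof.
move=> c0; apply: (big_ind2 (fun A x => f A <= x)).
- by rewrite -(scale0r 0) fZ// mul0r.
- by move=> A x B y Ax By; apply: le_trans (fD _ _) _; exact: lerD.
- by move=> k _; rewrite fZ.
Qed.
End maurey.

(* Maurey's empirical method: W^-1 H is the mean of a random atom, so it is
   within O(N^-1/2) of an average of N atoms, both in norm and in f. *)
Lemma empirical_lower_bound (R : realType) (n : nat) (f : 'M[R]_n -> R) (c C : R) (N : nat) :
  (forall A B, f (A + B) <= f A + f B) ->
  (forall a A, 0 <= a -> f (a *: A) = a * f A) -> (0 < N)%N -> 0 <= c -> 0 <= C ->
  (forall t : {ffun 'I_N -> atom_idx n}, c * frob (atom_sum R t) <= f (atom_sum R t)) ->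
  (forall t u : {ffun 'I_N -> atom_idx n}, f (atom_sum R t - atom_sum R u) <=
     C * frob (atom_sum R t - atom_sum R u)) ->
  forall H W, rep H W -> c * frob H <= f H + C * 8 * W / Num.sqrt N%:R.
Proof.
move=> fD fZ N0 c0 C0 lo up H W [q [q0 qW HE]].
have W0 : 0 <= W by rewrite -qW sumr_ge0.
have sN : 0 < Num.sqrt N%:R :> R by rewrite sqrtr_gt0 ltr0n.
have sN2 : Num.sqrt N%:R ^+ 2 = N%:R :> R by rewrite sqr_sqrtr.
have [Wz|Wz] := eqVneq W 0.
  have -> : H = 0.
    rewrite HE big1// => th _; move/eqP: qW; rewrite Wz psumr_eq0//.
    by move=> /allP/(_ th (mem_index_enum _))/eqP ->; rewrite scale0r.
  have f0 : f 0 = 0 by rewrite -(scale0r 0) fZ// mul0r.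
  have F0 : frob (0 : 'M[R]_n) = 0 by rewrite -(scale0r 0) frobZ normr0 mul0r.
  by rewrite f0 F0 Wz !mulr0 mul0r addr0.
have Wp : 0 < W by rewrite lt_def Wz.
pose w th := W^-1 * q th; pose h := \sum_th w th *: atom R th.
have w0 th : 0 <= w th by rewrite mulr_ge0// invr_ge0.
have w1 : \sum_th w th = 1 by rewrite -mulr_sumr qW mulVf.
have Hh : H = W *: h.
  rewrite HE /h scaler_sumr; apply: eq_bigr => th _.
  by rewrite [RHS]scalerA /w mulrA mulfV// mul1r.
pose p (t : {ffun 'I_N -> atom_idx n}) := wprod w t.
have p0 t : 0 <= p t by exact: wprod_ge0.
have p1 : \sum_t p t = 1 by exact: sum_wprod.
have pm : \sum_t p t *: atom_sum R t = N%:R *: h by exact: sum_wprod_atom_sum.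
pose U (t : {ffun 'I_N -> atom_idx n}) := atom_sum R t - N%:R *: h.
have dev : \sum_t p t * frob (U t) <= 4 * Num.sqrt N%:R by exact: sum_wprod_deviation.
have frobN A : frob (- A : 'M[R]_n) = frob A by rewrite -scaleN1r frobZ normrN normr1 mul1r.
(* The mean in [U t] is replaced by the average over an independent sample [u], so that only
   differences of two atom sums, which [up] covers, have to be bounded. *)
have fU t : f (U t) <= C * (frob (U t) + 4 * Num.sqrt N%:R).
  have -> : f (U t) = f (\sum_u p u *: (atom_sum R t - atom_sum R u)).
    under eq_bigr do rewrite scalerBr.
    by rewrite sumrB -scaler_suml p1 scale1r pm.
  apply: le_trans (sublinear_sum fD fZ _ p0) _.
  apply: (@le_trans _ _ (\sum_u p u * (C * (frob (U t) + frob (U u))))).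
    apply: ler_sum => u _; rewrite ler_wpM2l//; apply: le_trans (up _ _) _.
    rewrite ler_wpM2l//.
    have -> : atom_sum R t - atom_sum R u = U t - U u by rewrite /U opprB addrA subrK.
    by apply: le_trans (frobD _ _) _; rewrite frobN.
  under eq_bigr do rewrite mulrCA mulrDr.
  rewrite -mulr_sumr big_split /= -mulr_suml p1 mul1r.
  by rewrite ler_wpM2l// lerD2l.
(* Convexity of the norm bounds N |h| by the average norm of atom sums, to which [lo] applies. Of
   the factor 8, one half is the deviation of the sample and the other that of its independent
   copy. *)
have key : c * (N%:R * frob h) <= N%:R * f h + C * (8 * Num.sqrt N%:R).
  apply: (@le_trans _ _ (\sum_t p t * (c * frob (atom_sum R t)))).
    under eq_bigr do rewrite mulrCA.
    rewrite -mulr_sumr ler_wpM2l//.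
    have := @sublinear_sum R n (@frob R n n) (@frobD R n n) _ _ p (fun t => atom_sum R t) p0.
    rewrite pm frobZ ger0_norm//; apply => a A a0.
    by rewrite frobZ ger0_norm.
  apply: (@le_trans _ _ (\sum_t p t * (N%:R * f h + C * (frob (U t) + 4 * Num.sqrt N%:R)))).
    apply: ler_sum => t _; rewrite ler_wpM2l//; apply: le_trans (lo t) _.
    have -> : atom_sum R t = N%:R *: h + U t by rewrite /U addrC subrK.
    by apply: le_trans (fD _ _) _; rewrite fZ// lerD2l.
  under eq_bigr do rewrite mulrDr.
  rewrite big_split /= -mulr_suml p1 mul1r lerD2l.
  under eq_bigr do rewrite mulrCA mulrDr.
  rewrite -mulr_sumr big_split /= -mulr_suml p1 mul1r ler_wpM2l//; lra.
rewrite Hh frobZ (ger0_norm W0) fZ//.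
have -> : W * f h + C * 8 * W / Num.sqrt N%:R = W * (N%:R * f h + C * (8 * Num.sqrt N%:R)) / N%:R.
  move: sN sN2; set s := Num.sqrt _ => sN sN2.
  by rewrite -sN2; field; rewrite gt_eqF.
rewrite ler_pdivlMr ?ltr0n//.
have -> : c * (W * frob h) * N%:R = W * (c * (N%:R * frob h)) by ring.
by rewrite ler_wpM2l.
Qed.

(** * Orthogonal diagonalization of real symmetric matrices *)

Section spectral.
Context (R : realType).

Lemma orthogonal_first_column (n : nat) (v : 'cV[R]_n.+1) : v^T *m v = 1%:M ->
  exists2 U : 'M[R]_n.+1, U^T *m U = 1%:M & U *m delta_mx 0 0 = v.
Proof.
move=> v1; pose e : 'cV[R]_n.+1 := delta_mx 0 0; rewrite -/e.
have e1 : e^T *m e = 1%:M.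
  by rewrite /e trmx_delta mul_delta_mx; apply/matrixP => i j; rewrite !ord1 !mxE.
have [->|ve] := eqVneq v e; first by exists 1%:M; rewrite ?trmx1 mul1mx.
pose u := v - e.
have uT : u^T = v^T - e^T by rewrite /u linearB.
have uE : u^T *m u = (2 - 2 * (v^T *m e) 0 0)%:M.
  have ev : (e^T *m v) 0 0 = (v^T *m e) 0 0.
    by rewrite -[in LHS](trmxK (e^T *m v)) mxE trmx_mul trmxK.
  apply/matrixP => i j; rewrite !ord1.
  rewrite uT /u mulmxBl !mulmxBr v1 e1 [RHS]mxE eqxx.
  rewrite [LHS]mxE [X in X + _]mxE [X in _ + X]mxE [X in _ - X]mxE [X in _ + X + _]mxE [X in _ - (_ + X)]mxE ev !mxE !eqxx.
  by rewrite /= !mulr1n; ring.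
set b := _ - _ in uE.
have b0 : b != 0.
  apply: contra_neq ve => b0.
  have : frob u ^+ 2 = 0.
    rewrite frob_sqr exchange_big big_ord1.
    transitivity ((u^T *m u) 0 0); last by rewrite uE b0 mxE mul0rn.
    by rewrite [RHS]mxE; apply: eq_bigr => i _; rewrite [in RHS]mxE expr2.
  by move/eqP; rewrite sqrf_eq0 => /eqP/frob_eq0/eqP; rewrite subr_eq0 => /eqP.
(* Householder reflection exchanging v and e *)
exists (1%:M - (2 / b) *: (u *m u^T)).
  have -> : (1%:M - (2 / b) *: (u *m u^T))^T = 1%:M - (2 / b) *: (u *m u^T).
    by rewrite linearB /= trmx1 linearZ /= trmx_mul trmxK.
  rewrite mulmxBl mul1mx mulmxBr mulmx1 -scalemxAl -scalemxAr.
  have -> : u *m u^T *m (u *m u^T) = b *: (u *m u^T).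
    by rewrite -mulmxA (mulmxA u^T) uE mul_scalar_mx scalemxAr.
  rewrite !scalerA; have -> : 2 / b * (2 / b) * b = 2 / b + 2 / b by field.
  rewrite scalerDl; set A := (2 / b) *: _.
  by rewrite opprB addrK subrK.
have ue : u^T *m e = (- (b / 2))%:M.
  rewrite uT mulmxBl e1; apply/matrixP => i j; rewrite !ord1.
  by rewrite [LHS]mxE [X in _ + X]mxE !mxE eqxx /= !mulr1n /b !mxE; field.
rewrite mulmxBl mul1mx -scalemxAl -mulmxA ue mul_mx_scalar scalerA.
have -> : 2 / b * - (b / 2) = -1 by field.
by rewrite scaleN1r opprK /u addrC subrK.
Qed.

Lemma char_poly_conj (n : nat) (A U : 'M[R]_n) : U^T *m U = 1%:M ->
  char_poly (U^T *m A *m U) = char_poly A.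
Proof.
move=> U1; pose U' := map_mx (@polyC R) U; pose Ut' := map_mx (@polyC R) U^T.
have UU : Ut' *m U' = 1%:M by rewrite -map_mxM U1 map_mx1.
have dUU : \det Ut' * \det U' = 1 by rewrite -det_mulmx UU det1.
have E : char_poly_mx (U^T *m A *m U) = Ut' *m char_poly_mx A *m U'.
  rewrite /char_poly_mx mulmxBr mulmxBl !map_mxM; congr (_ - _).
  by rewrite -mulmxA mul_scalar_mx -scalemxAr UU scalemx1.
by rewrite /char_poly E !det_mulmx mulrAC dUU mul1r.
Qed.

Lemma char_poly_lift (n : nat) (a : R) (A : 'M[R]_n) :
  char_poly (block_mx a%:M 0 0 A : 'M[R]_(1 + n)) = ('X - a%:P) * char_poly A.
Proof.
rewrite /char_poly char_block_diag_mx det_ublock; congr (_ * _).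
by rewrite [char_poly_mx _]mx11_scalar det_scalar1 !mxE eqxx.
Qed.

(** As in [singular_values], the characteristic polynomial is given in split form, so a real
    eigenvector is at hand at each stage. An orthogonal [U] sending the first basis vector to it
    puts e 0 in the corner, symmetry clears the first row, and cancelling X - e 0 gives the
    hypothesis for the smaller block. *)
Lemma orthogonal_diagonalization (n : nat) (A : 'M[R]_n) (e : 'I_n -> R) :
  A^T = A -> char_poly A = \prod_(i < n) ('X - (e i)%:P) ->
  exists2 U : 'M[R]_n, U^T *m U = 1%:M & U^T *m A *m U = diag_mx (\row_i e i).
Proof.
elim: n A e => [|n IH] A e As cA.
  by exists 1%:M; [rewrite trmx1 mul1mx|apply/matrixP => -[]].
have : eigenvalue A (e 0).
  by rewrite eigenvalue_root_char cA big_ord_recl rootM root_XsubC eqxx.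
move=> /eigenvalueP[v0 v0A v00].
have nv : 0 < frob v0.
  rewrite lt_def frob_ge0 andbT; apply: contra_neq v00; exact: frob_eq0.
pose v := (frob v0)^-1 *: v0^T.
have v1 : v^T *m v = 1%:M.
  have -> : v^T = (frob v0)^-1 *: v0 by rewrite /v linearZ /= trmxK.
  rewrite /v -scalemxAl -scalemxAr scalerA.
  apply/matrixP => i j; rewrite !ord1 [RHS]mxE eqxx [LHS]mxE.
  have -> : (v0 *m v0^T) 0 0 = frob v0 ^+ 2.
    by rewrite frob_sqr big_ord1 mxE; apply: eq_bigr => k _; rewrite mxE expr2.
  by rewrite /=; field; rewrite gt_eqF.
have Av : A *m v = e 0 *: v.
  rewrite /v -scalemxAr -As -trmx_mul v0A linearZ /= !scalerA mulrC.
  by [].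
have [U U1 Ud] := orthogonal_first_column v1.
pose B := U^T *m A *m U.
have Bs : B^T = B by rewrite /B !trmx_mul trmxK As mulmxA.
have Bc : B *m (delta_mx 0 0 : 'cV_n.+1) = e 0 *: delta_mx 0 0.
  by rewrite /B -mulmxA Ud -mulmxA Av -scalemxAr -[in LHS]Ud mulmxA U1 mul1mx.
have Bi i : B i 0 = e 0 * (i == 0)%:R.
  have := congr1 (fun M : 'cV_n.+1 => M i 0) Bc.
  by rewrite -colE !mxE eqxx andbT.
have Bi' i : B 0 i = e 0 * (i == 0)%:R by rewrite -[in LHS]Bs mxE Bi.
pose A' := drsubmx (B : 'M[R]_(1 + n)).
have BE : B = (block_mx (e 0)%:M 0 0 A' : 'M[R]_(1 + n)).
  have -> : (e 0)%:M = ulsubmx (B : 'M[R]_(1 + n)).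
    apply/matrixP => i j; rewrite [RHS]mxE [RHS]mxE !ord1 mxE.
    by rewrite (_ : lshift n 0 = 0) ?Bi; [rewrite eqxx mulr1|apply/val_inj].
  have -> : 0 = ursubmx (B : 'M[R]_(1 + n)).
    apply/matrixP => i j; rewrite [RHS]mxE [RHS]mxE !ord1 mxE.
    by rewrite (_ : lshift n 0 = 0) ?Bi' ?mulr0//; apply/val_inj.
  have -> : 0 = dlsubmx (B : 'M[R]_(1 + n)).
    apply/matrixP => i j; rewrite [RHS]mxE [RHS]mxE !ord1 mxE.
    by rewrite (_ : lshift n 0 = 0) ?Bi ?mulr0//; apply/val_inj.
  by rewrite /A' submxK.
have A's : A'^T = A'.
  rewrite /A' trmx_drsub; exact: (congr1 (fun M : 'M[R]_(1 + n) => drsubmx M) Bs).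
have cA' : char_poly A' = \prod_(i < n) ('X - (e (lift 0 i))%:P).
  have pB : char_poly B = ('X - (e 0)%:P) * char_poly A'.
    by rewrite BE; exact: char_poly_lift.
  have := char_poly_conj A U1; rewrite -/B pB cA big_ord_recl.
  by apply: mulfI; rewrite polyXsubC_eq0.
have [V V1 VA] := IH A' _ A's cA'.
pose V' : 'M[R]_(1 + n) := block_mx 1%:M 0 0 V.
have V'1 : V'^T *m V' = 1%:M.
  rewrite /V' tr_block_mx mulmx_block !trmx0 trmx1 !mulmx0 !mul0mx mulmx1 V1.
  by rewrite !addr0 add0r -scalar_mx_block.
have V'B : V'^T *m block_mx (e 0)%:M 0 0 A' *m V' = block_mx (e 0)%:M 0 0 (diag_mx (\row_i e (lift 0 i))).
  rewrite /V' tr_block_mx !mulmx_block !trmx0 trmx1 !mulmx0 !mul0mx.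
  by rewrite mulmx1 mul1mx !addr0 !add0r !mul0mx VA.
exists (U *m (V' : 'M[R]_n.+1)).
  by rewrite trmx_mul -mulmxA (mulmxA U^T) U1 mul1mx; exact: V'1.
rewrite trmx_mul; transitivity ((V' : 'M[R]_n.+1)^T *m B *m V').
  by rewrite /B !mulmxA.
rewrite BE; apply: etrans V'B _.
apply/matrixP => i j; rewrite [RHS]mxE [X in _ = X *+ _]mxE.
case: (split_ordP i) => k ->; case: (split_ordP j) => l ->;
  rewrite ?block_mxEul ?block_mxEur ?block_mxEdl ?block_mxEdr ?mxE.
- by rewrite !ord1 !eqxx; congr (e _ *+ _); apply/val_inj.
- by rewrite -val_eqE /= ord1.
- by rewrite -val_eqE /= ord1.
- by rewrite -val_eqE /=; congr (e _ *+ _); apply/val_inj.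
Qed.

End spectral.

(** * Projections, the nuclear norm, and the atomic weight of the error *)

Section projections.
Context (R : realType).

Lemma ip_trace (p q : nat) (A B : 'M[R]_(p, q)) : ip A B = \tr (A^T *m B).
Proof.
rewrite /ip exchange_big; apply: eq_bigr => j _; rewrite mxE.
by apply: eq_bigr => i _; rewrite mxE.
Qed.

Lemma ip_col (p q : nat) (A B : 'M[R]_(p, q)) j :
  ip (col j A) (col j B) = (A^T *m B) j j.
Proof.
rewrite /ip exchange_big big_ord1 mxE.
by apply: eq_bigr => i _; rewrite !mxE.
Qed.

Lemma frob_tr (p q : nat) (A : 'M[R]_(p, q)) : frob A^T = frob A.
Proof.
rewrite /frob exchange_big; congr Num.sqrt.
by apply: eq_bigr => i _; apply: eq_bigr => j _; rewrite mxE.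
Qed.

Definition orth_proj (n : nat) (P : 'M[R]_n) := P^T = P /\ P *m P = P.

Lemma orth_projC (n : nat) (P : 'M[R]_n) : orth_proj P -> orth_proj (1%:M - P).
Proof.
move=> [Pt PP]; split; first by rewrite linearB /= trmx1 Pt.
by rewrite mulmxBl mul1mx mulmxBr mulmx1 PP subrr subr0.
Qed.

Lemma frob_proj (n q : nat) (P : 'M[R]_n) (A : 'M[R]_(n, q)) :
  orth_proj P -> frob (P *m A) <= frob A.
Proof.
move=> [Pt PP].
have h : frob (P *m A) ^+ 2 <= frob A * frob (P *m A).
  apply: le_trans (ip_le _ _); rewrite frob_ip !ip_trace trmx_mul Pt.
  by rewrite -mulmxA (mulmxA P P) PP.
have := frob_ge0 (P *m A); rewrite le_eqVlt => /predU1P[<-|p]; first exact: frob_ge0.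
by move: h; rewrite expr2 ler_pM2r.
Qed.

(** The projection is B^T (B B^T)^-1 B. The Gram matrix is invertible because K B B^T = 0 forces |K
    B|_F = 0. *)
Lemma row_free_proj (k n : nat) (B : 'M[R]_(k, n)) : row_free B ->
  exists P : 'M[R]_n, [/\ orth_proj P, B *m P = B & \tr P = k%:R].
Proof.
move=> Bf; pose G := B *m B^T.
have Gu : G \in unitmx.
  rewrite -row_free_unit -kermx_eq0; set K := kermx G.
  have KG : K *m G = 0 by exact: mulmx_ker.
  have KB : K *m B = 0.
    apply: frob_eq0; apply/eqP; rewrite -sqrf_eq0 -frob_tr frob_ip ip_trace trmxK.
    by rewrite trmx_mul mulmxA -(mulmxA K) -/G KG mul0mx linear0.
  by apply/eqP; apply: (row_free_inj Bf); rewrite /= mul0mx.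
have Gt : (invmx G)^T = invmx G by rewrite trmx_inv /G trmx_mul trmxK.
exists (B^T *m invmx G *m B); split.
- split; first by rewrite trmx_mul [(B^T *m _)^T]trmx_mul trmxK Gt mulmxA.
  by rewrite !mulmxA -(mulmxA (B^T *m invmx G) B B^T) -/G mulmxKV.
- by rewrite !mulmxA -/G mulmxV// mul1mx.
- by rewrite mxtrace_mulC mulmxA -/G mulmxV// mxtrace1.
Qed.

Lemma row_space_proj (n : nat) (M : 'M[R]_n) : exists P : 'M[R]_n,
  [/\ orth_proj P, M *m P = M & \tr P = (\rank M)%:R].
Proof.
have [P [pP BP tP]] := row_free_proj (row_base_free M).
by exists P; split => //; rewrite -[in LHS](mulmx_base M) -mulmxA BP mulmx_base.
Qed.

(** In an orthonormal basis of right singular vectors u_i the trace is the sum of the inner products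
    of Q u_i and M u_i, where |Q u_i| <= 1 and |M u_i| = s_i. Left singular vectors are thus
    avoided. *)
Lemma trace_proj_le_nuclear (n : nat) (M Q : 'M[R]_n) (nuc : R) :
  orth_proj Q -> nuclear_norm_is M nuc -> \tr (M *m Q) <= nuc.
Proof.
move=> pQ [s [[s0 cs] ->]].
have As : (M^T *m M)^T = M^T *m M by rewrite trmx_mul trmxK.
have [U U1 UA] := orthogonal_diagonalization As cs.
have UU : U *m U^T = 1%:M by exact: mulmx1C.
have -> : \tr (M *m Q) = \sum_i ip (col i (Q *m U)) (col i (M *m U)).
  under eq_bigr do rewrite ip_col.
  transitivity (\tr ((Q *m U)^T *m (M *m U))); last by [].
  have -> : (Q *m U)^T *m (M *m U) = U^T *m (Q *m M *m U) by rewrite trmx_mul pQ.1 !mulmxA.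
  by rewrite [RHS]mxtrace_mulC -(mulmxA _ U) UU mulmx1 mxtrace_mulC.
apply: ler_sum => i _; apply: le_trans (ip_le _ _) _; rewrite -[leRHS]mul1r.
have -> : frob (col i (M *m U)) = s i.
  apply/eqP; rewrite -(@eqrXn2 _ 2) ?frob_ge0// frob_ip ip_col trmx_mul.
  by rewrite -mulmxA (mulmxA M^T) mulmxA UA !mxE eqxx.
rewrite ler_wpM2r// colE -mulmxA -colE; apply: le_trans (frob_proj _ pQ) _.
by rewrite -(@ler_pXn2r _ 2) ?nnegrE ?frob_ge0// frob_ip ip_col U1 mxE eqxx expr1n.
Qed.

Lemma psd_conj (n : nat) (K A : 'M[R]_n) : psd A -> psd (K *m A *m K^T).
Proof.
move=> [As A0]; split; first by rewrite !trmx_mul trmxK As mulmxA.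
move=> v; have := A0 (K^T *m v); rewrite trmx_mul trmxK !mulmxA.
by [].
Qed.

Lemma psd1 (n : nat) : psd (1%:M : 'M[R]_n).
Proof.
split; first exact: trmx1.
move=> v; rewrite mulmx1 mxE; apply: sumr_ge0 => i _.
by rewrite mxE -expr2 sqr_ge0.
Qed.

Lemma psd_proj (n : nat) (P : 'M[R]_n) : orth_proj P -> psd P.
Proof.
by move=> [Pt PP]; have := psd_conj P (psd1 n); rewrite mulmx1 Pt PP.
Qed.

(* Polarization: 2 (Y P + P Y^T) is the difference of the positive
   semidefinite matrices (b + Y/b) P (b + Y/b)^T and (b - Y/b) P (b - Y/b)^T. *)
Lemma rep_polarized (n : nat) (P Y : 'M[R]_n) (b : R) : orth_proj P -> 0 < b ->
  rep (Y *m P + P *m Y^T) (b ^+ 2 * \tr P + frob (P *m Y^T) ^+ 2 / b ^+ 2).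
Proof.
move=> pP b0; have [Pt PP] := pP.
have KE (e : R) : (b%:M + e *: Y) *m P *m (b%:M + e *: Y)^T =
    b ^+ 2 *: P + (b * e) *: (Y *m P + P *m Y^T) + e ^+ 2 *: (Y *m P *m Y^T).
  have -> : (b%:M + e *: Y)^T = b%:M + e *: Y^T.
    by rewrite linearD /= tr_scalar_mx linearZ.
  rewrite !(mulmxDl, mulmxDr) mul_scalar_mx -!scalemxAl -!scalemxAr !mul_mx_scalar.
  by rewrite !scalerA scalerDr !addrA -!expr2 (mulrC e b).
have rK e := rep_psd (psd_conj (b%:M + e *: Y) (psd_proj pP)).
have tE (e : R) : \tr ((b%:M + e *: Y) *m P *m (b%:M + e *: Y)^T) =
    b ^+ 2 * \tr P + (b * e) * \tr (Y *m P + P *m Y^T) + e ^+ 2 * frob (P *m Y^T) ^+ 2.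
  have -> : frob (P *m Y^T) ^+ 2 = \tr (Y *m P *m Y^T).
    by rewrite frob_ip ip_trace trmx_mul trmxK Pt mulmxA -(mulmxA Y P P) PP.
  by rewrite KE [LHS]mxtraceD [X in X + _ = _]mxtraceD !mxtraceZ.
have h0 : 0 <= 2^-1 :> R by rewrite invr_ge0.
have := repZ h0 (repD (rK b^-1) (repN (rK (- b^-1)))).
rewrite !tE !KE; set Z := Y *m P + _; set V := Y *m P *m _.
have -> : 2^-1 *: (b ^+ 2 *: P + (b * b^-1) *: Z + b^-1 ^+ 2 *: V -
    (b ^+ 2 *: P + (b * - b^-1) *: Z + (- b^-1) ^+ 2 *: V)) = Z.
  rewrite sqrrN mulrN mulfV ?gt_eqF// scaleN1r scale1r opprD addrACA subrr addr0.
  rewrite opprD addrACA subrr add0r opprK scalerDr -scalerDl.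
  by rewrite (_ : 2^-1 + 2^-1 = 1) ?scale1r//; lra.
suff -> : 2^-1 * (b ^+ 2 * \tr P + b * b^-1 * \tr Z + b^-1 ^+ 2 * frob (P *m Y^T) ^+ 2 +
    (b ^+ 2 * \tr P + b * - b^-1 * \tr Z + (- b^-1) ^+ 2 * frob (P *m Y^T) ^+ 2)) =
    b ^+ 2 * \tr P + frob (P *m Y^T) ^+ 2 / b ^+ 2 by [].
by field; rewrite gt_eqF.
Qed.

(** The coefficient 1/2 shares the block P H P equally between two terms; for symmetric [H] they are
    Y P and its transpose P Y^T with Y = (1 - P/2) H, the shape of [rep_polarized]. *)
Lemma proj_split (n : nat) (P H : 'M[R]_n) :
  H = (1%:M - P) *m H *m (1%:M - P) +
    ((1%:M - 2^-1 *: P) *m H *m P + P *m (H *m (1%:M - 2^-1 *: P))).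
Proof.
rewrite !(mulmxBl, mulmxBr, mul1mx, mulmx1) -!(scalemxAl, scalemxAr) !mulmxA.
move: (P *m H *m P) (P *m H) (H *m P) => A B C.
by apply/matrixP => i j; rewrite !mxE; field.
Qed.

Lemma half_split (n : nat) (P H : 'M[R]_n) :
  (1%:M - 2^-1 *: P) *m H = 2^-1 *: (H + (1%:M - P) *m H).
Proof.
rewrite !mulmxBl !mul1mx -scalemxAl.
move: (P *m H) => B.
by apply/matrixP => i j; rewrite !mxE; field.
Qed.

(** With Q = 1 - P, the block Q H Q costs tr (Sh Q) + tr (S Q), and tr (Sh Q) = tr H - <H, P> + tr
    (S Q) is at most sqrt r |H|_F + nuc by the trace comparison and Cauchy-Schwarz. The two terms of
    [rep_polarized] add sqrt r |H|_F each. *)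
Lemma rep_difference (n r : nat) (S Sh P : 'M[R]_n) (nuc : R) :
  psd S -> psd Sh -> \tr Sh <= \tr S -> orth_proj P -> (0 < r)%N ->
  \tr P <= r%:R -> \tr (S *m (1%:M - P)) <= nuc -> 0 < frob (Sh - S) ->
  exists2 W, rep (Sh - S) W & W <= 3 * Num.sqrt r%:R * frob (Sh - S) + 2 * nuc.
Proof.
move=> pS pSh tS pP r0 tP tQ H0; have [Pt PP] := pP.
set H := Sh - S in H0 *; set Q := 1%:M - P in tQ.
have pQ : orth_proj Q by exact: orth_projC.
have [Qt QQ] := pQ.
pose J := 1%:M - 2^-1 *: P.
have Ht : H^T = H by rewrite /H linearB /= pS.1 pSh.1.
have Jt : J^T = J by rewrite /J linearB /= trmx1 linearZ /= Pt.
have sr : 0 < Num.sqrt r%:R :> R by rewrite sqrtr_gt0 ltr0n.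
have sr2 : Num.sqrt r%:R ^+ 2 = r%:R :> R by rewrite sqr_sqrtr.
have HE : H = (Q *m Sh *m Q^T + - (Q *m S *m Q^T)) + (J *m H *m P + P *m (J *m H)^T).
  have -> : Q *m Sh *m Q^T + - (Q *m S *m Q^T) = Q *m H *m Q.
    by rewrite -mulmxBl -mulmxBr Qt.
  by rewrite trmx_mul Ht Jt; exact: proj_split.
have tPP : \tr P = frob P ^+ 2 by rewrite frob_ip ip_trace Pt PP.
have fP : frob P <= Num.sqrt r%:R.
  by rewrite -(@ler_pXn2r _ 2) ?nnegrE ?frob_ge0 ?sqrtr_ge0// sr2 -tPP.
have tr_conj (A : 'M[R]_n) : \tr (Q *m A *m Q^T) = \tr (A *m Q).
  by rewrite -mulmxA mxtrace_mulC -mulmxA Qt QQ.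
have tHQ : \tr (Sh *m Q) <= Num.sqrt r%:R * frob H + nuc.
  have -> : \tr (Sh *m Q) = \tr H - ip H P + \tr (S *m Q).
    have -> : Sh = H + S by rewrite /H subrK.
    rewrite ip_trace Ht mulmxDl mxtraceD; congr (_ + _).
    by rewrite /Q mulmxBr mulmx1 linearB.
  have hP : - ip H P <= Num.sqrt r%:R * frob H.
    have -> : - ip H P = ip H ((-1) *: P) by rewrite ipZr mulN1r.
    apply: le_trans (ip_le _ _) _; rewrite frobZ normrN normr1 mul1r mulrC.
    by rewrite ler_wpM2r// ltW.
  have tH : \tr H <= 0 by rewrite /H linearB /= subr_le0.
  by move: tQ hP tH; lra.
have fY : frob (P *m (J *m H)^T) <= frob H.
  apply: le_trans (frob_proj _ pP) _; rewrite frob_tr.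
  have -> : J *m H = 2^-1 *: (H + Q *m H).
    exact: half_split.
  rewrite frobZ ger0_norm ?invr_ge0// mulrC ler_pdivrMr//.
  have := frobD H (Q *m H); have := frob_proj H pQ; lra.
(* This choice balances b^2 r against |H|_F^2 / b^2. *)
pose b := Num.sqrt (frob H / Num.sqrt r%:R).
have b0 : 0 < b by rewrite sqrtr_gt0 divr_gt0.
have b2 : b ^+ 2 = frob H / Num.sqrt r%:R by rewrite sqr_sqrtr// ltW// divr_gt0.
have := repD (repD (rep_psd (psd_conj Q pSh)) (repN (rep_psd (psd_conj Q pS))))
  (rep_polarized (J *m H) pP b0).
rewrite -HE !tr_conj => rH; eexists; first exact: rH.
have h1 : b ^+ 2 * \tr P <= Num.sqrt r%:R * frob H.
  rewrite b2 mulrAC ler_pdivrMr// [leRHS]mulrAC -expr2 sr2 mulrC.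
  by rewrite ler_wpM2r// ltW.
have h2 : frob (P *m (J *m H)^T) ^+ 2 / b ^+ 2 <= Num.sqrt r%:R * frob H.
  rewrite ler_pdivrMr ?exprn_gt0// b2 mulrA.
  have -> : Num.sqrt r%:R * frob H * frob H / Num.sqrt r%:R = frob H ^+ 2.
    by field; rewrite gt_eqF.
  by rewrite ler_pXn2r ?nnegrE ?frob_ge0.
by move: tHQ tQ h1 h2; lra.
Qed.

End projections.

(** * The paired functional and its uniform control on a finite family *)

Section paired_l1.
Context (R : realType) (m n p : nat) (a : 'I_m -> 'cV[R]_n) (i1 i2 : 'I_p -> 'I_m).

Definition paired_l1 (M : 'M[R]_n) : R :=
  \sum_k `|meas a M (i1 k) - meas a M (i2 k)|.

Lemma measD A B i : meas a (A + B) i = meas a A i + meas a B i.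
Proof. by rewrite /meas mulmxDr mulmxDl mxE. Qed.

Lemma measZ c A i : meas a (c *: A) i = c * meas a A i.
Proof. by rewrite /meas -scalemxAr -scalemxAl mxE. Qed.

Lemma measB A B i : meas a (A - B) i = meas a A i - meas a B i.
Proof. by rewrite -scaleN1r measD measZ mulN1r. Qed.

Lemma paired_l1D A B : paired_l1 (A + B) <= paired_l1 A + paired_l1 B.
Proof.
rewrite -big_split; apply: ler_sum => k _ /=.
by rewrite !measD opprD addrACA ler_normD.
Qed.

Lemma paired_l1Z c A : 0 <= c -> paired_l1 (c *: A) = c * paired_l1 A.
Proof.
move=> c0; rewrite mulr_sumr; apply: eq_bigr => k _.
by rewrite !measZ -mulrBr normrM ger0_norm.
Qed.

Lemma paired_l1_le (M : 'M[R]_n) : injective i1 -> injective i2 ->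
  (forall k l, i1 k != i2 l) -> paired_l1 M <= l1norm (meas a M).
Proof.
move=> j1 j2 i12.
apply: (@le_trans _ _ (\sum_k `|meas a M (i1 k)| + \sum_k `|meas a M (i2 k)|)).
  by rewrite -big_split; apply: ler_sum => k _; exact: ler_normB.
pose g (x : 'I_p + 'I_p) := match x with inl k => i1 k | inr k => i2 k end.
have jg : injective g.
  move=> [k|k] [l|l] /=; first by move/j1 => ->.
  - by move/eqP; rewrite (negbTE (i12 _ _)).
  - by move/esym/eqP; rewrite (negbTE (i12 _ _)).
  - by move/j2 => ->.
have -> : \sum_k `|meas a M (i1 k)| + \sum_k `|meas a M (i2 k)| = \sum_x `|meas a M (g x)|.
  by rewrite big_sumType.
rewrite -(big_map g predT (fun i => `|meas a M i|)) /l1norm.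
rewrite big_uniq ?map_inj_uniq ?index_enum_uniq//= [leRHS](bigID (mem (map g (index_enum _)))) /=.
by rewrite lerDl; apply: sumr_ge0.
Qed.

End paired_l1.

(** A union bound: the length of the list enters the probability only, while [c], [C] and [c']
    remain those of a single matrix. *)
Lemma rip_seq (R : realType) (mu : probability R R) : entry_law mu ->
  exists c C c' : R, [/\ 0 < c, 0 < C & 0 < c'] /\
  forall (m n p : nat) (d : measure_display) (T : measurableType d)
    (P : probability T R) (X : 'I_m * 'I_n -> {RV P >-> R}),
  mutually_independent X -> (forall k, has_law (X k) mu) ->
  forall i1 i2 : 'I_p -> 'I_m, injective i1 -> injective i2 ->
  (forall k l, i1 k != i2 l) ->
  forall s : seq 'M[R]_n, (forall M, M \in s -> M^T = M) ->
  exists G : set T, [/\ measurable G,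
    (P (~` G) <= ((size s)%:R * (2 * expR (- (c' * p%:R))))%:E)%E &
    forall w, G w -> let a i := \col_j X (i, j) w in forall M, M \in s ->
      c * p%:R * frob M <= paired_l1 a i1 i2 M <= C * p%:R * frob M].
Proof.
move=> /rip_fixed[c [C [c' [c0 rip]]]]; exists c, C, c'; split => //.
move=> m n p d T P X indX lawX i1 i2 j1 j2 i12; elim => [|M s IH] sym.
  by exists setT; split; rewrite // setCT measure0 mul0r.
have [M' s'|G [mG PG hG]] := IH; first by apply: sym; rewrite inE s' orbT.
have sM : M^T = M by apply: sym; rewrite mem_head.
have [G' [mG' PG' hG']] := rip m n p d T P X indX lawX i1 i2 j1 j2 i12 M sM.
exists (G' `&` G); split; first exact: measurableI.
  rewrite setCI; apply: le_trans (measureU2 _ _ _) _; try exact: measurableC.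
  by rewrite /= -natr1 mulrDl mul1r addrC EFinD leeD.
move=> w [wG' wG] a M'; rewrite inE => /predU1P[->|]; last exact: hG.
by apply/andP; exact: hG'.
Qed.

Lemma pair_indices (m : nat) : exists i1 i2 : 'I_(m./2) -> 'I_m,
  [/\ injective i1, injective i2 & forall k l, i1 k != i2 l].
Proof.
have h1 (k : 'I_(m./2)) : (k < m)%N.
  by rewrite (leq_trans (ltn_ord k))// -{2}(odd_double_half m) -addnn addnA leq_addl.
have h2 (k : 'I_(m./2)) : (m./2 + k < m)%N.
  by rewrite -[X in (_ < X)%N](odd_double_half m) -addnn addnA -addnS leq_add ?leq_addl.
exists (fun k => Ordinal (h1 k)), (fun k => Ordinal (h2 k)); split.
- by move=> k l [] /val_inj.
- by move=> k l [] /addnI/val_inj.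
- move=> k l; apply/eqP => -[] kl; have := ltn_ord k.
  by rewrite {1}kl ltnNge leq_addr.
Qed.

Lemma residual_l1 (R : realType) (m n : nat) (a : 'I_m -> 'cV[R]_n) (S Sh : 'M[R]_n)
    (eps1 : R) (eta : 'I_m -> R) :
  l1norm eta <= eps1 ->
  l1norm (fun i => meas a S i + eta i - meas a Sh i) <= eps1 ->
  l1norm (meas a (Sh - S)) <= 2 * eps1.
Proof.
move=> h1 h2; have -> : 2 * eps1 = eps1 + eps1 by ring.
apply: le_trans (lerD h1 h2); rewrite -big_split; apply: ler_sum => i _ /=.
rewrite measB -normrN.
have -> : - (meas a Sh i - meas a S i) = - eta i + (meas a S i + eta i - meas a Sh i) by ring.
by apply: le_trans (ler_normD _ _) _; rewrite normrN.
Qed.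

(** * Deterministic recovery and choice of constants *)

(** The weight bound of [rep_difference] turns the Maurey error into at most p K (3 h + 2 z), with h
    = |Sh - S|_F and z = nuc / sqrt r. Since 6 K <= c, this is at most p c (h + z) / 2, and half of
    the left side absorbs the term in h. *)
Lemma recovery_bound (R : realType) (n r : nat) (S Sh Sr : 'M[R]_n)
    (f : 'M[R]_n -> R) (c p K eps1 nuc : R) :
  (forall H W, rep H W -> c * p * frob H <= f H + p * K * W / Num.sqrt r%:R) ->
  0 < c -> 0 < p -> 0 <= K -> 6 * K <= c -> (0 < r)%N ->
  psd S -> psd Sh -> \tr Sh <= \tr S -> (\rank Sr <= r)%N ->
  nuclear_norm_is (S - Sr) nuc -> 0 <= eps1 -> f (Sh - S) <= 2 * eps1 ->
  frob (Sh - S) <= nuc / Num.sqrt r%:R + 4 * eps1 / (c * p).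
Proof.
move=> lower c0 p0 K0 Kc r0 pS pSh tS rk nucE e0 fH.
have sr : 0 < Num.sqrt r%:R :> R by rewrite sqrtr_gt0 ltr0n.
have nuc0 : 0 <= nuc by have [s [[s0 _] ->]] := nucE; exact: sumr_ge0.
have cp : 0 < c * p by exact: mulr_gt0.
have := frob_ge0 (Sh - S); rewrite le_eqVlt => /predU1P[<-|H0].
  by apply: addr_ge0; apply: divr_ge0; rewrite ?sqrtr_ge0 ?(ltW cp) ?mulr_ge0.
have [P [pP SP tP]] := row_space_proj Sr.
have tPr : \tr P <= r%:R by rewrite tP ler_nat.
have tQ : \tr (S *m (1%:M - P)) <= nuc.
  have -> : S *m (1%:M - P) = (S - Sr) *m (1%:M - P).
    by rewrite [RHS]mulmxBl [Sr *m _]mulmxBr mulmx1 SP subrr subr0.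
  exact: trace_proj_le_nuclear (orth_projC pP) nucE.
have [W rW Wle] := rep_difference pS pSh tS pP r0 tPr tQ H0.
have := lower _ _ rW; move: (frob (Sh - S)) H0 Wle fH => h h0 Wle fH low.
have Ws : W / Num.sqrt r%:R <= 3 * h + 2 * (nuc / Num.sqrt r%:R).
  rewrite ler_pdivrMr//; apply: le_trans Wle _.
  by rewrite [leRHS]mulrDl -[X in _ <= _ + X]mulrA divfK ?gt_eqF// lerD2r mulrAC.
set z := nuc / _ in Ws *; have z0 : 0 <= z by rewrite divr_ge0 ?sqrtr_ge0.
have : c * p * h <= 2 * eps1 + p * (c / 2 * h + c / 2 * z).
  apply: le_trans low _; apply: lerD => //; rewrite -!mulrA ler_wpM2l ?(ltW p0)//.
  apply: (@le_trans _ _ (K * (3 * h + 2 * z))); first by rewrite ler_wpM2l.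
  have := ler_wpM2r (ltW h0) Kc; have := ler_wpM2r z0 Kc.
  by have := mulr_ge0 K0 z0; lra.
move=> hh; rewrite -lerBlDl ler_pdivlMr//; move: hh; lra.
Qed.

(** There are at most 2 * 48^(2 n) atoms, hence at most 48^(3 n) <= exp(144 n) as n > 0; a pair of
    samples doubles the exponent. The option adds the single sums to the differences. *)
Lemma card_sample_pairs (R : realType) (n N : nat) : (0 < n)%N ->
  #|{: {ffun 'I_N -> atom_idx n} * option {ffun 'I_N -> atom_idx n}}|%:R <=
  2 * expR (288 * (n * N)%:R) :> R.
Proof.
move=> n0; rewrite card_prod card_option card_ffun card_ord natrM -natr1 natrX.
pose b : R := expR (144 * (n * N)%:R).
have b1 : 1 <= b by rewrite -expR0 ler_expR mulr_ge0.
have h48 : 48 <= expR 48 :> R by apply: le_trans (expR_ge1Dx 48); lra.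
have hb : (#|{: atom_idx n}|%:R : R) ^+ N <= b.
  have -> : b = (expR 48 ^+ (3 * n)) ^+ N.
    by rewrite -exprM -expRM_natr /b; congr expR; rewrite !natrM; ring.
  rewrite lerXn2r ?nnegrE ?exprn_ge0 ?expR_ge0//.
  apply: le_trans (card_atom_idx R n) _.
  have -> : expR 48 ^+ (3 * n) = expR 48 ^+ n * (expR 48 ^+ n) ^+ 2 :> R.
    by rewrite -exprM -exprD; congr (_ ^+ _); rewrite mulnC; lia.
  have x0 : 0 <= 48 ^+ n :> R by rewrite exprn_ge0.
  have x48 : 48 ^+ n <= expR 48 ^+ n :> R by rewrite lerXn2r ?nnegrE ?expR_ge0.
  apply: ler_pM => //.
    by apply: le_trans x48; apply: le_trans (ler_eXnr n0 _); rewrite ?ler1n// ler_nat.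
  by rewrite lerXn2r ?nnegrE// exprn_ge0 ?expR_ge0.
have -> : expR (288 * (n * N)%:R) = b * b.
  by rewrite /b -expRD; congr expR; ring.
set x := _ ^+ N in hb *; have x0 : 0 <= x by rewrite exprn_ge0.
have : x * (x + 1) <= b * (b + b) by apply: ler_pM => //; [exact: addr_ge0|exact: lerD].
by lra.
Qed.

Theorem theorem1 (R : realType) (mu : probability R R) :
  entry_law mu ->
  exists c0 c1 C0 C1 C2 : R,
    [/\ 0 < c0, 0 < c1, 0 < C0, 0 < C1 & 0 < C2] /\
    forall (n r m : nat), (0 < r)%N -> c1 * (n * r)%:R < m%:R ->
    forall (d : measure_display) (T : measurableType d) (P : probability T R)
           (X : 'I_m * 'I_n -> {RV P >-> R}),
      mutually_independent X ->
      (forall k, has_law (X k) mu) ->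
      exists E : set T, measurable E /\
        ((1 - C0 * expR (- (c0 * m%:R)))%:E <= P E)%E /\
        forall w, E w ->
          let a : 'I_m -> 'cV[R]_n := fun i => \col_j X (i, j) w in
          forall (S : 'M[R]_n), psd S ->
          forall (eps1 : R), 0 <= eps1 ->
          forall (eta : 'I_m -> R), l1norm eta <= eps1 ->
          let y := fun i => meas a S i + eta i in
          forall Sh : 'M[R]_n, is_minimizer a y eps1 Sh ->
          forall Sr : 'M[R]_n, best_rank_approx r S Sr ->
          forall nuc : R, nuclear_norm_is (S - Sr) nuc ->
            frob (Sh - S) <= C1 * nuc / Num.sqrt r%:R + C2 * eps1 / m%:R.
Proof.
move=> /rip_seq[c [C [c' [[c0 C0 c'0] rip]]]].
(* N = L r atoms are sampled; sqrt L >= 48 C / c is the condition 6 K <= c for K = 8 C / sqrt L. *)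
pose L := Num.bound ((48 * C / c) ^+ 2).
have Lb : (48 * C / c) ^+ 2 <= L%:R by apply/ltW/archi_boundP; exact: sqr_ge0.
have L0 : (0 < L)%N.
  rewrite -(ltr_nat R); apply: lt_le_trans Lb; rewrite exprn_gt0// divr_gt0//.
  by rewrite mulr_gt0.
have sL : 48 * C / c <= Num.sqrt L%:R.
  rewrite -(@ler_pXn2r _ 2) ?nnegrE ?sqrtr_ge0 ?sqr_sqrtr//.
  by apply/divr_ge0/ltW => //; rewrite mulr_ge0// ltW.
have sL0 : 0 < Num.sqrt L%:R :> R by rewrite sqrtr_gt0 ltr0n.
(* 1728 = 6 * 288: then q n r <= m gives 288 n N <= c' m / 6, while c' p >= c' m / 3, so c' m / 6 is
   left in the exponent after the union bound. *)
have [q q0 qE] : exists2 q : R, 0 <= q & q * c' = 1728 * L%:R.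
  exists (1728 * L%:R / c'); last by rewrite divfK ?gt_eqF.
  by apply/divr_ge0/ltW/c'0; apply: mulr_ge0; exact: ler0n.
(* The summand 2 forces m > 2, whence p > 0 and m <= 3 p; the latter turns 4 / (c p) into 12 / (c
   m). The 4 collects the factor 2 of the cardinality and the 2 of the two tails. *)
exists (c' / 6), (q + 2), 4, 1, (12 / c); split.
  have q2 : 0 < q + 2 by lra.
  by split; [exact: divr_gt0|exact: q2|exact: ltr0n|exact: ltr01|exact: divr_gt0].
move=> n r m r0 hm d T P X indX lawX.
(* For n = 0 the condition on m does not force m > 2, but all matrices are empty and the error is
   0. *)
have [n0|n0] := posnP n.
  exists setT; split => //; split.
    by rewrite probability_setT lee_fin gerBl mulr_ge0 ?expR_ge0.
  move=> w _ a S pS eps1 e0 eta _ y Sh _ Sr _ nuc [s [[s0 _] ->]].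
  have -> : frob (Sh - S) = 0.
    rewrite /frob big1 ?sqrtr0// => i _.
    by have := leq_ltn_trans (leq0n _) (ltn_ord i); rewrite {1}n0.
  have s'0 : 0 <= \sum_i s i by exact: sumr_ge0.
  have c12 : 0 <= 12 / c by apply: divr_ge0; [exact: ler0n|exact: ltW].
  rewrite mul1r; apply: addr_ge0; first exact/divr_ge0/sqrtr_ge0.
  by apply: divr_ge0; [exact: mulr_ge0|exact: ler0n].
have nr0 : 1 <= (n * r)%:R :> R by rewrite ler1n muln_gt0 n0.
have m2 : (2 < m)%N by rewrite -(ltr_nat R); have := ler_wpM2l q0 nr0; move: hm nr0; lra.
pose p := m./2.
have mp : m%:R <= 3 * p%:R :> R.
  rewrite -natrM ler_nat; clear -m2; move: (odd_double_half m) m2; rewrite -/p -addnn.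
  by case: (odd m); clearbody p => <-; lia.
have p0 : 0 < p%:R :> R by rewrite ltr0n /p half_gt0 ltnW.
pose N := (L * r)%N.
have N0 : (0 < N)%N by rewrite muln_gt0 L0.
have [i1 [i2 [j1 j2 i12]]] := pair_indices m.
pose idx : finType := ({ffun 'I_N -> atom_idx n} * option {ffun 'I_N -> atom_idx n})%type.
(* The family of the union bound: [None] gives an atom sum, used for the lower estimate, and
   [Some u] a difference of two sums, used for the upper one. *)
pose D (j : idx) := match j.2 with
  | None => atom_sum R j.1 | Some u => atom_sum R j.1 - atom_sum R u end.
have symS (t : {ffun 'I_N -> atom_idx n}) : (atom_sum R t)^T = atom_sum R t.
  by rewrite /atom_sum linear_sum; apply: eq_bigr => k _; exact: atom_sym.
have symD M : M \in [seq D j | j <- enum idx] -> M^T = M.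
  by move=> /mapP[[t [u|]] _ ->]; rewrite /D /= ?linearB /= !symS.
have [E [mE PE hE]] := rip m n p d T P X indX lawX i1 i2 j1 j2 i12 _ symD.
exists E; split => //; split.
  have PE' : (P (~` E) <= (4 * expR (- (c' / 6 * m%:R)))%:E)%E.
    apply: le_trans PE _; rewrite lee_fin size_map -cardE.
    apply: (@le_trans _ _ (2 * expR (288 * (n * N)%:R) * (2 * expR (- (c' * p%:R))))).
      by rewrite ler_wpM2r ?mulr_ge0 ?expR_ge0// card_sample_pairs.
    rewrite mulrACA -expRD (_ : 2 * 2 = 4); last by lra.
    rewrite ler_wpM2l// ler_expR.
    have h1 : 1728 * L%:R * (n * r)%:R <= c' * m%:R.
      have := ltW hm; rewrite mulrDl => h.
      have h3 : q * (n * r)%:R <= m%:R by move: h nr0; lra.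
      by rewrite -qE mulrAC mulrC ler_wpM2l// ltW.
    have h2 := ler_wpM2l (ltW c'0) mp.
    have -> : (n * N)%:R = L%:R * (n * r)%:R :> R by rewrite /N !natrM; ring.
    by move: h1 h2; lra.
  have := probability_setC P mE.
  have fE : P E \is a fin_num by exact: fin_num_measure.
  move: PE'; rewrite -(fineK fE) => PE' PC; move: PE'; rewrite PC -EFinB !lee_fin.
  by lra.
move=> w wE a S pS eps1 e0 eta eta1 y Sh [[pSh fSh] minSh] Sr [rk _] nuc nucE.
have hD := hE w wE; rewrite -/a in hD.
have tS : \tr Sh <= \tr S.
  apply: minSh; split => //; apply: le_trans eta1.
  by rewrite le_eqVlt; apply/orP; left; apply/eqP; apply: eq_bigr => i _; rewrite /y addrAC subrr add0r.
have inD j : D j \in [seq D j | j <- enum idx] by rewrite map_f ?mem_enum.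
pose K := 8 * C / Num.sqrt L%:R.
have K0 : 0 <= K by rewrite divr_ge0 ?mulr_ge0 ?ltW.
have Kc : 6 * K <= c.
  rewrite /K mulrA ler_pdivrMr//; move: sL; rewrite ler_pdivrMr// [_ * c]mulrC; lra.
have lower H W : rep H W ->
    c * p%:R * frob H <= paired_l1 a i1 i2 H + p%:R * K * W / Num.sqrt r%:R.
  move=> rH.
  have -> : p%:R * K * W / Num.sqrt r%:R = C * p%:R * 8 * W / Num.sqrt N%:R.
    rewrite /N natrM sqrtrM// /K; field.
    by rewrite !gt_eqF// sqrtr_gt0 ltr0n.
  apply: (empirical_lower_bound (paired_l1D a i1 i2) (@paired_l1Z _ _ _ _ a i1 i2) N0) => //.
  - by rewrite mulr_ge0 ?ltW.
  - by rewrite mulr_ge0 ?ltW.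
  - by move=> t; have /andP[] := hD _ (inD (t, None)).
  - by move=> t u; have /andP[] := hD _ (inD (t, Some u)).
have fH : paired_l1 a i1 i2 (Sh - S) <= 2 * eps1.
  exact: le_trans (paired_l1_le a _ j1 j2 i12) (residual_l1 eta1 fSh).
have := recovery_bound lower c0 p0 K0 Kc r0 pS pSh tS rk nucE e0 fH.
rewrite mul1r => /le_trans; apply; rewrite lerD2l.
have m0 : 0 < m%:R :> R by rewrite ltr0n; apply: leq_trans m2.
rewrite ler_pdivlMr// mulrAC ler_pdivrMr ?mulr_gt0//.
have -> : 12 / c * eps1 * (c * p%:R) = 4 * eps1 * (3 * p%:R) by field; rewrite gt_eqF.
by rewrite ler_wpM2l// mulr_ge0.
Qed.
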